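(* Let $n\ge 2$, let $\alpha$ be a special barrier with respect to $Y=B_R(0)\subset\mathbb{R}^n$, and let $f$ be its special augmenting function. Let $X\subset\mathbb{R}^n$ be a convex initial domain, set $D=X+iY$, and let $K_\alpha=\{x+iy\in\mathbb{R}^n+i\overline{Y}:\|x\|^2\le\alpha(x)+f(x,y)\}$ be the compact fence given by $\alpha+f$. Then the envelope of holomorphy $\mathcal{E}(S_\alpha)$ of the special domain $S_\alpha:=D\setminus K_\alpha$ is given by $$\mathcal{E}(S_\alpha)=D\setminus\widehat{K_{\alpha,\partial}},$$ where $\widehat{K_{\alpha,\partial}}$ denotes the polynomial hull of $K_{\alpha,\partial}:=K_\alpha\cap(X+ibY)$. In particular, the envelope of holomorphy is schlicht.
   Context: Notation: $z=x+iy\in\mathbb{C}^n$ with $x,y\in\mathbb{R}^n$; $\|\cdot\|$ is the Euclidean norm; $B_R(0)$ is the open ball of radius $R>0$ centered at $0$ in $\mathbb{R}^n$; $bA$ is the boundary of $A$; $A+iB=\{x+iy:x\in A,y\in B\}$. Good functions: a real-analytic function $\alpha:\mathbb{R}^n\to\mathbb{R}$ is a good $\mathcal{C}^\omega$ function if there is a holomorphic function $F_\alpha:\mathbb{C}^n\to\mathbb{C}$ with $F_\alpha|_{\mathbb{R}^n}=\alpha$; one then writes $\mathrm{Re}\,F_\alpha(x+iy)=\alpha(x)+f(x,y)$ for all $x,y\in\mathbb{R}^n$, and $f$ is called the (good) augmenting function of $\alpha$. Special barrier: a good $\mathcal{C}^\omega$ function $\alpha$ with augmenting function $f$ is a special barrier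 with respect to a convex set $Y\subset\mathbb{R}^n$ if for every fixed $y_0\in Y$ the real Hessian matrix $\left(\frac{\partial^2\left(\|x\|^2-(\alpha(x)+f(x,y_0))\right)}{\partial x_j\partial x_k}(\mathbf{x})\right)_{1\le j,k\le n}$ is positive definite for all $\mathbf{x}\in\mathbb{R}^n$; then $f$ is called a special augmenting function. Convex initial domain: a bounded strictly convex domain $X\subset\mathbb{R}^n$ with $\mathcal{C}^2$ boundary such that $K_\alpha\cap(bX+i\overline{Y})=\emptyset$. Strictly convex means that at every boundary point $p$, with $r$ a local defining function ($X=\{r<0\}$ near $p$), $\sum_{j,k}a_ja_k\frac{\partial^2 r}{\partial x_j\partial x_k}(p)>0$ for all nonzero tangent vectors $\sum_j a_j\frac{\partial}{\partial x_j}|_p\in T_p(bX)$. The polynomial hull of a compact set $K\subset\mathbb{C}^n$ is $\widehat{K}=\{z\in\mathbb{C}^n:|p(z)|\le\max_K|p|\text{ for all }p\in\mathbb{C}[z_1,\dots,z_n]\}$. For a domain $D\subset\mathbb{C}^n$, the envelope of holomorphy $\mathcal{E}(D)$ is the maximal Riemann domain over $\mathbb{C}^n$, with projection $\pi:\mathcal{E}(D)\to\mathbb{C}^n$ and canonical holomorphic embedding $\iota_D:D\hookrightarrow\mathcal{E}(D)$ satisfying $\pi\circ\iota_D=\mathrm{id}_D$, such that for every $f\in\mathcal{O}(D)$ the function $f\circ(\pi|_{\iota_D(D)})$ extends holomorphically to $\mathcal{E}(D)$. The envelope is schlicht if $\pi$ is injective, so that $\mathcal{E}(D)$ is identified with a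 domain in $\mathbb{C}^n$. *)

(* Defs.v *)
From HB Require Import structures.
From mathcomp Require Import all_boot all_order all_algebra.
From mathcomp Require Import all_classical all_reals all_analysis.
From mathcomp Require Import complex.
From mathcomp Require mpoly.

Set Implicit Arguments.
Unset Strict Implicit.
Unset Printing Implicit Defensive.

Import Order.TTheory GRing.Theory Num.Theory.
Import numFieldNormedType.Exports.

Local Open Scope classical_set_scope.
Local Open Scope ring_scope.

Section EuclideanSpace.
Variables (R : realType) (n : nat).
Implicit Types (g alpha r : 'rV[R]_n -> R) (A X : set 'rV[R]_n).

(* The library norm on 'rV[R]_n is the sup norm; it induces the same topology. *)
Definition enorm (x : 'rV[R]_n) : R := Num.sqrt (\sum_(j < n) x 0 j ^+ 2).

Definition eball (a : 'rV[R]_n) (rho : R) : set 'rV[R]_n :=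
  [set x | enorm (x - a) < rho].

Definition boundary A : set 'rV[R]_n := closure A `\` interior A.

Definition partial (j : 'I_n) g : 'rV[R]_n -> R :=
  fun x => 'D_(delta_mx 0 j) g x.

Definition hessian g (x : 'rV[R]_n) : 'M[R]_n :=
  \matrix_(j, k) partial j (partial k g) x.

Definition posdef (H : 'M[R]_n) : Prop :=
  forall v : 'rV[R]_n, v != 0 -> 0 < (v *m H *m v^T) 0 0.

Definition C1_near (p : 'rV[R]_n) g : Prop :=
  \forall x \near p, forall j,
    derivable g x (delta_mx 0 j) /\ {for x, continuous (partial j g)}.

Definition C2_near (p : 'rV[R]_n) g : Prop :=
  C1_near p g /\ forall j, C1_near p (partial j g).

(* On a neighbourhood of a, alpha is the sum of an absolutely convergent power
   series centered at a; c gives its coefficients, indexed by multi-indices,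
   and the partial sums run over the multi-indices with all entries < N. *)
Definition real_analytic_at alpha (a : 'rV[R]_n) : Prop :=
  exists c : ('I_n -> nat) -> R, \forall x \near a,
    let term (m : 'I_n -> nat) := c m * \prod_(j < n) (x - a) 0 j ^+ m j in
    cvgn (fun N => \sum_(m : {ffun 'I_n -> 'I_N}) `|term (fun j => m j)|) /\
    (fun N => \sum_(m : {ffun 'I_n -> 'I_N}) term (fun j => m j)) @ \oo
      --> alpha x.

Definition real_analytic alpha : Prop := forall a, real_analytic_at alpha a.

Definition is_domain A : Prop := [/\ open A, connected A & A !=set0].

Definition local_defining X (p : 'rV[R]_n) r : Prop :=
  [/\ C2_near p r,
      exists j, partial j r p != 0 &
      \forall x \near p, X x <-> r x < 0].

Definition C2_boundary X : Prop :=
  forall p, boundary X p -> exists r, local_defining X p r.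

Definition strictly_convex X : Prop :=
  forall p r, boundary X p -> local_defining X p r ->
  forall a : 'rV[R]_n, a != 0 -> \sum_(j < n) a 0 j * partial j r p = 0 ->
    0 < \sum_(j < n) \sum_(k < n) a 0 j * a 0 k * partial j (partial k r) p.

End EuclideanSpace.

(* R[i] as a numClosedFieldType: this sort carries the library's topology and
   normed module structure, which the bare type R[i] does not. *)
Definition Cx (R : realType) : numClosedFieldType := R[i].

Section ComplexSpace.
Variables (R : realType) (n : nat).
Implicit Types (X Y : set 'rV[R]_n) (D K : set 'rV[Cx R]_n).

Definition cvec (x y : 'rV[R]_n) : 'rV[Cx R]_n :=
  \row_j Complex (x 0 j) (y 0 j).

Definition reV (z : 'rV[Cx R]_n) : 'rV[R]_n := \row_j complex.Re (z 0 j).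
Definition imV (z : 'rV[Cx R]_n) : 'rV[R]_n := \row_j complex.Im (z 0 j).

(* The set X + iY. *)
Definition tube X Y : set 'rV[Cx R]_n := [set z | X (reV z) /\ Y (imV z)].

(* For D open: complex (Frechet) differentiability over the field Cx R.
   Values of g outside D are irrelevant. *)
Definition holomorphic_on D (g : 'rV[Cx R]_n -> Cx R) : Prop :=
  forall z, D z -> differentiable g z.

(* The maximum of |p| on K is attained, K being compact.  The hull of the
   empty set is empty. *)
Definition poly_hull K : set 'rV[Cx R]_n :=
  [set z : 'rV[Cx R]_n | forall p : mpoly.mpoly n (Cx R), exists2 w, K w &
     `|mpoly.meval (fun j => z 0 j) p| <= `|mpoly.meval (fun j => w 0 j) p|].

(* F is unique, and f is determined by alpha. *)
Definition augmenting (alpha : 'rV[R]_n -> R) (f : 'rV[R]_n -> 'rV[R]_n -> R) :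
    Prop :=
  exists F : 'rV[Cx R]_n -> Cx R,
    [/\ holomorphic_on setT F,
        forall x, F (cvec x 0) = real_complex R (alpha x) &
        forall x y, complex.Re (F (cvec x y)) = alpha x + f x y].

Definition special_barrier Y (alpha : 'rV[R]_n -> R)
    (f : 'rV[R]_n -> 'rV[R]_n -> R) : Prop :=
  [/\ real_analytic alpha,
      augmenting alpha f &
      forall y0, Y y0 -> forall x,
        posdef (hessian (fun x => enorm x ^+ 2 - (alpha x + f x y0)) x)].

Definition fence Y (alpha : 'rV[R]_n -> R) (f : 'rV[R]_n -> 'rV[R]_n -> R) :
    set 'rV[Cx R]_n :=
  [set z | closure Y (imV z) /\
           enorm (reV z) ^+ 2 <= alpha (reV z) + f (reV z) (imV z)].

Definition convex_initial_domain Y (alpha : 'rV[R]_n -> R)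
    (f : 'rV[R]_n -> 'rV[R]_n -> R) X : Prop :=
  [/\ is_domain X, bounded_set X, C2_boundary X, strictly_convex X &
      fence Y alpha f `&` tube (boundary X) (closure Y) = set0].

End ComplexSpace.

Section RiemannDomains.
Variables (R : realType) (n : nat).

(* A continuous map that is injective and open on an open set U restricts to a
   homeomorphism of U onto an open set. *)
Definition local_homeo (M N : topologicalType) (h : M -> N) : Prop :=
  continuous h /\
  forall p, exists U : set M,
    [/\ open U, U p, set_inj U h &
        forall V, open V -> V `<=` U -> open (h @` V)].

Record riemann_domain := RiemannDomain {
  rd_space :> topologicalType ;
  rd_proj : rd_space -> 'rV[Cx R]_n ;
  rd_hausdorff : hausdorff_space rd_space ;
  rd_connected : connected [set: rd_space] ;
  rd_local_homeo : local_homeo rd_proj }.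

(* Holomorphy in the charts given by the local inverses of the projection. *)
Definition rd_holomorphic (M : riemann_domain) (h : M -> Cx R) : Prop :=
  forall p : M, exists2 g : 'rV[Cx R]_n -> Cx R,
    \forall z \near rd_proj p, differentiable g z &
    \forall q \near p, h q = g (rd_proj q).

(* iota embeds the open set D over C^n (values outside D are irrelevant), and
   every g in O(D), i.e. every function g o (pi restricted to iota(D)), extends
   holomorphically to M. *)
Definition holomorphic_extension (D : set 'rV[Cx R]_n) (M : riemann_domain)
    (iota : 'rV[Cx R]_n -> M) : Prop :=
  [/\ forall z, D z -> rd_proj (iota z) = z,
      forall z, D z -> {for z, continuous iota} &
      forall g, holomorphic_on D g ->
        exists2 h : M -> Cx R, rd_holomorphic h &
          forall z, D z -> h (iota z) = g z].

(* The maximal holomorphic extension: every other one maps to it over C^n,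
   compatibly with the embeddings of D.  A continuous map over C^n between
   Riemann domains is automatically locally biholomorphic. *)
Definition is_envelope (D : set 'rV[Cx R]_n) (E : riemann_domain)
    (iota : 'rV[Cx R]_n -> E) : Prop :=
  holomorphic_extension D iota /\
  forall (M : riemann_domain) (kappa : 'rV[Cx R]_n -> M),
    holomorphic_extension D kappa ->
    exists phi : M -> E,
      [/\ continuous phi,
          forall q, rd_proj (phi q) = rd_proj q &
          forall z, D z -> phi (kappa z) = iota z].

Definition schlicht (E : riemann_domain) : Prop := injective (@rd_proj E).

End RiemannDomains.

(* Main.v *)
Require Import Defs.
From mathcomp Require mpoly.
Import -(notations) mpoly.
From HB Require Import structures.
From mathcomp Require Import all_boot all_order all_algebra.
From mathcomp Require Import all_classical all_reals all_analysis.
From mathcomp Require Import complex.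
From mathcomp Require Import ring lra.

Set Implicit Arguments.
Unset Strict Implicit.
Unset Printing Implicit Defensive.

Import Order.TTheory GRing.Theory Num.Theory numFieldNormedType.Exports.

Local Open Scope classical_set_scope.
Local Open Scope ring_scope.

(** Write z = x + i y and let F be the entire function with Re F = alpha + f. The entire
    function g z = z.z - F z + rho^2 satisfies Re g = |x|^2 - (alpha + f) + (rho^2 - |y|^2).
    In terms of g, the special domain S is the part of the tube D where Re g > rho^2 -
    |y|^2, and the part K_b of the fence over the sphere |y| = rho is where Re g <= 0. Let W
    be the part of D where Re g > 0; it contains S. Both sides of the asserted equality are
    W.

    Extension from S to W (local_extension, local_step, extension). Suppose that h has been
    extended to an open U between S and D such that the real slices (y fixed) of D \ U are
    convex, and that U misses a point of W. For small ep > 0 the function Re g + ep |z|^2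
    has a maximum on the rest of D \ U at a point z0 that lies inside D: near bX the fence
    is absent, and over |y| = rho the function is too small. By Taylor's formula D \ U lies,
    near z0, in the set {q <= - de |v|^2} of a quadratic function q with Levi form a
    positive multiple of the identity, and a small translation makes the linear part of q
    different from 0. As n >= 2, the kernel of the linear part contains a complex line,
    which can be bent into an analytic disc that stays in {q > 0} except for its centre z0.
    Cauchy integrals over the translates of this disc extend h to a neighbourhood of z0. The
    Hessian condition makes q strictly convex in the real directions; therefore a small cap
    around z0 can be added to U without destroying the convexity of the slices of the
    complement, and the extension agrees with h on the cap, since the points of U in the cap
    can be joined inside U to points where it does. Zorn's lemma gives U that contains W.

    The hull of K_b (hull_contains_fence, hull_avoids). Let Re g z0 <= 0 and suppose that
    |P| is smaller on K_b than at z0. A maximum of |P|^2 + ep |z|^2 on the level set of g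
    through z0 lies inside D, and the same local analysis extends 1 / (g - g z0) across a
    point of the level set, which is absurd. If Re g z0 > 0, then g + L, with L large, is
    larger in modulus at z0 than on K_b, where Re g <= 0, and so is a polynomial close to
    it.

    W is connected (hull_domain_connected): X is convex (tietze), and over a fixed y the
    slice of W is the complement in X of a compact convex set, so it is the union of
    half-space pieces of X, which move continuously with y and with the normal of the
    half-space.

    Envelope (schlicht_envelope). Each point outside W is a zero of an entire function
    without zeros on S: g minus its value, or a linear function supporting the convex tube
    D. Its inverse on S does not extend past the point, so every Riemann domain to which all
    functions of S extend projects into W. Thus W is an envelope, and any other one is
    isomorphic to it because lifts are unique. *)

(** * Real-valued norms, continuity and differentials over the complex numbers *)

Section RealNorm.
Variable R : realType.
Notation C := (Cx R).
Notation rc := (real_complex R).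

(** The norm of a normed space over C takes its values in C. Its real part carries the same
    information and is what real inequalities apply to. *)
Definition rnorm (V : normedModType C) (v : V) : R := complex.Re `|v|.

Lemma normE (V : normedModType C) (v : V) : `|v| = rc (rnorm v) :> C.
Proof.
have : 0 <= `|v| :> C by exact: normr_ge0.
by rewrite /rnorm; case: (`|v|) => a b; rewrite lecE /= => /andP[/eqP -> _].
Qed.

Section V.
Variable V : normedModType C.
Implicit Types u v w : V.

Lemma rnorm_ge0 v : 0 <= rnorm v.
Proof. by rewrite -lecR -normE; exact: normr_ge0. Qed.

Lemma rnormD u v : rnorm (u + v) <= rnorm u + rnorm v.
Proof. by rewrite -lecR rmorphD /= -!normE ler_normD. Qed.

Lemma rnormN v : rnorm (- v) = rnorm v.
Proof. by rewrite /rnorm normrN. Qed.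

Lemma rnormB u v : rnorm (u - v) <= rnorm u + rnorm v.
Proof. by rewrite -[rnorm v]rnormN rnormD. Qed.

Lemma rnormZ (c : C) v : rnorm (c *: v) = rnorm (c : C^o) * rnorm v.
Proof. by apply: (@complexI R); rewrite rmorphM /= -!normE normrZ. Qed.

Lemma rnorm0 : rnorm (0 : V) = 0.
Proof. by rewrite /rnorm normr0. Qed.

Lemma rnorm_eq0 v : (rnorm v == 0) = (v == 0).
Proof.
rewrite -[v == 0]normr_eq0 normE.
by apply/eqP/eqP => [->//|]; exact: (@complexI R).
Qed.

Lemma rnorm_gt0 v : (0 < rnorm v) = (v != 0).
Proof. by rewrite lt_def rnorm_eq0 rnorm_ge0 andbT. Qed.

Lemma rnorm_distC u v : rnorm (u - v) = rnorm (v - u).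
Proof. by rewrite /rnorm distrC. Qed.

Lemma rnorm_triB u v : rnorm u <= rnorm (u - v) + rnorm v.
Proof. by rewrite -{1}(subrK v u) rnormD. Qed.

Lemma near_rnormP (z : V) (P : V -> Prop) :
  (\forall w \near z, P w) <->
  exists2 e : R, 0 < e & forall w, rnorm (w - z) < e -> P w.
Proof.
split.
  move=> /nbhs_normP[e /= e0 H].
  have eR : e = rc (complex.Re e).
    by move: e0; case: (e) => a b; rewrite ltcE /= => /andP[/eqP -> _].
  exists (complex.Re e); first by move: e0; rewrite {1}eR ltcR.
  move=> w wz; apply: H; rewrite /ball_ /= normE eR ltcR rnorm_distC //.
move=> [e e0 H]; apply/nbhs_normP; exists (rc e) => /=; first by rewrite ltcR.
by move=> w; rewrite /= normE ltcR rnorm_distC => /H.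
Qed.

Lemma continuous_rnormP (T : topologicalType) (f : T -> V) (x : T) :
  {for x, continuous f} <->
  forall e : R, 0 < e -> \forall y \near x, rnorm (f y - f x) < e.
Proof.
split => [cf e e0|H].
  have : \forall w \near f x, rnorm (w - f x) < e by apply/near_rnormP; exists e.
  by move/cf.
apply/cvgrPdist_lt => e e0.
have eR : e = rc (complex.Re e).
  by move: e0; case: (e) => a b; rewrite ltcE /= => /andP[/eqP -> _].
have : 0 < complex.Re e by move: e0; rewrite eR ltcR.
move=> /H; apply: filterS => y; rewrite rnorm_distC eR normE.
by rewrite ltcR.
Qed.

End V.

Lemma rnormM (a b : C) : rnorm (a * b) = rnorm a * rnorm b.
Proof. by apply: (@complexI R); rewrite rmorphM /= -!normE normrM. Qed.

Lemma rnormV (a : C) : rnorm a^-1 = (rnorm a)^-1.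
Proof. by apply: (@complexI R); rewrite fmorphV /= -!normE normfV. Qed.

Lemma rnormX (a : C) n : rnorm (a ^+ n) = rnorm a ^+ n.
Proof. by apply: (@complexI R); rewrite rmorphXn /= -!normE normrX. Qed.

Lemma rnorm1 : rnorm (1 : C) = 1.
Proof. by rewrite /rnorm normr1. Qed.

Lemma rnormE (z : C) :
  rnorm z = Num.sqrt (complex.Re z ^+ 2 + complex.Im z ^+ 2).
Proof. by rewrite /rnorm normc_def. Qed.

Lemma rnorm_sqr (z : C) : rnorm z ^+ 2 = complex.Re z ^+ 2 + complex.Im z ^+ 2.
Proof. by rewrite rnormE sqr_sqrtr // addr_ge0 // sqr_ge0. Qed.

Lemma rnorm_rc (a : R) : rnorm (rc a : C) = `|a|.
Proof. by rewrite rnormE /= expr0n addr0 sqrtr_sqr. Qed.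

Lemma Re_le (z : C) : `|complex.Re z| <= rnorm z.
Proof.
by rewrite rnormE -sqrtr_sqr ler_wsqrtr // lerDl sqr_ge0.
Qed.

Lemma Im_le (z : C) : `|complex.Im z| <= rnorm z.
Proof.
by rewrite rnormE -sqrtr_sqr ler_wsqrtr // lerDr sqr_ge0.
Qed.

Lemma rnorm_le (z : C) : rnorm z <= `|complex.Re z| + `|complex.Im z|.
Proof.
rewrite -(@ler_pXn2r _ 2) ?nnegrE ?addr_ge0 ?rnorm_ge0 // rnorm_sqr.
rewrite sqrrD !real_normK ?num_real // lerD2r lerDl.
by rewrite mulrn_wge0 // mulr_ge0.
Qed.

Lemma CReD (z w : C) : complex.Re (z + w) = complex.Re z + complex.Re w.
Proof. by case: z w => [a b] [c d]. Qed.
Lemma CImD (z w : C) : complex.Im (z + w) = complex.Im z + complex.Im w.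
Proof. by case: z w => [a b] [c d]. Qed.
Lemma CReN (z : C) : complex.Re (- z) = - complex.Re z.
Proof. by case: z. Qed.
Lemma CImN (z : C) : complex.Im (- z) = - complex.Im z.
Proof. by case: z. Qed.
Lemma CReM (z w : C) : complex.Re (z * w) =
  complex.Re z * complex.Re w - complex.Im z * complex.Im w.
Proof. by case: z w => [a b] [c d]. Qed.
Lemma CImM (z w : C) : complex.Im (z * w) =
  complex.Re z * complex.Im w + complex.Im z * complex.Re w.
Proof. by case: z w => [a b] [c d]. Qed.

Lemma cplx_eq (z w : C) : complex.Re z = complex.Re w ->
  complex.Im z = complex.Im w -> z = w.
Proof. by case: z w => [a b] [c d] /= -> ->. Qed.

Lemma continuous_normP (T : topologicalType) (f : T -> R) (x : T) :
  {for x, continuous f} <->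
  forall e : R, 0 < e -> \forall y \near x, `|f y - f x| < e.
Proof.
split => [/cvgrPdist_lt cf e e0|H].
  by have := cf _ e0; apply: filterS => y; rewrite distrC.
by apply/cvgrPdist_lt => e e0; have := H _ e0; apply: filterS => y; rewrite distrC.
Qed.

Lemma Re_cont : continuous (@complex.Re R : C -> R).
Proof.
move=> z; apply/continuous_normP => e e0.
apply/(@near_rnormP (C : normedModType C)); exists e => // w wz.
by apply: le_lt_trans wz; rewrite -CReN -CReD Re_le.
Qed.

Lemma Im_cont : continuous (@complex.Im R : C -> R).
Proof.
move=> z; apply/continuous_normP => e e0.
apply/(@near_rnormP (C : normedModType C)); exists e => // w wz.
by apply: le_lt_trans wz; rewrite -CImN -CImD Im_le.
Qed.

Lemma cont_Complex (T : topologicalType) (f g : T -> R) (x : T) :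
  {for x, continuous f} -> {for x, continuous g} ->
  {for x, continuous (fun y => Complex (f y) (g y) : C)}.
Proof.
move=> /cvgrPdist_lt cf /cvgrPdist_lt cg; apply/(@continuous_rnormP (C : normedModType C)) => e e0.
have e2 : 0 < e / 2 by rewrite divr_gt0.
have := cf _ e2; have := cg _ e2; apply: filterS2 => y gy fy.
apply: le_lt_trans (rnorm_le _) _; rewrite /= [e]splitr.
by rewrite ltrD // distrC.
Qed.

Section diff.
Variable V : normedModType C.
Implicit Types (f : V -> C) (z v : V).

Lemma differential_estimate f z : differentiable f z -> forall e : R, 0 < e ->
  exists2 d : R, 0 < d & forall v, rnorm v < d ->
    rnorm (f (z + v) - f z - 'd f z v) <= e * rnorm v.
Proof.
move=> /diff_locallyP [_ /eqaddoP fo] e e0.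
have := fo (rc e); rewrite ltcR => /(_ e0) /near_rnormP[d d0 H].
exists d => // v vd.
have := H v; rewrite subr0 => /(_ vd); rewrite /= !normE -rmorphM lecR.
apply: le_trans; rewrite le_eqVlt; apply/orP; left; apply/eqP; congr rnorm.
by rewrite [z + v]addrC -addrA -opprD.
Qed.

Lemma differentiable_of_estimate f z (L : V -> C) : linear L -> continuous L ->
  (forall e : R, 0 < e -> exists2 d : R, 0 < d & forall v, rnorm v < d ->
    rnorm (f (z + v) - f z - L v) <= e * rnorm v) ->
  differentiable f z /\ 'd f z = L :> (V -> C).
Proof.
move=> lL cL H.
pose L' : {linear V -> C} := HB.pack L (GRing.isLinear.Build C V C *:%R L lL).
have fo : f \o shift z = cst (f z) + L' +o_ (0 : V) id.
  apply/eqaddoP => e e0.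
  have eR : e = rc (complex.Re e).
    by move: e0; case: (e) => a b; rewrite ltcE /= => /andP[/eqP -> _].
  have e0' : 0 < complex.Re e by move: e0; rewrite eR ltcR.
  have [d d0 {}H] := H _ e0'.
  apply/near_rnormP; exists d => // v; rewrite subr0 => /H; rewrite /= !normE eR -rmorphM lecR.
  apply: le_trans; rewrite le_eqVlt; apply/orP; left; apply/eqP; congr rnorm.
  by rewrite [z + v]addrC -addrA -opprD.
have E : 'd f z = L' :> (V -> C) by apply: diff_unique; [exact: cL|exact: fo].
split; last exact: E.
apply/diff_locallyP; rewrite E; split; [exact: cL|exact: fo].
Qed.

Lemma bounded_linear_continuous (L : V -> C) (K : R) : linear L ->
  (forall v, rnorm (L v) <= K * rnorm v) -> continuous L.
Proof.
move=> lL HK x; apply/(@continuous_rnormP (C : normedModType C)) => e e0.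
pose L' : {linear V -> C} := HB.pack L (GRing.isLinear.Build C V C *:%R L lL).
have K1 : 0 < `|K| + 1 by rewrite ltr_pwDr.
apply/near_rnormP; exists (e / (`|K| + 1)); first by rewrite divr_gt0.
move=> w wx; have -> : L w - L x = L (w - x) by rewrite -[L]/(L' : V -> C) linearB.
apply: le_lt_trans (HK _) _.
rewrite ltr_pdivlMr // in wx; apply: le_lt_trans wx; rewrite mulrC.
by apply: ler_wpM2l; [exact: rnorm_ge0|rewrite (le_trans (ler_norm _)) // lerDl].
Qed.

Lemma diff_near_eq f g z : (\forall w \near z, f w = g w) ->
  differentiable g z -> differentiable f z /\ 'd f z = 'd g z :> (V -> C).
Proof.
move=> /near_rnormP[d0 d00 fg] gd.
apply: differentiable_of_estimate; [exact: linearP|exact: diff_continuous|move=> e e0].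
have [d dd H] := differential_estimate gd e0.
exists (Num.min d d0) => [|v]; first by rewrite lt_min dd d00.
rewrite lt_min => /andP[v1 v2]; rewrite !fg ?subrr ?rnorm0 //; first exact: H.
by rewrite addrAC subrr add0r.
Qed.

End diff.
End RealNorm.

(** * Integrals over a segment *)

Section RealIntegral.
Variable R : realType.
Implicit Types (f g : R -> R) (a b : R).

Definition cont_on (T : topologicalType) a b (f : R -> T) :=
  forall x, a <= x <= b -> {for x, continuous f}.

Definition int_seg a b f : R := \int[@lebesgue_measure R]_(x in `[a, b]) f x.

Lemma cont_on_within a b f : cont_on a b f -> {within `[a, b], continuous f}.
Proof.
move=> cf; apply/subspace_continuousP => x /=; rewrite in_itv /= => /cf.
by move=> cx; apply: cvg_within_filter.
Qed.

Lemma int_seg_integrable a b f : cont_on a b f ->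
  (@lebesgue_measure R).-integrable `[a, b] (EFin \o f).
Proof.
move=> cf; apply: continuous_compact_integrable; first exact: segment_compact.
exact: cont_on_within.
Qed.

Lemma int_segD a b f g : cont_on a b f -> cont_on a b g ->
  int_seg a b (fun x => f x + g x) = int_seg a b f + int_seg a b g.
Proof. by move=> cf cg; apply: RintegralD => //; exact: int_seg_integrable. Qed.

Lemma int_segZ a b f (l : R) : cont_on a b f ->
  int_seg a b (fun x => l * f x) = l * int_seg a b f.
Proof. by move=> cf; apply: RintegralZl => //; exact: int_seg_integrable. Qed.

Lemma int_seg_cat a m b f : a <= m <= b -> cont_on a b f ->
  int_seg a b f = int_seg a m f + int_seg m b f.
Proof.
move=> /andP[am mb] /int_seg_integrable cf.
have := @Rintegral_itvB R f (BLeft a) (BRight b) m cf.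
rewrite !bnd_simp => /(_ am mb) H.
rewrite /int_seg -[RHS]/(_ + int_seg m b f).
have -> : int_seg m b f = \int[@lebesgue_measure R]_(x in `]m, b]) f x.
  rewrite /int_seg -(@Rintegral_itv_obnd_cbnd R m) //.
  apply: integrableS cf; first exact: measurable_itv.
    exact: measurable_itv.
  by apply: subset_itvr; rewrite bnd_simp.
by rewrite -H addrC subrK.
Qed.

Lemma int_seg_cst a b (l : R) : a <= b -> int_seg a b (fun=> l) = l * (b - a).
Proof.
move=> ab; rewrite /int_seg Rintegral_cst /=; last exact: measurable_itv.
rewrite lebesgue_measure_itv /= lte_fin; case: ltP => [_ //|ba].
by rewrite (@le_anti _ _ a b) ?ab // subrr !mulr0.
Qed.

Lemma int_seg_le a b f g : cont_on a b f -> cont_on a b g ->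
  (forall x, a <= x <= b -> f x <= g x) -> int_seg a b f <= int_seg a b g.
Proof.
move=> cf cg fg; apply: le_Rintegral => //; try exact: int_seg_integrable.
Qed.

Lemma int_seg_bound a b f (B : R) : a <= b -> cont_on a b f ->
  (forall x, a <= x <= b -> `|f x| <= B) -> `|int_seg a b f| <= B * (b - a).
Proof.
move=> ab cf fB; rewrite ler_norml -mulNr -!int_seg_cst //.
have cc (l : R) : cont_on a b (fun=> l) by move=> x _; exact: cst_continuous.
by rewrite !int_seg_le// => x /fB; rewrite ler_norml => /andP[].
Qed.

Lemma is_derive_eps f t l :
  (forall e : R, 0 < e -> exists2 d : R, 0 < d & forall h, `|h| < d ->
    `|f (t + h) - f t - l * h| <= e * `|h|) -> is_derive t 1 f l.
Proof.
move=> H.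
have cv : (fun h => h^-1 *: ((f \o shift t) (h *: 1) - f t)) @ 0^' --> l.
  apply/cvgrPdist_le => e e0; have [d d0 {}H] := H _ e0.
  rewrite near_withinE; apply/nbhs_normP; exists d => // h /=.
  rewrite sub0r normrN => hd h0; rewrite /shift /= scaler1 [h + t]addrC.
  have := H _ hd; rewrite -ler_pdivrMr ?normr_gt0 // -normfV -normrM.
  apply: le_trans; rewrite -normrN le_eqVlt; apply/orP; left; apply/eqP.
  by congr (`| _ |); rewrite /GRing.scale /=; field.
by split; [apply/cvg_ex; exists l|exact: cvg_lim].
Qed.

Lemma int_seg_FTC a b f F : a <= b -> cont_on a b f ->
  (forall x, a <= x <= b -> is_derive x 1 F (f x)) -> int_seg a b f = F b - F a.
Proof.
rewrite le_eqVlt => /predU1P[<- _ _|ab cf dF].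
  by rewrite /int_seg set_itv1 Rintegral_set1 subrr.
rewrite /int_seg /Rintegral (@continuous_FTC2 _ f F) //.
- exact: cont_on_within.
- split.
  + move=> x; rewrite in_itv /= => /andP[ax xb].
    by have [] := dF x; rewrite ?(ltW ax) ?(ltW xb).
  + apply: cvg_at_right_filter; apply: differentiable_continuous.
    by apply/derivable1_diffP; have [] := dF a; rewrite ?lexx ?(ltW ab).
  + apply: cvg_at_left_filter; apply: differentiable_continuous.
    by apply/derivable1_diffP; have [] := dF b; rewrite ?lexx ?(ltW ab).
- move=> x; rewrite in_itv /= => /andP[ax xb]; rewrite derive1E.
  by have [] := dF x; rewrite ?(ltW ax) ?(ltW xb).
Qed.

End RealIntegral.

Section ComplexIntegral.
Variable R : realType.
Notation C := (Cx R).
Notation rc := (real_complex R).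
Implicit Types (f g : R -> C) (a b : R).

Definition cint_seg a b f : C :=
  Complex (int_seg a b (fun x => complex.Re (f x))) (int_seg a b (fun x => complex.Im (f x))).

Lemma cont_on_Re a b f : cont_on a b f -> cont_on a b (fun x => complex.Re (f x)).
Proof. by move=> cf x /cf cx; apply: (continuous_comp cx); exact: Re_cont. Qed.
Lemma cont_on_Im a b f : cont_on a b f -> cont_on a b (fun x => complex.Im (f x)).
Proof. by move=> cf x /cf cx; apply: (continuous_comp cx); exact: Im_cont. Qed.

Lemma cont_onZ a b (l : R) (f : R -> R) : cont_on a b f -> cont_on a b (fun x => l * f x).
Proof. by move=> cf x /cf cx; apply: cvgM => //; exact: cvg_cst. Qed.

Lemma cint_segD a b f g : cont_on a b f -> cont_on a b g ->
  cint_seg a b (fun x => f x + g x) = cint_seg a b f + cint_seg a b g.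
Proof.
move=> cf cg; rewrite /cint_seg.
under eq_fun do rewrite CReD; under [fun x => complex.Im _]eq_fun do rewrite CImD.
by rewrite !int_segD //; by [exact: cont_on_Re|exact: cont_on_Im].
Qed.

Lemma cint_segZ a b f (l : C) : cont_on a b f ->
  cint_seg a b (fun x => l * f x) = l * cint_seg a b f.
Proof.
move=> cf; rewrite /cint_seg.
have cr := cont_on_Re cf; have ci := cont_on_Im cf.
have -> : (fun x => complex.Re (l * f x)) = (fun x => complex.Re l * complex.Re (f x) + - complex.Im l
  * complex.Im (f x)).
  by apply/funext => x; rewrite CReM mulNr.
have -> : (fun x => complex.Im (l * f x)) = (fun x => complex.Re l * complex.Im (f x) + complex.Im l
  * complex.Re (f x)).
  by apply/funext => x; rewrite CImM.
rewrite !int_segD ?int_segZ //; try exact: cont_onZ.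
by case: l => p q /=; apply: cplx_eq; rewrite /= ?mulNr.
Qed.

Lemma cint_seg_cat a m b f : a <= m <= b -> cont_on a b f ->
  cint_seg a b f = cint_seg a m f + cint_seg m b f.
Proof.
move=> amb cf; rewrite /cint_seg.
by rewrite (int_seg_cat amb (cont_on_Re cf)) (int_seg_cat amb (cont_on_Im cf)).
Qed.

(** The factor 2 comes from estimating the real and the imaginary part separately. *)
Lemma cint_seg_bound a b f (B : R) : a <= b -> cont_on a b f ->
  (forall x, a <= x <= b -> rnorm (f x) <= B) -> rnorm (cint_seg a b f) <= 2 * B * (b - a).
Proof.
move=> ab cf fB; apply: le_trans (rnorm_le _) _ => /=.
rewrite -mulrA mulr_natl mulr2n lerD // int_seg_bound //; try by [exact: cont_on_Re|exact: cont_on_Im].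
- by move=> x /fB; apply: le_trans; exact: Re_le.
- by move=> x /fB; apply: le_trans; exact: Im_le.
Qed.

(** The primitive is only asked to have a first-order expansion at each point, so that F can
    be the restriction of a complex primitive to a segment. *)
Lemma cint_seg_FTC a b f (F : R -> C) : a <= b -> cont_on a b f ->
  (forall x, a <= x <= b -> forall e : R, 0 < e -> exists2 d : R, 0 < d &
    forall h : R, `|h| < d -> rnorm (F (x + h) - F x - f x * rc h) <= e * `|h|) ->
  cint_seg a b f = F b - F a.
Proof.
move=> ab cf dF.
have E1 : int_seg a b (fun x => complex.Re (f x)) = complex.Re (F b) - complex.Re (F a).
  apply: (@int_seg_FTC _ _ _ _ (fun x => complex.Re (F x))) => //; first exact: cont_on_Re.
  move=> x /dF H; apply: is_derive_eps => e /H[d d0 {}H]; exists d => // h /H.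
  apply: le_trans; apply: le_trans (Re_le _).
  by rewrite !CReD !CReN CReM /= mulr0 subr0.
have E2 : int_seg a b (fun x => complex.Im (f x)) = complex.Im (F b) - complex.Im (F a).
  apply: (@int_seg_FTC _ _ _ _ (fun x => complex.Im (F x))) => //; first exact: cont_on_Im.
  move=> x /dF H; apply: is_derive_eps => e /H[d d0 {}H]; exists d => // h /H.
  apply: le_trans; apply: le_trans (Im_le _).
  by rewrite !CImD !CImN CImM /= mulr0 add0r.
by rewrite /cint_seg E1 E2; case: (F b) (F a) => [p q] [r s].
Qed.

End ComplexIntegral.

(** * Rectangle integrals and Goursat's theorem *)

Section Continuity.
Variables (R : realType) (T : topologicalType) (x : T).
Notation C := (Cx R).
Implicit Types f g : T -> C.
Lemma contC_cst (l : C) : {for x, continuous (fun _ : T => l)}.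
Proof. exact: cst_continuous. Qed.
Lemma contCD f g : {for x, continuous f} -> {for x, continuous g} ->
  {for x, continuous (fun y => f y + g y)}.
Proof. by move=> cf cg; exact: (cvgD cf cg). Qed.
Lemma contCB f g : {for x, continuous f} -> {for x, continuous g} ->
  {for x, continuous (fun y => f y - g y)}.
Proof. by move=> cf cg; exact: (cvgB cf cg). Qed.
Lemma contCM f g : {for x, continuous f} -> {for x, continuous g} ->
  {for x, continuous (fun y => f y * g y)}.
Proof. by move=> cf cg; exact: (cvgM cf cg). Qed.
Lemma contCX f n : {for x, continuous f} -> {for x, continuous (fun y => f y ^+ n)}.
Proof.
move=> cf; elim: n => [|n IH]; first exact: contC_cst.
have -> : (fun y => f y ^+ n.+1) = (fun y => f y * f y ^+ n).
  by apply/funext => y; rewrite exprS.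
exact: contCM.
Qed.
Lemma contCV f : f x != 0 -> {for x, continuous f} -> {for x, continuous (fun y => (f y)^-1)}.
Proof. by move=> f0 cf; exact: (cvgV f0 cf). Qed.
End Continuity.
Lemma contC_id (R : realType) (z : Cx R) : {for z, continuous (fun y : Cx R => y)}.
Proof. exact: cvg_id. Qed.

Section Rectangles.
Variable R : realType.
Notation C := (Cx R).
Notation rc := (real_complex R).
Implicit Types (k : C -> C) (a b c d : R).

Definition cx (x y : R) : C := Complex x y.

Definition rect a b c d (z : C) :=
  a <= complex.Re z <= b /\ c <= complex.Im z <= d.
Definition rect_bdry a b c d (z : C) := rect a b c d z /\
  [\/ complex.Re z = a, complex.Re z = b, complex.Im z = c | complex.Im z = d].

(** The contour integral along the boundary of the rectangle, counterclockwise; the factor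
    'i comes from the vertical sides. *)
Definition int_rect k a b c d : C :=
  cint_seg a b (fun x => k (cx x c)) - cint_seg a b (fun x => k (cx x d))
  + 'i%C * (cint_seg c d (fun y => k (cx b y)) - cint_seg c d (fun y => k (cx a y))).

Definition bdry_cont k a b c d := forall z, rect_bdry a b c d z -> {for z, continuous k}.

Lemma cxh_cont (y x : R) : {for x, continuous (fun t => cx t y)}.
Proof. by apply: cont_Complex; [exact: cvg_id|exact: cst_continuous]. Qed.
Lemma cxv_cont (x y : R) : {for y, continuous (fun t => cx x t)}.
Proof. by apply: cont_Complex; [exact: cst_continuous|exact: cvg_id]. Qed.

Lemma horizontal_cont k (y : R) a b : (forall x, a <= x <= b -> {for cx x y, continuous k}) ->
  cont_on a b (fun x => k (cx x y)).
Proof.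
move=> H x /H kx; have cxc := @cxh_cont y x; exact: (continuous_comp cxc kx).
Qed.
Lemma vertical_cont k (x : R) c d : (forall y, c <= y <= d -> {for cx x y, continuous k}) ->
  cont_on c d (fun y => k (cx x y)).
Proof.
move=> H y /H ky; have cxc := @cxv_cont x y; exact: (continuous_comp cxc ky).
Qed.

Lemma bdry_cont_bottom k a b c d : a <= b -> c <= d -> bdry_cont k a b c d ->
  cont_on a b (fun x => k (cx x c)).
Proof. by move=> ab cd kc; apply: horizontal_cont => x xab; apply: kc; split; [split; rewrite /=
  ?lexx ?cd|constructor 3]. Qed.
Lemma bdry_cont_top k a b c d : a <= b -> c <= d -> bdry_cont k a b c d ->
  cont_on a b (fun x => k (cx x d)).
Proof. by move=> ab cd kc; apply: horizontal_cont => x xab; apply: kc; split; [split; rewrite /=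
  ?lexx ?cd|constructor 4]. Qed.
Lemma bdry_cont_left k a b c d : a <= b -> c <= d -> bdry_cont k a b c d ->
  cont_on c d (fun y => k (cx a y)).
Proof. by move=> ab cd kc; apply: vertical_cont => x xab; apply: kc; split; [split; rewrite /=
  ?lexx ?ab|constructor 1]. Qed.
Lemma bdry_cont_right k a b c d : a <= b -> c <= d -> bdry_cont k a b c d ->
  cont_on c d (fun y => k (cx b y)).
Proof. by move=> ab cd kc; apply: vertical_cont => x xab; apply: kc; split; [split; rewrite /=
  ?lexx ?ab|constructor 2]. Qed.

Lemma int_rectD k1 k2 a b c d : a <= b -> c <= d -> bdry_cont k1 a b c d -> bdry_cont k2 a b c d ->
  int_rect (fun z => k1 z + k2 z) a b c d = int_rect k1 a b c d + int_rect k2 a b c d.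
Proof.
move=> ab cd c1 c2; rewrite /int_rect !cint_segD; first by ring.
all: by first [exact: (bdry_cont_left ab cd)|exact: (bdry_cont_right ab cd)|exact: (bdry_cont_bottom ab
  cd)|exact: (bdry_cont_top ab cd)].
Qed.

Lemma int_rectZ k (l : C) a b c d : a <= b -> c <= d -> bdry_cont k a b c d ->
  int_rect (fun z => l * k z) a b c d = l * int_rect k a b c d.
Proof.
move=> ab cd c1; rewrite /int_rect !cint_segZ; first by ring.
all: by first [exact: (bdry_cont_left ab cd)|exact: (bdry_cont_right ab cd)|exact: (bdry_cont_bottom ab
  cd)|exact: (bdry_cont_top ab cd)].
Qed.

Lemma int_rect_bound k a b c d (B : R) : a <= b -> c <= d -> bdry_cont k a b c d ->
  (forall z, rect_bdry a b c d z -> rnorm (k z) <= B) ->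
  rnorm (int_rect k a b c d) <= 4 * B * ((b - a) + (d - c)).
Proof.
move=> ab cd kc kB.
have i1 : rnorm ('i%C : C) = 1 by rewrite rnormE /= expr0n add0r expr1n sqrtr1.
have h1 : rnorm (cint_seg a b (fun x => k (cx x c))) <= 2 * B * (b - a).
  apply: cint_seg_bound => //; first exact: (bdry_cont_bottom ab cd kc).
  by move=> x xab; apply: kB; split; [split; rewrite /= ?lexx|constructor 3].
have h2 : rnorm (cint_seg a b (fun x => k (cx x d))) <= 2 * B * (b - a).
  apply: cint_seg_bound => //; first exact: (bdry_cont_top ab cd kc).
  by move=> x xab; apply: kB; split; [split; rewrite /= ?lexx ?cd|constructor 4].
have h3 : rnorm (cint_seg c d (fun y => k (cx b y))) <= 2 * B * (d - c).
  apply: cint_seg_bound => //; first exact: (bdry_cont_right ab cd kc).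
  by move=> x xab; apply: kB; split; [split; rewrite /= ?lexx ?ab|constructor 2].
have h4 : rnorm (cint_seg c d (fun y => k (cx a y))) <= 2 * B * (d - c).
  apply: cint_seg_bound => //; first exact: (bdry_cont_left ab cd kc).
  by move=> x xab; apply: kB; split; [split; rewrite /= ?lexx|constructor 1].
rewrite /int_rect; apply: le_trans (rnormD (V := C) _ _) _.
rewrite rnormM i1 mul1r.
apply: le_trans (lerD (rnormB (V := C) _ _) (rnormB (V := C) _ _)) _.
lra.
Qed.

Lemma int_rect_splitv k a m b c d : a <= m <= b -> c <= d -> bdry_cont k a b c d ->
  int_rect k a b c d = int_rect k a m c d + int_rect k m b c d.
Proof.
move=> /andP[am mb] cd kc; have ab := le_trans am mb.
rewrite /int_rect (@cint_seg_cat _ a m b (fun x => k (cx x c))) ?am //; last exact: (bdry_cont_bottom ab cd kc).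
rewrite (@cint_seg_cat _ a m b (fun x => k (cx x d))) ?am //; last exact: (bdry_cont_top ab cd kc).
by ring.
Qed.

Lemma int_rect_splith k a b c m d : a <= b -> c <= m <= d -> bdry_cont k a b c d ->
  int_rect k a b c d = int_rect k a b c m + int_rect k a b m d.
Proof.
move=> ab /andP[cm md] kc; have cd := le_trans cm md.
rewrite /int_rect (@cint_seg_cat _ c m d (fun x => k (cx a x))) ?cm //; last exact: (bdry_cont_left ab cd kc).
rewrite (@cint_seg_cat _ c m d (fun x => k (cx b x))) ?cm //; last exact: (bdry_cont_right ab cd kc).
by ring.
Qed.

Lemma is_derive_cx (P : C -> C) (z l : C) : is_derive z 1 P l ->
  forall e : R, 0 < e -> exists2 dd : R, 0 < dd & forall v : C, rnorm v < dd ->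
    rnorm (P (z + v) - P z - l * v) <= e * rnorm v.
Proof.
move=> dP e e0.
have Pd : differentiable P z by apply/derivable1_diffP; case: dP.
have [dd dd0 H] := differential_estimate Pd e0; exists dd => // v /H.
suff -> : 'd P z v = l * v by [].
have -> : v = v *: (1 : C) by rewrite /GRing.scale /= mulr1.
rewrite linearZ -deriveE // derive_val /GRing.scale /= mulr1; exact: mulrC.
Qed.

Lemma int_rect_FTC k (P : C -> C) a b c d : a <= b -> c <= d -> bdry_cont k a b c d ->
  (forall z, rect_bdry a b c d z -> is_derive z 1 P (k z)) -> int_rect k a b c d = 0.
Proof.
move=> ab cd kc dP.
have hF y : (y = c \/ y = d) ->
    cint_seg a b (fun x => k (cx x y)) = P (cx b y) - P (cx a y).
  move=> ycd; have bx x : a <= x <= b -> rect_bdry a b c d (cx x y).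
    move=> xab; case: ycd => ->; split; try by [constructor 3|constructor 4].
      by split; rewrite /= ?lexx.
    by split; rewrite /= ?lexx ?cd.
  apply: (@cint_seg_FTC _ _ _ _ (fun x => P (cx x y))) => //.
    by apply: horizontal_cont => x /bx /kc.
  move=> x /bx /dP dPx e e0; have [dd dd0 H] := is_derive_cx dPx e0.
  exists dd => // h hd; have := H (rc h); rewrite rnorm_rc => /(_ hd).
  suff -> : cx x y + rc h = cx (x + h) y by [].
  by apply: cplx_eq; rewrite /= ?addr0.
have i1 : rnorm ('i%C : C) = 1 by rewrite rnormE /= expr0n add0r expr1n sqrtr1.
have vF x : (x = a \/ x = b) ->
    'i%C * cint_seg c d (fun y => k (cx x y)) = P (cx x d) - P (cx x c).
  move=> xab; have bx y : c <= y <= d -> rect_bdry a b c d (cx x y).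
    move=> ycd; case: xab => ->; split; try by [constructor 1|constructor 2].
      by split; rewrite /= ?lexx.
    by split; rewrite /= ?lexx ?ab.
  have kcc : cont_on c d (fun y => k (cx x y)) by apply: vertical_cont => y /bx /kc.
  rewrite -cint_segZ //.
  apply: (@cint_seg_FTC _ _ _ (fun y => 'i%C * k (cx x y)) (fun y => P (cx x y)) cd).
    move=> y /kcc kcy; apply: contCM; [exact: contC_cst|exact: kcy].
  move=> y /bx /dP dPx e e0; have [dd dd0 H] := is_derive_cx dPx e0.
  exists dd => // h hd; have := H ('i%C * rc h); rewrite rnormM i1 mul1r rnorm_rc => /(_ hd).
  have -> : cx x y + 'i%C * rc h = cx x (y + h).
    by apply: cplx_eq; rewrite /= ?(mul0r, mulr0, mul1r, subr0, addr0, add0r).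
  by rewrite mulrA [k _ * _]mulrC.
rewrite /int_rect mulrBr !vF ?hF; first (by ring).
all: by [left|right].
Qed.

End Rectangles.

Section Goursat.
Variable R : realType.
Notation C := (Cx R).
Notation rc := (real_complex R).
Variable k : C -> C.

Definition rct := (R * R * R * R)%type.
Definition int_rct (r : rct) := let: (a, b, c, d) := r in int_rect k a b c d.
Definition in_rct (r : rct) (z : C) := let: (a, b, c, d) := r in rect a b c d z.
Definition mid (x y : R) := (x + y) / 2.

Definition quarter (r : rct) (s : rct) := let: (a, b, c, d) := r in
  [\/ s = (a, mid a b, c, mid c d), s = (mid a b, b, c, mid c d),
      s = (a, mid a b, mid c d, d) | s = (mid a b, b, mid c d, d)].

(** The four boundary integrals add up to the large one, so one of them has at least a
    quarter of its modulus. *)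
Lemma quarter_ex (r : rct) : (let: (a, b, c, d) := r in a < b /\ c < d) ->
  (forall z, in_rct r z -> {for z, continuous k}) ->
  exists s, quarter r s /\ rnorm (int_rct r) <= 4 * rnorm (int_rct s).
Proof.
move: r => [[[a b] c] d] [ab cd] kc.
have am : a <= mid a b <= b by rewrite /mid; apply/andP; split; lra.
have cm : c <= mid c d <= d by rewrite /mid; apply/andP; split; lra.
have /andP[am1 am2] := am; have /andP[cm1 cm2] := cm.
have bc a' b' c' d' : a <= a' -> b' <= b -> c <= c' -> d' <= d -> bdry_cont k a' b' c' d'.
  move=> h1 h2 h3 h4 z [[/andP[h5 h6] /andP[h7 h8]] _]; apply: kc; split; apply/andP; split; lra.
have E : int_rct (a, b, c, d) = int_rct (a, mid a b, c, mid c d) + int_rct (mid a b, b, c, mid c d)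
    + int_rct (a, mid a b, mid c d, d) + int_rct (mid a b, b, mid c d, d).
  rewrite /= (int_rect_splitv am (ltW cd)); last exact: bc.
  rewrite (int_rect_splith am1 cm); last exact: bc.
  rewrite (int_rect_splith am2 cm); last exact: bc.
  by ring.
have h : rnorm (int_rct (a, b, c, d)) <= rnorm (int_rct (a, mid a b, c, mid c d)) +
    rnorm (int_rct (mid a b, b, c, mid c d))
    + rnorm (int_rct (a, mid a b, mid c d, d)) + rnorm (int_rct (mid a b, b, mid c d, d)).
  rewrite E; apply: le_trans (rnormD (V := C) _ _) _; rewrite lerD2r.
  by apply: le_trans (rnormD (V := C) _ _) _; rewrite lerD2r; exact: (rnormD (V := C)).
set X := rnorm (int_rct (a, b, c, d)) in h *.
have [h1|h1] := leP X (4 * rnorm (int_rct (a, mid a b, c, mid c d))).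
  by exists (a, mid a b, c, mid c d); split => //; constructor 1.
have [h2|h2] := leP X (4 * rnorm (int_rct (mid a b, b, c, mid c d))).
  by exists (mid a b, b, c, mid c d); split => //; constructor 2.
have [h3|h3] := leP X (4 * rnorm (int_rct (a, mid a b, mid c d, d))).
  by exists (a, mid a b, mid c d, d); split => //; constructor 3.
exists (mid a b, b, mid c d, d); split; first by constructor 4.
move: h h1 h2 h3; move: (rnorm _) (rnorm _) (rnorm _) (rnorm _) => p1 p2 p3 p4.
by clear; lra.
Qed.

Lemma quarterP a b c d a' b' c' d' :
  quarter (a, b, c, d) (a', b', c', d') -> a < b -> c < d ->
  [/\ a' < b', c' < d', b' - a' = (b - a) / 2, d' - c' = (d - c) / 2 &
   [/\ a <= a', b' <= b, c <= c' & d' <= d]].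
Proof.
by move=> + ab cd; case=> -[-> -> -> ->]; rewrite /mid; split; (try split); lra.
Qed.

(** Bisection: keep a quarter whose integral has at least a quarter of the modulus of the
    previous one, and pass to the common point w of the nested rectangles. Near w the
    function k is its affine part, which has a primitive, plus a remainder o(|z - w|); so
    the n-th integral is o(4^-n), which forces the first one to be 0. *)
Theorem Goursat a b c d : a < b -> c < d ->
  (forall z, rect a b c d z -> differentiable k z) -> int_rect k a b c d = 0.
Proof.
move=> ab cd kd.
have kc z : rect a b c d z -> {for z, continuous k}.
  by move=> /kd; exact: differentiable_continuous.
have /choice[st stP] : forall r : rct, exists s, 
    (let: (a, b, c, d) := r in a < b /\ c < d) ->
    (forall z, in_rct r z -> {for z, continuous k}) ->
    quarter r s /\ rnorm (int_rct r) <= 4 * rnorm (int_rct s).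
  move=> r; have [h1|h1] := pselect (let: (a, b, c, d) := r in a < b /\ c < d); last by exists r.
  have [h2|h2] := pselect (forall z, in_rct r z -> {for z, continuous k}); last by exists r.
  by have [s hs] := quarter_ex h1 h2; exists s.
pose r n := iter n st (a, b, c, d).
pose ra n := (r n).1.1.1; pose rb n := (r n).1.1.2; pose rC n := (r n).1.2; pose rd n := (r n).2.
have rE n : r n = (ra n, rb n, rC n, rd n) by rewrite /ra /rb /rC /rd; case: (r n) => [[[]]].
have key n : [/\ ra n < rb n, rC n < rd n, 
    (forall z, in_rct (r n) z -> rect a b c d z) & rnorm (int_rect k a b c d) <= 4 ^+ n * rnorm (int_rct (r n))] /\
    [/\ rb n - ra n = (b - a) / 2 ^+ n, rd n - rC n = (d - c) / 2 ^+ n &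
     [/\ ra n <= ra n.+1, rb n.+1 <= rb n, rC n <= rC n.+1 & rd n.+1 <= rd n]].
  have step m : ra m < rb m -> rC m < rd m -> (forall z, in_rct (r m) z -> rect a b c d z) ->
      quarter (ra m, rb m, rC m, rd m) (ra m.+1, rb m.+1, rC m.+1, rd m.+1) /\ rnorm (int_rct (r m)) <=
        4 * rnorm (int_rct (r m.+1)).
    move=> h1 h2 h3; rewrite -!rE; apply: stP; first by rewrite -/(r m) rE.
    by move=> z /h3 /kc.
  elim: n => [|n [[h1 h2 h3 h4] [h5 h6 [h7 h8 h9 h10]]]].
    have [q _] := step 0%N ab cd (fun z => id).
    have [_ _ _ _ h] := quarterP q ab cd.
    by split; split => //; rewrite expr0 ?mul1r ?divr1.
  have [q1 q2] := step n h1 h2 h3.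
  have [h1' h2' h5' h6' _] := quarterP q1 h1 h2.
  have h3' z : in_rct (r n.+1) z -> rect a b c d z.
    move=> hz; apply: h3; move: hz; rewrite (rE n) (rE n.+1).
    move=> [/andP[e1 e2] /andP[e3 e4]]; split; apply/andP; split.
    - exact: le_trans e1.
    - exact: (le_trans e2).
    - exact: le_trans e3.
    - exact: (le_trans e4).
  have [q3 _] := step n.+1 h1' h2' h3'.
  have [_ _ _ _ h] := quarterP q3 h1' h2'.
  split; split => //.
  - by apply: le_trans h4 _; rewrite exprSr -mulrA ler_wpM2l // exprn_ge0.
  - by rewrite h5' h5 exprSr invfM mulrA.
  - by rewrite h6' h6 exprSr invfM mulrA.
have amono : {homo ra : m n / (m <= n)%N >-> m <= n}.
  by apply: homo_leq => [//|??? h1 h2|m]; [exact: le_trans h1 h2|have [_ [_ _ []]] := key m].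
have bmono : {homo rb : m n / (m <= n)%N >-> n <= m}.
  by apply: homo_leq => [//|??? h1 h2|m]; [exact: le_trans h2 h1|have [_ [_ _ []]] := key m].
have cmono : {homo rC : m n / (m <= n)%N >-> m <= n}.
  by apply: homo_leq => [//|??? h1 h2|m]; [exact: le_trans h1 h2|have [_ [_ _ []]] := key m].
have dmono : {homo rd : m n / (m <= n)%N >-> n <= m}.
  by apply: homo_leq => [//|??? h1 h2|m]; [exact: le_trans h2 h1|have [_ [_ _ []]] := key m].
have mid_ex (p q : nat -> R) : {homo p : m n / (m <= n)%N >-> m <= n} ->
    {homo q : m n / (m <= n)%N >-> n <= m} -> (forall n, p n <= q n) ->
    exists x, forall n, p n <= x <= q n.
  move=> hp hq pq; exists (sup (range p)) => n.
  have ub m : ubound (range p) (q m).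
    move=> _ [i _ <-]; apply: (le_trans (hp _ _ (leq_maxl i m))).
    by apply: le_trans (hq _ _ (leq_maxr i m)).
  apply/andP; split.
    by apply: ub_le_sup; [exists (q 0%N); exact: ub|exists n].
  by apply: ge_sup; [exists (p 0%N), 0%N|exact: ub].
have [x xP] : exists x, forall n, ra n <= x <= rb n.
  by apply: mid_ex => // n; have [[/ltW]] := key n.
have [y yP] : exists y, forall n, rC n <= y <= rd n.
  by apply: mid_ex => // n; have [[_ /ltW]] := key n.
have wr : rect a b c d (cx x y).
  by have := xP 0%N; have := yP 0%N.
set w := cx x y in wr.
pose L := (b - a) + (d - c).
have L0 : 0 < L by rewrite /L; lra.
apply/eqP; rewrite -(rnorm_eq0 (V := C)) eq_le rnorm_ge0 andbT.
apply/ler_addgt0Pr => e e0; rewrite add0r.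
have e1 : 0 < e / (4 * L ^+ 2) by rewrite divr_gt0 // mulr_gt0 // exprn_gt0.
have [dd dd0 H] := differential_estimate (kd _ wr) e1.
have [n Ln] : exists n : nat, L / 2 ^+ n < dd.
  have := @cvg_geometric R L (2^-1).
  rewrite ger0_norm ?invr_ge0 // invf_lt1 // ltr1n => /(_ isT) /cvgrPdist_lt /(_ _ dd0).
  move=> [n _ /(_ n (leqnn n))] /=; rewrite sub0r normrN ger0_norm.
    by rewrite exprVn; exists n.
  by rewrite mulr_ge0 ?ltW // exprn_ge0 // invr_ge0.
have [[h1 h2 h3 h4] [h5 h6 _]] := key n.
apply: le_trans h4 _.
rewrite rE /=; set A := ra n in h1 h5 *; set B := rb n in h1 h5 *.
set CC := rC n in h2 h6 *; set DD := rd n in h2 h6 *.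
have bsub z : rect_bdry A B CC DD z -> rect a b c d z.
  by move=> [hz _]; apply: h3; rewrite rE.
(* the affine part g has a primitive, so only the remainder rr contributes *)
pose g (z : C) := k w + 'd k w (1 : C) * (z - w).
have kg z : k w + 'd k w (z - w) = g z.
  rewrite /g; congr (_ + _); rewrite -[z - w in LHS](mulr1) -[_ * 1]/((z - w) *: (1 : C)) linearZ /=.
  by rewrite mulrC.
have dg (z : C) : is_derive z 1 (fun u : C => k w * u + 'd k w (1 : C) * ((u - w) ^+ 2 / 2)) (g z).
  apply: is_derive_eq; rewrite /GRing.scale /= /g; by field.
have gc z : {for z, continuous g}.
  apply: contCD; first exact: contC_cst.
  by apply: contCM; [exact: contC_cst|apply: contCB; [exact: contC_id|exact: contC_cst]].
pose rr (z : C) := k z + (-1) * g z.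
have rcont : bdry_cont rr A B CC DD.
  move=> z /bsub /kc kz; apply: contCD; first exact: kz.
  by apply: contCM; [exact: contC_cst|exact: gc].
have kb : bdry_cont k A B CC DD by move=> z /bsub /kc.
have gb : bdry_cont g A B CC DD by move=> z _; exact: gc.
have -> : int_rect k A B CC DD = int_rect rr A B CC DD.
  have h1' := ltW h1; have h2' := ltW h2.
  have gb' : bdry_cont (fun z => (-1) * g z) A B CC DD.
    by move=> z _; apply: contCM; [exact: contC_cst|exact: gc].
  rewrite /rr (int_rectD h1' h2' kb gb') (int_rectZ (-1) h1' h2' gb).
  by rewrite (int_rect_FTC h1' h2' gb (fun z _ => dg z)) mulr0 addr0.
have zw z : rect_bdry A B CC DD z -> rnorm (z - w) <= L / 2 ^+ n.
  move=> [[/andP[z1 z2] /andP[z3 z4]] _].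
  have /andP[x1 x2] := xP n; have /andP[y1 y2] := yP n.
  apply: le_trans (rnorm_le _) _; rewrite /L mulrDl -h5 -h6; apply: lerD.
    have -> : complex.Re (z - w) = complex.Re z - x by rewrite CReD CReN.
    by rewrite -/A -/B in x1 x2; rewrite ler_norml; apply/andP; split; clear -z1 z2 x1 x2; lra.
  have -> : complex.Im (z - w) = complex.Im z - y by rewrite CImD CImN.
  by rewrite -/CC -/DD in y1 y2; rewrite ler_norml; apply/andP; split; clear -z3 z4 y1 y2; lra.
have bd z : rect_bdry A B CC DD z -> rnorm (rr z) <= e / (4 * L ^+ 2) * (L / 2 ^+ n).
  move=> zb; have := zw _ zb => zw1; have := H (z - w) (le_lt_trans zw1 Ln).
  rewrite [w + _]addrC subrK; have -> : k z - k w - 'd k w (z - w) = rr z.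
    by rewrite /rr -kg mulN1r opprD addrA.
  move/le_trans; apply; apply: ler_wpM2l => //; exact: ltW.
apply: (@le_trans _ _ (4 ^+ n * (4 * (e / (4 * L ^+ 2) * (L / 2 ^+ n)) * (L / 2 ^+ n)))).
  rewrite ler_wpM2l ?exprn_ge0 //; apply: le_trans (int_rect_bound (ltW h1) (ltW h2) rcont bd) _.
  by rewrite h5 h6 -mulrDl.
have -> : (4 : R) ^+ n = 2 ^+ n * 2 ^+ n by rewrite -exprMn; congr (_ ^+ _); lra.
rewrite le_eqVlt; apply/orP; left; apply/eqP.
have aux (t l : R) : t != 0 -> l != 0 ->
    t * t * (4 * (e / (4 * l ^+ 2) * (l / t)) * (l / t)) = e.
  by move=> t0 l0; field; rewrite t0 l0.
by apply: aux; [rewrite expf_neq0|exact: lt0r_neq0].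
Qed.

End Goursat.

(** * Cauchy's formula and Taylor expansion on a square *)

Section Cauchy.
Variable R : realType.
Notation C := (Cx R).
Notation rc := (real_complex R).

Definition on_square (z : C) := rect_bdry (-1) 1 (-1) 1 z.
Definition in_square (z : C) := rect (-1) 1 (-1) 1 z.
(** The contour is the boundary of the square of side 2 around 0 rather than the unit
    circle, so that the theorem on rectangles applies to it. *)
Definition int_square (f : C -> C) : C := int_rect f (-1) 1 (-1) 1.

Lemma on_square_in z : on_square z -> in_square z. Proof. by case. Qed.

Lemma on_square_ge1 z : on_square z -> 1 <= rnorm z.
Proof.
move=> [_ []] h; [apply: le_trans (Re_le z)|apply: le_trans (Re_le z)|
  apply: le_trans (Im_le z)|apply: le_trans (Im_le z)]; by rewrite h ?normrN normr1.
Qed.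

Lemma in_square_le2 z : in_square z -> rnorm z <= 2.
Proof.
move=> [h1 h2]; apply: le_trans (rnorm_le _) _.
by have -> : (2 : R) = 1 + 1 by []; apply: lerD; rewrite ler_norml.
Qed.

Lemma on_square_neq0 z : on_square z -> z != 0.
Proof. by move/on_square_ge1 => h; rewrite -(rnorm_gt0 (V := C)); apply: lt_le_trans h. Qed.

Lemma on_square_sub (z w : C) : on_square z -> 1 - rnorm w <= rnorm (z - w).
Proof.
move/on_square_ge1 => h; rewrite lerBlDr; apply: le_trans h _.
exact: (rnorm_triB (V := C)).
Qed.

Lemma on_square_neq (z w : C) : rnorm w < 1 -> on_square z -> z - w != 0.
Proof.
move=> w1 /(on_square_sub w) h; rewrite -(rnorm_gt0 (V := C)).
by apply: lt_le_trans h; rewrite subr_gt0.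
Qed.

Let m1 : (-1 : R) <= 1. Proof. by rewrite lerNl; lra. Qed.

Definition square_cont f := forall z, on_square z -> {for z, continuous (f : C -> C)}.

Lemma int_squareD f g : square_cont f -> square_cont g ->
  int_square (fun z => f z + g z) = int_square f + int_square g.
Proof. exact: int_rectD. Qed.
Lemma int_squareZ l f : square_cont f -> int_square (fun z => l * f z) = l * int_square f.
Proof. exact: int_rectZ. Qed.
Lemma int_square_bound f (B : R) : square_cont f -> (forall z, on_square z -> rnorm (f z) <= B) ->
  rnorm (int_square f) <= 16 * B.
Proof.
move=> cf fB; apply: le_trans (int_rect_bound m1 m1 cf fB) _.
by rewrite le_eqVlt; apply/orP; left; apply/eqP; ring.
Qed.
Lemma int_square_FTC f P : square_cont f -> (forall z, on_square z -> is_derive z 1 P (f z)) -> int_square f = 0.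
Proof. exact: int_rect_FTC. Qed.

Lemma int_square_sum (I : Type) (r : seq I) (f : I -> C -> C) :
  (forall i, square_cont (f i)) ->
  square_cont (fun z => \sum_(i <- r) f i z) /\
  int_square (fun z => \sum_(i <- r) f i z) = \sum_(i <- r) int_square (f i).
Proof.
move=> cf; elim: r => [|i r [IH1 IH2]].
  have -> : (fun z : C => \sum_(i <- [::]) f i z) = (fun=> 0).
    by apply/funext => z; rewrite big_nil.
  have c0 : square_cont (fun=> 0) by move=> z _; exact: contC_cst.
  split => //; rewrite big_nil; have := int_squareZ 0 c0.
  by under eq_fun do rewrite mulr0; rewrite mul0r.
have -> : (fun z : C => \sum_(i <- i :: r) f i z) = (fun z => f i z + \sum_(i <- r) f i z).
  by apply/funext => z; rewrite big_cons.
split; first by move=> z hz; apply: contCD; [exact: cf|exact: IH1].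
by rewrite big_cons (int_squareD (cf i) IH1) IH2.
Qed.

Lemma eq_int_square f g : square_cont f -> (forall z, on_square z -> f z = g z) -> int_square f = int_square g.
Proof.
move=> cf fg.
have e (x y : R) (h : R -> C) (k : R -> C) : (forall t, x <= t <= y -> h t = k t) -> cint_seg x y h = cint_seg x y k.
  move=> hk; rewrite /cint_seg /int_seg; congr Complex; apply: eq_Rintegral => t; rewrite inE /=
    in_itv /= => /hk -> //.
rewrite /int_square /int_rect; congr (_ - _ + _ * (_ - _)); apply: e => t ht; apply: fg.
- by split; [split; rewrite /= ?lexx ?m1|constructor 3].
- by split; [split; rewrite /= ?lexx ?m1|constructor 4].
- by split; [split; rewrite /= ?lexx ?m1|constructor 2].
- by split; [split; rewrite /= ?lexx ?m1|constructor 1].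
Qed.

(** This is 2 i pi. Cauchy's formula needs no more than its being nonzero. *)
Definition c0 : C := int_square (fun z => z^-1).

Lemma inv_cont : square_cont (fun z => z^-1).
Proof. by move=> z /on_square_neq0 z0; apply: contCV; [exact: z0|exact: contC_id]. Qed.

Lemma invX_cont n : square_cont (fun z => (z ^+ n)^-1).
Proof.
move=> z /on_square_neq0 z0; apply: (contCV (f := fun z : C => z ^+ n)); first by rewrite expf_neq0.
by apply: contCX; exact: contC_id.
Qed.

Lemma cauchy_cont w : rnorm w < 1 -> square_cont (fun z => (z - w)^-1).
Proof.
move=> w1 z /(on_square_neq w1) zw; apply: (contCV (f := fun z : C => z - w)); first exact: zw.
by apply: contCB; [exact: contC_id|exact: contC_cst].
Qed.

Lemma arctan_integrand_cont : cont_on (-1) 1 (fun x : R => (x ^+ 2 + 1)^-1).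
Proof.
move=> x _; apply: (@cvgV _ _ (nbhs x) _ (fun x => x ^+ 2 + 1)).
  by rewrite lt0r_neq0 // ltr_pwDr // sqr_ge0.
apply: cvgD; last exact: cvg_cst.
by apply: cvgM; exact: cvg_id.
Qed.

(** Up to sign the integrand contributes 1 / (t^2 + 1) to the imaginary part on each of the
    four sides. *)
Lemma c0_neq0 : c0 != 0.
Proof.
suff : 0 < complex.Im c0 by case: c0 => a b /= b0; apply/eqP => -[_ b1]; rewrite b1 ltxx in b0.
have den0 (x : R) : 0 < x ^+ 2 + 1 by rewrite ltr_pwDr // sqr_ge0.
have den (x : R) : x ^+ 2 + 1 != 0 by rewrite lt0r_neq0.
have E1 : complex.Im c0 = 4 * int_seg (-1) 1 (fun x : R => (x ^+ 2 + 1)^-1).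
  have ImE (p q r s : C) : complex.Im (p - q + 'i%C * (r - s)) =
      complex.Im p - complex.Im q + (complex.Re r - complex.Re s).
    by case: p q r s => [? ?] [? ?] [? ?] [? ?] /=; rewrite mul0r mul1r add0r.
  have ImI f : complex.Im (cint_seg (-1) 1 f) = int_seg (-1) 1 (fun x : R => complex.Im (f x)) by [].
  have ReI f : complex.Re (cint_seg (-1) 1 f) = int_seg (-1) 1 (fun x : R => complex.Re (f x)) by [].
  have Imv x y : complex.Im (cx x y)^-1 = - (y / (x ^+ 2 + y ^+ 2)) :> R by [].
  have Rev x y : complex.Re (cx x y)^-1 = x / (x ^+ 2 + y ^+ 2) :> R by [].
  rewrite /c0 /int_square /int_rect ImE !ImI !ReI.
  have -> : (fun x : R => complex.Im ((cx x (-1))^-1)) = (fun x => (x ^+ 2 + 1)^-1).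
    by apply/funext => x; rewrite Imv mulNr opprK sqrrN expr1n mul1r.
  have -> : (fun x : R => complex.Im ((cx x 1)^-1)) = (fun x => (-1) * (x ^+ 2 + 1)^-1).
    by apply/funext => x; rewrite Imv expr1n mul1r mulN1r.
  have -> : (fun x : R => complex.Re ((cx 1 x)^-1)) = (fun x => (x ^+ 2 + 1)^-1).
    by apply/funext => x; rewrite Rev expr1n addrC mul1r.
  have -> : (fun x : R => complex.Re ((cx (-1) x)^-1)) = (fun x => (-1) * (x ^+ 2 + 1)^-1).
    by apply/funext => x; rewrite Rev sqrrN expr1n addrC.
  rewrite !int_segZ; try exact: arctan_integrand_cont.
  by ring.
rewrite E1 mulr_gt0 //.
apply: (@lt_le_trans _ _ (int_seg (-1) 1 (fun=> 2^-1))).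
  by rewrite int_seg_cst //; lra.
apply: int_seg_le; [by move=> x _; exact: cst_continuous|exact: arctan_integrand_cont|].
move=> x /andP[x1 x2]; rewrite lef_pV2 ?posrE //.
have : x ^+ 2 <= 1 by nra.
lra.
Qed.

(** Turns estimates by geometric remainders into exact identities. *)
Lemma le0_of_geometric (x K r : R) : 0 <= r < 1 -> (forall n, x <= K * r ^+ n) -> x <= 0.
Proof.
move=> /andP[r0 r1] H.
apply/ler_addgt0Pr => e e0; rewrite add0r.
have := @cvg_geometric R K r; rewrite ger0_norm // => /(_ r1) /cvgrPdist_lt /(_ _ e0).
move=> [n _ /(_ n (leqnn n))] /=; rewrite sub0r normrN => h.
by apply: le_trans (H n) _; apply: le_trans (ler_norm _) _; exact: ltW.
Qed.

Lemma is_deriveC_inv (f : C -> C) (z df : C) : f z != 0 -> is_derive z 1 f df ->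
  is_derive z 1 (fun y => (f y)^-1) (- (f z ^+ 2)^-1 * df).
Proof.
move=> fz h; have fd : derivable f z 1 by case: h.
by split; [exact: derivableV|rewrite deriveV // derive_val].
Qed.

Lemma is_deriveC_mul (f g : C -> C) (z df dg : C) : is_derive z 1 f df -> is_derive z 1 g dg ->
  is_derive z 1 (fun y => f y * g y) (f z * dg + g z * df).
Proof. by move=> h1 h2; exact: (is_deriveM h1 h2). Qed.

Lemma is_deriveC_cst (l z : C) : is_derive z 1 (fun=> l : C) 0.
Proof. exact: is_derive_cst. Qed.

Lemma differentiableC_id (z : C) : differentiable (fun y : C => y) z.
Proof. by apply/derivable1_diffP; exact: derivable_id. Qed.

Lemma is_deriveC_exp n (z : C) : is_derive z 1 (fun y : C => y ^+ n) (n%:R * z ^+ n.-1).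
Proof.
split; first exact: exprn_derivable.
by rewrite exp_derive /GRing.scale /= mulr1.
Qed.

Lemma is_deriveC_invX n (z : C) : z != 0 ->
  is_derive z 1 (fun y : C => (y ^+ n)^-1) (- n%:R * (z ^+ n.+1)^-1).
Proof.
move=> z0; have zn : z ^+ n != 0 by rewrite expf_neq0.
have := is_deriveC_inv (f := fun y : C => y ^+ n) zn (is_deriveC_exp n z); congr is_derive; case: n zn => [|n] zn.
  by rewrite !mul0r mulr0 oppr0 mul0r.
have zn' : z ^+ n != 0 by rewrite expf_neq0.
by rewrite /= !exprS; field; rewrite z0 zn'.
Qed.

Lemma int_square_invX n : int_square (fun z => (z ^+ n.+2)^-1) = 0.
Proof.
apply: (int_square_FTC (P := fun z => - n.+1%:R^-1 * (z ^+ n.+1)^-1)).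
  exact: invX_cont.
move=> z /on_square_neq0 z0.
have := is_deriveC_mul (is_deriveC_cst (- n.+1%:R^-1) z) (is_deriveC_invX n.+1 z0); congr is_derive.
have n0 : n.+1%:R != 0 :> C by rewrite pnatr_eq0.
by rewrite mulr0 addr0 mulrA mulrNN mulVf // mul1r.
Qed.

Lemma cauchy_expand (z w : C) N : z != 0 -> z - w != 0 ->
  (z - w)^-1 = \sum_(k < N) w ^+ k * (z ^+ k.+1)^-1 + w ^+ N * ((z ^+ N)^-1 * (z - w)^-1).
Proof.
move=> z0 zw; elim: N => [|N IH].
  by rewrite big_ord0 !expr0 invr1 !mul1r add0r.
rewrite {1}IH big_ord_recr /= -!addrA; congr (_ + _).
have zn : z ^+ N != 0 by rewrite expf_neq0.
by rewrite !exprS; field; rewrite zw z0 zn.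
Qed.

(** In the geometric expansion of the kernel in powers of w / z every term but the first has
    a primitive, and the remainder is bounded by a multiple of |w|^N. *)
Lemma int_square_cauchy_kernel w : rnorm w < 1 -> int_square (fun z => (z - w)^-1) = c0.
Proof.
move=> w1; apply/eqP; rewrite -subr_eq0 -(rnorm_eq0 (V := C)) eq_le rnorm_ge0 andbT.
apply: (@le0_of_geometric _ (16 / (1 - rnorm w)) (rnorm w)); first by rewrite rnorm_ge0.
move=> n.
have ccw : square_cont (fun z => (z ^+ n.+1)^-1 * (z - w)^-1).
  by move=> z hz; apply: contCM; [exact: invX_cont|exact: cauchy_cont].
have cck (k : 'I_n.+1) : square_cont (fun z => w ^+ k * (z ^+ k.+1)^-1).
  by move=> z hz; apply: contCM; [exact: contC_cst|exact: invX_cont].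
have cc2 : square_cont (fun z => w ^+ n.+1 * ((z ^+ n.+1)^-1 * (z - w)^-1)).
  by move=> z hz; apply: contCM; [exact: contC_cst|exact: ccw].
rewrite (@eq_int_square _ (fun z => \sum_(k < n.+1) w ^+ k * (z ^+ k.+1)^-1 +
    w ^+ n.+1 * ((z ^+ n.+1)^-1 * (z - w)^-1))); last 2 first.
- exact: cauchy_cont.
- by move=> z hz; apply: cauchy_expand; [exact: on_square_neq0|exact: on_square_neq].
have [s1 s2] := int_square_sum (index_enum 'I_n.+1) cck.
rewrite (int_squareD s1 cc2) s2 big_ord_recl big1 => [|i _]; last first.
  by rewrite (int_squareZ _ (@invX_cont _)) /= /bump /= add1n int_square_invX mulr0.
rewrite (int_squareZ _ (@invX_cont _)) /= expr0 mul1r addr0 -[int_square (fun z => (z ^+ 1)^-1)]/c0.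
rewrite addrAC subrr add0r (int_squareZ _ ccw) rnormM rnormX mulrC.
have r0 : 0 < 1 - rnorm w by rewrite subr_gt0.
have rn := rnorm_ge0 (V := C) w.
apply: ler_pM; rewrite ?rnorm_ge0 ?exprn_ge0 //; last first.
  by rewrite exprS ler_piMl ?exprn_ge0 // ltW.
apply: int_square_bound => // z hz; rewrite rnormM !rnormV rnormX.
rewrite -[leRHS]mul1r; apply: ler_pM; rewrite ?invr_ge0 ?exprn_ge0 ?rnorm_ge0 //.
  have hz1 := on_square_ge1 hz.
  by rewrite invf_le1; [exact: exprn_ege1|apply: exprn_gt0; exact: lt_le_trans hz1].
rewrite lef_pV2 ?posrE //; first exact: on_square_sub.
by rewrite rnorm_gt0; exact: on_square_neq.
Qed.

(** What is left of the square after removing the small square around w is a union of four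
    rectangles on which k is differentiable. *)
Lemma excision (k : C -> C) (w : C) (dl : R) :
  rnorm w < 1 -> 0 < dl -> dl < 1 - rnorm w ->
  (forall z, in_square z -> z != w -> differentiable k z) ->
  int_square k = int_rect k (complex.Re w - dl) (complex.Re w + dl) (complex.Im w - dl) (complex.Im w + dl).
Proof.
move=> w1 dl0 dl1 kd; set x := complex.Re w; set y := complex.Im w.
have := Re_le w; have := Im_le w; rewrite !ler_norml -/x -/y => /andP[y1 y2] /andP[x1 x2].
have hb a b c d : -1 <= a -> b <= 1 -> -1 <= c -> d <= 1 ->
    x != a -> x != b -> y != c -> y != d -> bdry_cont k a b c d.
  move=> a1 b1 c1 d1 h1 h2 h3 h4 z [[/andP[z1 z2] /andP[z3 z4]] hz].
  apply: differentiable_continuous; apply: kd.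
    by split; apply/andP; split; [exact: le_trans z1|exact: le_trans b1|exact: le_trans z3|exact: le_trans d1].
  by apply/eqP => zw; move: h1 h2 h3 h4; rewrite /x /y -zw; case: hz => ->; rewrite eqxx.
have hd a b c d : -1 <= a -> a < b -> b <= 1 -> -1 <= c -> c < d -> d <= 1 ->
   (x < a \/ b < x \/ y < c \/ d < y) -> int_rect k a b c d = 0.
  move=> a1 ab b1 c1 cd d1 h; apply: Goursat => // z [/andP[z1 z2] /andP[z3 z4]].
  apply: kd.
    by split; apply/andP; split; [exact: le_trans z1|exact: le_trans b1|exact: le_trans z3|exact: le_trans d1].
  apply/eqP => zw; move: z1 z2 z3 z4 h; rewrite zw -/x -/y => z1 z2 z3 z4.
  by case=> [|[|[]]]; lra.
have ne (a b : R) : (a < b \/ b < a) -> a != b by case=> h; [rewrite lt_eqF|rewrite gt_eqF].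
rewrite /int_square (@int_rect_splitv _ k (-1) (x - dl)); last 3 first.
- by apply/andP; split; lra.
- exact: m1.
- by apply: hb; try apply: ne; lra.
have -> : int_rect k (-1) (x - dl) (-1) 1 = 0 by apply: hd; lra.
rewrite add0r.
rewrite (@int_rect_splitv _ k (x - dl) (x + dl)); last 3 first.
- by apply/andP; split; lra.
- exact: m1.
- by apply: hb; try apply: ne; lra.
have -> : int_rect k (x + dl) 1 (-1) 1 = 0 by apply: hd; lra.
rewrite addr0.
rewrite (@int_rect_splith _ k _ _ _ (y - dl)); last 3 first.
- by lra.
- by apply/andP; split; lra.
- by apply: hb; try apply: ne; lra.
have -> : int_rect k (x - dl) (x + dl) (-1) (y - dl) = 0 by apply: hd; lra.
rewrite add0r (@int_rect_splith _ k _ _ _ (y + dl)); last 3 first.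
- by lra.
- by apply/andP; split; lra.
- by apply: hb; try apply: ne; lra.
have -> : int_rect k (x - dl) (x + dl) (y + dl) 1 = 0 by apply: hd; lra.
by rewrite addr0.
Qed.

(** The integrand (g z - g w) / (z - w) stays bounded near w, so its integral over small
    squares around w is arbitrarily small; what remains is the kernel times g w. *)
Theorem cauchy (g : C -> C) (w : C) : rnorm w < 1 ->
  (forall z, in_square z -> differentiable g z) ->
  int_square (fun z => g z * (z - w)^-1) = c0 * g w.
Proof.
move=> w1 gd.
have win : in_square w.
  split; rewrite -ler_norml ltW //; apply: le_lt_trans w1; by [exact: Re_le|exact: Im_le].
pose f (z : C) := (z - w)^-1.
have fd (z : C) : z != w -> differentiable f z.
  move=> zw; apply: (differentiableV (f := fun z : C => z - w)); last by rewrite subr_eq0.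
  by apply: differentiableB; [exact: differentiableC_id|exact: differentiable_cst].
pose k1 z := g z * f z; pose k2 z := g w * f z; pose k3 z := (g z - g w) * f z.
have kd1 z : in_square z -> z != w -> differentiable k1 z.
  by move=> zi zw; apply: differentiableM; [exact: gd|exact: fd].
have kd2 z : in_square z -> z != w -> differentiable f z by move=> _; exact: fd.
have kd3 z : in_square z -> z != w -> differentiable k3 z.
  move=> zi zw; apply: differentiableM; last exact: fd.
  by apply: differentiableB; [exact: gd|exact: differentiable_cst].
have [e0 e00 He] := differential_estimate (gd _ win) (@ltr01 R).
pose K := 1 + rnorm ('d g w (1 : C)).
have K0 : 0 <= K by rewrite addr_ge0 // rnorm_ge0.
have kB z : z != w -> rnorm (z - w) < e0 -> rnorm (k3 z) <= K.
  move=> zw ze; rewrite /k3 /f rnormM rnormV ler_pdivrMr ?rnorm_gt0 ?subr_eq0 //.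
  have := He _ ze; rewrite [w + _]addrC subrK mul1r => h.
  have -> : g z - g w = (g z - g w - 'd g w (z - w)) + 'd g w (z - w) by rewrite subrK.
  apply: le_trans (rnormD (V := C) _ _) _; rewrite /K mulrDl mul1r lerD //.
  have -> : z - w = (z - w) *: (1 : C) by rewrite /GRing.scale /= mulr1.
  by rewrite linearZ /= rnormZ rnormZ rnorm1 mulr1 mulrC.
apply/eqP; rewrite -subr_eq0 -(rnorm_eq0 (V := C)) eq_le rnorm_ge0 andbT.
apply/ler_addgt0Pr => e egt0; rewrite add0r.
have hr : 0 < 1 - rnorm w by rewrite subr_gt0.
(* since k3 is bounded by K there, its integral along the boundary of the square of half
   side dl is at most 16 K dl *)
pose dl := Num.min ((1 - rnorm w) / 2) (Num.min (e0 / 4) (e / (16 * (K + 1)))).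
have K1 : 0 < K + 1 by rewrite ltr_wpDl.
have dl0 : 0 < dl by rewrite !lt_min !divr_gt0 // mulr_gt0.
have dl1 : dl < 1 - rnorm w.
  by apply: (@le_lt_trans _ _ ((1 - rnorm w) / 2)); [rewrite ge_min lexx|lra].
have dl2 : dl <= e0 / 4 by rewrite ge_min ge_min lexx orbT.
have dl3 : 16 * (K + 1) * dl <= e.
  by rewrite mulrC -ler_pdivlMr ?mulr_gt0 // !ge_min lexx !orbT.
have E : int_square k1 = int_square k2 + int_square k3.
  rewrite -int_squareD.
  - by congr int_square; apply/funext => z; rewrite /k1 /k2 /k3 -mulrDl addrC subrK.
  - move=> z hz; apply: contCM; first exact: contC_cst.
    by apply: differentiable_continuous; apply: fd; rewrite -subr_eq0; exact: on_square_neq.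
  - move=> z hz; apply: differentiable_continuous; apply: kd3; first exact: on_square_in.
    by rewrite -subr_eq0; exact: on_square_neq.
have -> : (fun z => g z / (z - w)) = k1 by [].
rewrite E (int_squareZ _ (cauchy_cont w1)) (int_square_cauchy_kernel w1) mulrC addrAC subrr add0r.
rewrite (excision w1 dl0 dl1 kd3).
set x := complex.Re w; set y := complex.Im w.
have := Re_le w; have := Im_le w; rewrite !ler_norml -/x -/y => /andP[y1 y2] /andP[x1 x2].
have bw z : rect_bdry (x - dl) (x + dl) (y - dl) (y + dl) z -> [/\ in_square z, z != w & rnorm (z - w) < e0].
  move=> [[/andP[z1 z2] /andP[z3 z4]] hz]; split.
  - by split; apply/andP; split; lra.
  - by apply/eqP => zw; move: hz; rewrite zw -/x -/y; case; lra.
  - apply: le_lt_trans (rnorm_le _) _.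
    have -> : complex.Re (z - w) = complex.Re z - x by rewrite CReD CReN.
    have -> : complex.Im (z - w) = complex.Im z - y by rewrite CImD CImN.
    have h1 : `|complex.Re z - x| <= dl by rewrite ler_norml; apply/andP; split; lra.
    have h2 : `|complex.Im z - y| <= dl by rewrite ler_norml; apply/andP; split; lra.
    by lra.
have bc : bdry_cont k3 (x - dl) (x + dl) (y - dl) (y + dl).
  by move=> z /bw[z1 z2 z3]; apply: differentiable_continuous; exact: kd3.
have h1 : x - dl <= x + dl by lra.
have h2 : y - dl <= y + dl by lra.
apply: le_trans (int_rect_bound h1 h2 bc (B := K) _) _; first by move=> z /bw[z1 z2 z3]; exact: kB.
by apply: le_trans dl3; rewrite -subr_ge0; have := ltW dl0; nra.
Qed.

(** Normalised so that Cauchy's formula holds with constant 1. *)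
Definition cauchy_int (f : C -> C) : C := c0^-1 * int_square f.

Definition cauchy_cst : R := 16 * rnorm c0^-1.

Lemma cauchy_cst_ge0 : 0 <= cauchy_cst. Proof. by rewrite mulr_ge0 // rnorm_ge0. Qed.

Lemma cauchy_int_bound f (B : R) : square_cont f -> (forall z, on_square z -> rnorm (f z) <= B) ->
  rnorm (cauchy_int f) <= cauchy_cst * B.
Proof.
move=> cf fB; rewrite /cauchy_int rnormM /cauchy_cst mulrAC mulrC ler_wpM2r ?rnorm_ge0 //.
exact: int_square_bound.
Qed.

Lemma cauchy_intD f g : square_cont f -> square_cont g ->
  cauchy_int (fun z => f z + g z) = cauchy_int f + cauchy_int g.
Proof. by move=> cf cg; rewrite /cauchy_int int_squareD // mulrDr. Qed.

Lemma cauchy_intZ l f : square_cont f -> cauchy_int (fun z => l * f z) = l * cauchy_int f.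
Proof. by move=> cf; rewrite /cauchy_int int_squareZ // mulrCA. Qed.

Lemma cauchy_int_FTC f P : square_cont f -> (forall z, on_square z -> is_derive z 1 P (f z)) -> cauchy_int f = 0.
Proof. by move=> cf dP; rewrite /cauchy_int (int_square_FTC cf dP) mulr0. Qed.

Lemma cauchy_int_kernel (g : C -> C) (w : C) : rnorm w < 1 ->
  (forall z, in_square z -> differentiable g z) ->
  cauchy_int (fun z => g z * (z - w)^-1) = g w.
Proof. by move=> w1 gd; rewrite /cauchy_int cauchy // mulKf // c0_neq0. Qed.

Definition taylor_coef (g : C -> C) k := cauchy_int (fun z => g z * (z ^+ k.+1)^-1).

(** Integrate the finite geometric expansion of the kernel against g; on the contour |z - w|
    >= 1/2. *)
Lemma taylor_remainder (g : C -> C) (B : R) N (w : C) : rnorm w <= 2^-1 ->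
  (forall z, in_square z -> differentiable g z) ->
  (forall z, on_square z -> rnorm (g z) <= B) ->
  rnorm (g w - \sum_(k < N) taylor_coef g k * w ^+ k) <= 2 * cauchy_cst * B * rnorm w ^+ N.
Proof.
move=> w2 gd gB.
have w1 : rnorm w < 1 by apply: le_lt_trans w2 _; rewrite invf_lt1 // ltr1n.
have gc : square_cont g by move=> z /on_square_in /gd; exact: differentiable_continuous.
have c1 k : square_cont (fun z => g z * (z ^+ k.+1)^-1).
  by move=> z hz; apply: contCM; [exact: gc|exact: invX_cont].
have c2 : square_cont (fun z => g z * ((z ^+ N)^-1 * (z - w)^-1)).
  by move=> z hz; apply: contCM; [exact: gc|apply: contCM; [exact: invX_cont|exact: cauchy_cont]].
have c1' (k : 'I_N) : square_cont (fun z => w ^+ k * (g z * (z ^+ k.+1)^-1)).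
  by move=> z hz; apply: contCM; [exact: contC_cst|exact: c1].
have c2' : square_cont (fun z => w ^+ N * (g z * ((z ^+ N)^-1 * (z - w)^-1))).
  by move=> z hz; apply: contCM; [exact: contC_cst|exact: c2].
have [s1 s2] := int_square_sum (index_enum 'I_N) c1'.
have c3 : square_cont (fun z => g z * (z - w)^-1).
  by move=> z hz; apply: contCM; [exact: gc|exact: cauchy_cont].
have E : g w = \sum_(k < N) taylor_coef g k * w ^+ k + w ^+ N * cauchy_int (fun z => g z * ((z ^+ N)^-1
  * (z - w)^-1)).
  rewrite -(cauchy_int_kernel w1 gd) -cauchy_intZ //.
  have -> : \sum_(k < N) taylor_coef g k * w ^+ k =
      cauchy_int (fun z => \sum_(k < N) w ^+ k * (g z * (z ^+ k.+1)^-1)).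
    rewrite /cauchy_int s2 mulr_sumr; apply: eq_bigr => i _.
    by rewrite (int_squareZ _ (c1 i)) /taylor_coef /cauchy_int mulrCA mulrC.
  rewrite -(cauchy_intD s1 c2') /cauchy_int; congr (_ * _); apply: eq_int_square; first exact: c3.
  move=> z hz; rewrite {1}(cauchy_expand N (on_square_neq0 hz) (on_square_neq w1 hz)) mulrDr mulr_sumr.
  by congr (_ + _); [apply: eq_bigr => i _|]; rewrite mulrCA.
rewrite {1}E addrAC subrr add0r rnormM rnormX mulrC ler_wpM2r ?exprn_ge0 ?rnorm_ge0 //.
have -> : 2 * cauchy_cst * B = cauchy_cst * (2 * B) by rewrite mulrAC mulrC.
apply: (@cauchy_int_bound _ (2 * B)); first exact: c2.
move=> z hz.
have B0 : 0 <= B by apply: le_trans (gB _ hz); exact: rnorm_ge0.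
rewrite rnormM [2 * B]mulrC; apply: ler_pM; rewrite ?rnorm_ge0 ?gB //.
rewrite rnormM !rnormV rnormX -[leRHS]mul1r; apply: ler_pM; rewrite ?invr_ge0 ?exprn_ge0 ?rnorm_ge0 //.
  have hz1 := on_square_ge1 hz.
  by rewrite invf_le1; [exact: exprn_ege1|apply: exprn_gt0; exact: lt_le_trans hz1].
rewrite -[leRHS]invrK lef_pV2 ?posrE ?invr_gt0 //; last by rewrite rnorm_gt0; exact: on_square_neq.
by apply: le_trans (on_square_sub w hz); lra.
Qed.

End Cauchy.

(** * Holomorphic functions on normed spaces *)

Section Holomorphic.
Variable R : realType.
Notation C := (Cx R).
Notation rc x := (real_complex R x : Cx R).

Lemma img_seg_compact (T : topologicalType) (f : R -> T) (a b : R) : (forall x, {for x, continuous f}) ->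
  compact (f @` `[a, b]).
Proof.
move=> cf; apply: continuous_compact; last exact: segment_compact.
by apply: continuous_subspaceT => x; exact: cf.
Qed.

Lemma in_square_compact : compact (@in_square R).
Proof.
have -> : @in_square R = (fun p : R * R => cx p.1 p.2) @` (`[-1, 1] `*` `[-1, 1]).
  apply/seteqP; split => [[x y] [h1 h2]|_ [[x y] [h1 h2] <-]].
    by exists (x, y) => //; split; rewrite /= in_itv.
  by move: h1 h2; rewrite /= !in_itv.
apply: continuous_compact; last by apply: compact_setX; exact: segment_compact.
apply: continuous_subspaceT => p; apply: cont_Complex; [exact: cvg_fst|exact: cvg_snd].
Qed.

Lemma on_square_compact : compact (@on_square R).
Proof.
have -> : @on_square R = ((cx (-1)) @` `[-1, 1] `|` (cx 1) @` `[-1, 1]) `|`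
   ((fun x => cx x (-1)) @` `[-1, 1] `|` (fun x => cx x 1) @` `[-1, 1]).
  apply/seteqP; split => [[x y] [[h1 h2]]|]; rewrite /= ?in_itv.
    case=> e; [left; left; exists y|left; right; exists y|right; left; exists x|right; right; exists x];
    by rewrite ?in_itv //= -e.
  have h : -1 <= 1 :> R by rewrite lerNl; lra.
  move=> z [[[y yi <-]|[y yi <-]]|[[y yi <-]|[y yi <-]]]; move: yi; rewrite /= in_itv /= => yi.
  - by split; [split => //=; rewrite lexx h|constructor 1].
  - by split; [split => //=; rewrite lexx h|constructor 2].
  - by split; [split => //=; rewrite lexx h|constructor 3].
  - by split; [split => //=; rewrite lexx h|constructor 4].
by apply: compactU; apply: compactU; apply: img_seg_compact => x; by [exact: cxv_cont|exact: cxh_cont].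
Qed.

Lemma square_bounded (f : C -> C) : square_cont f -> exists2 B : R, 0 < B & forall z, on_square z -> rnorm (f z) <= B.
Proof.
move=> cf; have := on_square_compact; rewrite compact_near_coveringP => /(_ R (pinfty_nbhs R)
  (fun B z => rnorm (f z) <= B) _) [].
  move=> z hz; have /continuous_rnormP/(_ _ (@ltr01 R)) cz := cf z hz.
  exists ([set w | rnorm (f w - f z) < 1], [set B | rnorm (f z) + 1 < B]).
    by split; [exact: cz|apply: nbhs_pinfty_gt; rewrite num_real].
  move=> [w B] /= [h1 h2]; apply: le_trans (ltW h2).
  by apply: le_trans (rnorm_triB (V := C) _ (f z)) _; rewrite addrC lerD2l ltW.
move=> M [_ H]; exists (Num.max M 0 + 1); first by rewrite ltr_pwDr // le_max lexx orbT.
by move=> z hz; apply: H => //; rewrite ltr_pwDr // le_max lexx.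
Qed.

Section V.
Variable V : normedModType C.
Implicit Types (h f : V -> C) (z v : V) (U : set V).

Lemma contV_cst (T : topologicalType) (x : T) (v : V) : {for x, continuous (fun _ : T => v)}.
Proof. exact: cst_continuous. Qed.
Lemma contV_id (v : V) : {for v, continuous (fun u : V => u)}.
Proof. exact: cvg_id. Qed.
Lemma contVD (T : topologicalType) (f g : T -> V) (x : T) : {for x, continuous f} ->
  {for x, continuous g} -> {for x, continuous (fun y => f y + g y)}.
Proof. by move=> cf cg; exact: (cvgD cf cg). Qed.
Lemma contVZ (T : topologicalType) (k : T -> C) (v : V) (x : T) : {for x, continuous k} ->
  {for x, continuous (fun y => k y *: v)}.
Proof.
move=> /continuous_rnormP ck; apply/continuous_rnormP => e e0.
have v1 : 0 < rnorm v + 1 by rewrite ltr_wpDl // rnorm_ge0.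
have e1 : 0 < e / (rnorm v + 1) by rewrite divr_gt0.
have := ck _ e1; apply: filterS => y; rewrite ltr_pdivlMr // => h.
rewrite -scalerBl rnormZ; apply: le_lt_trans h.
by apply: ler_wpM2l; rewrite ?rnorm_ge0 // lerDl.
Qed.

Definition hol (U : set V) h := forall z, U z -> differentiable h z.

Lemma line_is_deriveC h z v (t : C) : differentiable h (z + t *: v) ->
  is_derive t 1 (fun t : C => h (z + t *: v)) ('d h (z + t *: v) v).
Proof.
move=> hd.
have H : differentiable (fun t : C => h (z + t *: v)) t /\
  'd (fun t : C => h (z + t *: v)) t = (fun s : C => 'd h (z + t *: v) (s *: v)) :> (C -> C).
  have lv : linear (fun s : C => 'd h (z + t *: v) (s *: v)).
    by move=> a x y; rewrite scalerDl -scalerA !linearP.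
  apply: differentiable_of_estimate => //.
    apply: (@bounded_linear_continuous _ _ _ (rnorm ('d h (z + t *: v) v))) => // s.
    by rewrite linearZ /= rnormZ mulrC.
  move=> e e0; have v1 : 0 < rnorm v + 1 by rewrite ltr_wpDl // rnorm_ge0.
  have e1 : 0 < e / (rnorm v + 1) by rewrite divr_gt0.
  have [d d0 H] := differential_estimate hd e1; exists (d / (rnorm v + 1)); first by rewrite divr_gt0.
  move=> s; rewrite ltr_pdivlMr // => sd.
  have sv : rnorm (s *: v) <= rnorm s * (rnorm v + 1).
    by rewrite rnormZ ler_wpM2l ?rnorm_ge0 // lerDl.
  have := H _ (le_lt_trans sv sd); rewrite scalerDl addrA.
  move/le_trans; apply; apply: (le_trans (ler_wpM2l (ltW e1) sv)).
  by rewrite mulrCA mulrC mulfVK // lt0r_neq0.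
split; first by apply/derivable1_diffP; case: H.
by rewrite deriveE; case: H => // _ ->; rewrite scale1r.
Qed.

Lemma line_diff h z v (t : C) : differentiable h (z + t *: v) ->
  differentiable (fun t : C => h (z + t *: v)) t.
Proof. by move=> /line_is_deriveC[hd _]; apply/derivable1_diffP. Qed.

(** Functions on V are studied on complex lines: these are the Taylor coefficients at 0 of h
    along the line z + t v. *)
Definition line_coef h z v k := taylor_coef (fun t : C => h (z + t *: v)) k.

(** The radius is 2 because the disc has to contain the square of side 2 around 0. *)
Definition disc_differentiable h z v := forall t : C, rnorm t <= 2 -> differentiable h (z + t *: v).

Lemma disc_differentiable_in h z v : disc_differentiable h z v ->
  forall t, in_square t -> differentiable (fun t : C => h (z + t *: v)) t.
Proof. by move=> H t /in_square_le2 /H; exact: line_diff. Qed.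

Lemma line_taylor h z v (B : R) N (w : C) : disc_differentiable h z v ->
  (forall t : C, rnorm t <= 2 -> rnorm (h (z + t *: v)) <= B) -> rnorm w <= 2^-1 ->
  rnorm (h (z + w *: v) - \sum_(k < N) line_coef h z v k * w ^+ k) <= 2 * cauchy_cst R * B * rnorm w ^+ N.
Proof.
move=> hd hB w2; apply: (@taylor_remainder _ (fun t : C => h (z + t *: v)) B N w w2 (disc_differentiable_in hd)).
by move=> t /on_square_in/in_square_le2; exact: hB.
Qed.

Lemma line_coef_cont h z v k : disc_differentiable h z v -> square_cont (fun t : C => h (z + t *: v) * (t ^+ k)^-1).
Proof.
move=> hd t ht; apply: contCM; last exact: invX_cont.
by apply: differentiable_continuous; apply: disc_differentiable_in => //; exact: on_square_in.
Qed.

Lemma line_coef0 h z v : disc_differentiable h z v -> line_coef h z v 0 = h z.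
Proof.
move=> hd; have := @cauchy_int_kernel _ (fun t : C => h (z + t *: v)) 0; rewrite rnorm0 scale0r addr0.
move=> /(_ ltr01 (disc_differentiable_in hd)) <-; rewrite /line_coef /taylor_coef.
by congr cauchy_int; apply/funext => t; rewrite subr0 expr1.
Qed.

Lemma line_coef_bound h z v (B : R) k : disc_differentiable h z v ->
  (forall t : C, rnorm t <= 2 -> rnorm (h (z + t *: v)) <= B) ->
  rnorm (line_coef h z v k) <= cauchy_cst R * B.
Proof.
move=> hd hB; apply: cauchy_int_bound; first exact: line_coef_cont.
move=> t ht; rewrite rnormM rnormV rnormX -[leRHS]mulr1; have t1 := on_square_ge1 ht.
apply: ler_pM; rewrite ?invr_ge0 ?exprn_ge0 ?rnorm_ge0 //.
  by apply: hB; exact/in_square_le2/on_square_in.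
by rewrite invf_le1; [exact: exprn_ege1|apply: exprn_gt0; exact: lt_le_trans t1].
Qed.

(** Turns a linear estimate in a free small radius into an exact inequality. *)
Lemma le0_of_linear (x K d : R) : 0 < d -> (forall r, 0 < r -> r < d -> x <= K * r) -> x <= 0.
Proof.
move=> d0 H; apply/ler_addgt0Pr => e e0; rewrite add0r.
have K1 : 0 < `|K| + 1 by rewrite ltr_wpDl.
pose r := Num.min (d / 2) (e / (`|K| + 1)).
have r0 : 0 < r by rewrite lt_min !divr_gt0.
have rd : r < d.
  by apply: (@le_lt_trans _ _ (d / 2)); [rewrite ge_min lexx|lra].
apply: le_trans (H _ r0 rd) _; have r1 : r * (`|K| + 1) <= e.
  by rewrite -ler_pdivlMr // ge_min lexx orbT.
apply: le_trans r1; rewrite mulrC; apply: ler_wpM2l; first exact: ltW.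
by apply: le_trans (ler_norm _) _; rewrite lerDl.
Qed.

(** Both sides are the derivative at 0 of h along the line: compare Taylor's formula of
    order 2 with the definition of the differential. *)
Lemma line_coef1 h z v : disc_differentiable h z v -> line_coef h z v 1 = 'd h z v.
Proof.
move=> hd.
have [B B0 hB] : exists2 B : R, 0 < B & forall t, on_square t -> rnorm (h (z + t *: v)) <= B.
  by apply: square_bounded => t /on_square_in ht; apply: differentiable_continuous; exact: disc_differentiable_in.
have hd0 : differentiable h (z + 0 *: v) by apply: hd; rewrite rnorm0.
have hd1 := is_derive_cx (line_is_deriveC hd0).
apply/eqP; rewrite -subr_eq0 -(rnorm_eq0 (V := C)) eq_le rnorm_ge0 andbT.
apply/ler_addgt0Pr => e e0; rewrite add0r.
have [d d0 {}hd1] := hd1 _ e0.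
rewrite -subr_le0; apply: (@le0_of_linear _ (2 * cauchy_cst R * B) (Num.min d 2^-1)).
  by rewrite lt_min d0 invr_gt0 ltr0n.
move=> r r0; rewrite lt_min => /andP[rd r2].
have nr : rnorm (rc r : C) = r by rewrite rnorm_rc gtr0_norm.
have := hd1 (rc r); rewrite nr => /(_ rd); rewrite add0r scale0r addr0 => h1.
have := @taylor_remainder _ (fun t : C => h (z + t *: v)) B 2 (rc r); rewrite nr.
move=> /(_ (ltW r2) (disc_differentiable_in hd) hB); rewrite !big_ord_recl big_ord0 /= => h2.
rewrite -/(line_coef h z v 0) -/(line_coef h z v (bump 0 0)) line_coef0 // in h2.
rewrite expr0 mulr1 addr0 /bump /= addn0 expr1 in h2.
rewrite -(ler_pM2r r0).
have E : rnorm (line_coef h z v 1 - 'd h z v) * r =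
    rnorm ((h (z + rc r *: v) - h z - 'd h z v * rc r) - (h (z + rc r *: v) - (h z + line_coef h z v 1 * rc r))).
  by rewrite -{1}nr -rnormM; congr rnorm; ring.
have : rnorm (line_coef h z v 1 - 'd h z v) * r <= e * r + 2 * cauchy_cst R * B * r ^+ 2.
  by rewrite E; apply: le_trans (rnormB (V := C) _ _) _; apply: lerD.
by move: (rnorm _) (2 * cauchy_cst R * B) => X Y; rewrite expr2; clear; lra.
Qed.

(** The common hypothesis of the Cauchy estimates. *)
Definition bounded_on_ball h z (rho B : R) := forall u, rnorm (u - z) < rho -> differentiable h u /\ rnorm (h u) <= B.

Lemma bounded_on_ball_line h z v (rho B : R) : bounded_on_ball h z rho B -> 2 * rnorm v < rho ->
  disc_differentiable h z v /\ (forall t : C, rnorm t <= 2 -> rnorm (h (z + t *: v)) <= B).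
Proof.
move=> H vr; have aux (t : C) : rnorm t <= 2 -> rnorm (z + t *: v - z) < rho.
  move=> t2; rewrite addrAC subrr add0r rnormZ; apply: le_lt_trans vr.
  by rewrite ler_wpM2r // rnorm_ge0.
by split=> t /aux /H[].
Qed.

(** Taylor's formula of order 2 on the line through v, rescaled so that the square of the
    Cauchy integral has the size of the ball. *)
Lemma bounded_on_ball_second h z v (rho B : R) : 0 < rho -> bounded_on_ball h z rho B -> 8 * rnorm v <= rho ->
  rnorm (h (z + v) - h z - 'd h z v) <= 32 * cauchy_cst R * B / rho ^+ 2 * rnorm v ^+ 2.
Proof.
move=> r0 H vr.
have [->|v0] := eqVneq v 0.
  by rewrite addr0 subrr linear0 subr0 !rnorm0 expr0n mulr0.
have nv : 0 < rnorm v by rewrite rnorm_gt0.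
have nv0 := lt0r_neq0 nv; have r00 := lt0r_neq0 r0.
pose s := 4 * rnorm v / rho; have s0 : 0 < s by rewrite divr_gt0 // mulr_gt0.
have s00 : (rc s : C) != 0 by rewrite -(rnorm_gt0 (V := C)) rnorm_rc gtr0_norm.
pose v' := (rc s)^-1 *: v.
have nv' : rnorm v' = rho / 4.
  by rewrite rnormZ rnormV rnorm_rc gtr0_norm // /s; field; rewrite nv0 r00.
have [ld lB] : disc_differentiable h z v' /\ (forall t : C, rnorm t <= 2 -> rnorm (h (z + t *: v')) <= B).
  by apply: bounded_on_ball_line H _; rewrite nv'; lra.
have ws : rnorm (rc s : C) = s by rewrite rnorm_rc gtr0_norm.
have := @line_taylor h z v' B 2 (rc s) ld lB; rewrite ws => h1.
have {}h1 := h1 _; rewrite !big_ord_recl big_ord0 /= in h1.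
rewrite line_coef0 // expr0 mulr1 addr0 /bump /= addn0 line_coef1 // expr1 in h1.
have E : rc s *: v' = v by rewrite scalerA mulfV // scale1r.
rewrite E in h1.
have E2 : 'd h z v' * rc s = 'd h z v.
  have -> : 'd h z v = rc s * 'd h z v' by rewrite -{1}E; exact: linearZ.
  exact: mulrC.
rewrite E2 opprD addrA in h1.
apply: le_trans (h1 _) _; first by rewrite /s ler_pdivrMr //; lra.
rewrite le_eqVlt; apply/orP; left; apply/eqP; rewrite /s.
by field.
Qed.

Lemma bounded_on_ball_diff h z v (rho B : R) : 0 < rho -> bounded_on_ball h z rho B ->
  rnorm ('d h z v) <= 4 * cauchy_cst R * B / rho * rnorm v.
Proof.
move=> r0 H.
have [->|v0] := eqVneq v 0; first by rewrite linear0 !rnorm0 mulr0.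
have nv : 0 < rnorm v by rewrite rnorm_gt0.
have nv0 := lt0r_neq0 nv; have r00 := lt0r_neq0 r0.
pose s := 4 * rnorm v / rho; have s0 : 0 < s by rewrite divr_gt0 // mulr_gt0.
have s00 : (rc s : C) != 0 by rewrite -(rnorm_gt0 (V := C)) rnorm_rc gtr0_norm.
pose v' := (rc s)^-1 *: v.
have nv' : rnorm v' = rho / 4.
  by rewrite rnormZ rnormV rnorm_rc gtr0_norm // /s; field; rewrite nv0 r00.
have [ld lB] : disc_differentiable h z v' /\ (forall t : C, rnorm t <= 2 -> rnorm (h (z + t *: v')) <= B).
  by apply: bounded_on_ball_line H _; rewrite nv'; lra.
have E : rc s *: v' = v by rewrite scalerA mulfV // scale1r.
have := @line_coef_bound h z v' B 1 ld lB; rewrite line_coef1 // => h1.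
rewrite -{1}E linearZ /= rnormZ rnorm_rc gtr0_norm //.
apply: le_trans (ler_wpM2l (ltW s0) h1) _.
by rewrite le_eqVlt; apply/orP; left; apply/eqP; rewrite /s; field.
Qed.

Lemma locally_bounded_on_ball U h z : open U -> hol U h -> U z ->
  exists2 rho : R, 0 < rho & exists2 B : R, 0 < B &
   bounded_on_ball h z rho B /\ (forall u, rnorm (u - z) < rho -> U u).
Proof.
move=> oU hU Uz.
have : \forall u \near z, U u by apply: open_nbhs_nbhs; split.
move=> /near_rnormP[r1 r10 H1].
have /continuous_rnormP/(_ _ (@ltr01 R))/near_rnormP[r2 r20 H2] := differentiable_continuous (hU _ Uz).
exists (Num.min r1 r2); first by rewrite lt_min r10.
exists (rnorm (h z) + 1); first by rewrite ltr_wpDl // rnorm_ge0.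
split=> u; rewrite lt_min => /andP[u1 u2]; last exact: H1.
split; first by apply: hU; exact: H1.
apply: le_trans (rnorm_triB (V := C) _ (h z)) _; rewrite addrC lerD2l ltW //; exact: H2.
Qed.

Lemma bounded_on_ball_sub h z z' (rho rho' B : R) : bounded_on_ball h z rho B -> rnorm (z' - z) + rho' <= rho ->
  bounded_on_ball h z' rho' B.
Proof.
move=> H zz u uz; apply: H; apply: lt_le_trans zz.
have -> : u - z = (z' - z) + (u - z') by rewrite [RHS]addrC addrA subrK.
by apply: le_lt_trans (rnormD _ _) _; rewrite ltrD2l.
Qed.

(** On a small ball the differential is a uniform limit of difference quotients, which are
    continuous. *)
Lemma diff_dir_cont U h v z : open U -> hol U h -> U z -> {for z, continuous (fun z => 'd h z v)}.
Proof.
move=> oU hU Uz; have [rho r0 [B B0 [bb bU]]] := locally_bounded_on_ball oU hU Uz.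
apply/continuous_rnormP => e e0.
have cs := cauchy_cst_ge0 R.
pose K := 32 * cauchy_cst R * B / (rho / 2) ^+ 2.
have K0 : 0 <= K by rewrite /K; do !apply: mulr_ge0 => //; rewrite ?invr_ge0 ?exprn_ge0 //; lra.
have nv := rnorm_ge0 v.
pose s := Num.min (rho / (16 * (rnorm v + 1))) (e / (4 * (K * rnorm v ^+ 2 + 1))).
have a1 : 0 < 16 * (rnorm v + 1) by rewrite mulr_gt0 // ltr_wpDl.
have a2 : 0 < 4 * (K * rnorm v ^+ 2 + 1).
  by rewrite mulr_gt0 // ltr_wpDl // mulr_ge0 // exprn_ge0.
have s0 : 0 < s by rewrite lt_min !divr_gt0.
have s1 : s * (16 * (rnorm v + 1)) <= rho by rewrite -ler_pdivlMr // ge_min lexx.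
have s2 : s * (4 * (K * rnorm v ^+ 2 + 1)) <= e by rewrite -ler_pdivlMr // ge_min lexx orbT.
have ns : rnorm (rc s : C) = s by rewrite rnorm_rc gtr0_norm.
have s00 : (rc s : C) != 0 by rewrite -(rnorm_gt0 (V := C)) ns.
pose dq z' := (rc s)^-1 * (h (z' + rc s *: v) - h z').
have est z' : rnorm (z' - z) < rho / 2 -> rnorm (dq z' - 'd h z' v) <= e / 4.
  move=> zz; have b' : bounded_on_ball h z' (rho / 2) B by apply: bounded_on_ball_sub bb _; lra.
  have r2 : 0 < rho / 2 by rewrite divr_gt0.
  have sv : 8 * rnorm (rc s *: v) <= rho / 2.
    rewrite rnormZ ns; apply: (@le_trans _ _ (s * (8 * (rnorm v + 1)))).
      by rewrite mulrCA ler_wpM2l ?(ltW s0) // ler_wpM2l // lerDl.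
    by lra.
  have := bounded_on_ball_second r2 b' sv; rewrite -/K rnormZ ns linearZ /= => h1.
  have -> : dq z' - 'd h z' v = (rc s)^-1 * (h (z' + rc s *: v) - h z' - rc s * 'd h z' v).
    by rewrite /dq [in RHS]mulrBr mulKf.
  rewrite rnormM rnormV ns mulrC ler_pdivrMr //; apply: le_trans h1 _.
  have -> : K * (s * rnorm v) ^+ 2 = s * (K * rnorm v ^+ 2) * s by rewrite exprMn expr2; ring.
  apply: ler_wpM2r; first exact: ltW.
  by lra.
have cq : {for z, continuous dq}.
  apply: contCM; first exact: contC_cst.
  apply: contCB; last by apply: differentiable_continuous; exact: hU.
  have c1 : {for z, continuous (fun z' => z' + rc s *: v)}.
    by apply: contVD; [exact: contV_id|exact: contV_cst].
  apply: (continuous_comp c1); apply: differentiable_continuous; apply: hU; apply: bU.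
  rewrite addrAC subrr add0r rnormZ ns; have := ltW s0; nra.
have e4 : 0 < e / 4 by rewrite divr_gt0.
have /continuous_rnormP/(_ _ e4)/near_rnormP[d d0 H] := cq.
apply/near_rnormP; exists (Num.min d (rho / 2)); first by rewrite lt_min d0 divr_gt0.
move=> u; rewrite lt_min => /andP[u1 u2].
have h1 := est _ u2; have h2 := H _ u1.
have h3 : rnorm (dq z - 'd h z v) <= e / 4 by apply: est; rewrite subrr rnorm0 divr_gt0.
have -> : 'd h u v - 'd h z v = (dq u - dq z) - (dq u - 'd h u v) + (dq z - 'd h z v) by ring.
apply: le_lt_trans (rnormD (V := C) _ _) _.
apply: le_lt_trans (lerD (rnormB (V := C) _ _) (lexx _)) _.
by move: h1 h2 h3; set x1 := rnorm _; set x2 := rnorm _; set x3 := rnorm _; lra.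
Qed.

(** Compactness of the contour gives one radius and one bound for all its points. *)
Lemma param_uniform U h (g k : C -> C) (gam : C -> V) z0 : open U -> hol U h ->
  (forall t, on_square t -> {for t, continuous gam}) -> square_cont k ->
  (forall t, on_square t -> U (z0 + gam t)) ->
  exists2 rho : R, 0 < rho & forall t, on_square t ->
    bounded_on_ball h (z0 + gam t) rho rho^-1 /\ rnorm (k t) <= rho^-1.
Proof.
move=> oU hU cg ck Ug.
have := on_square_compact; rewrite compact_near_coveringP => /(_ R (0^'+)
  (fun rho t => bounded_on_ball h (z0 + gam t) rho rho^-1 /\ rnorm (k t) <= rho^-1) _) [].
  move=> t ht.
  have [r r0 [B B0 [bb _]]] := locally_bounded_on_ball oU hU (Ug _ ht).
  have /continuous_rnormP/(_ _ (@ltr01 R)) ct := ck t ht.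
  have r2 : 0 < r / 2 by rewrite divr_gt0.
  have /continuous_rnormP/(_ _ r2) gt_ := cg t ht.
  pose M := B + (rnorm (k t) + 1).
  have M0 : 0 < M by rewrite ltr_wpDr // addr_ge0 // rnorm_ge0.
  exists ([set w | rnorm (k w - k t) < 1 /\ rnorm (gam w - gam t) < r / 2],
     [set rho | [/\ 0 < rho, rho < r / 2 & rho < M^-1]]).
    split; first exact: filterI.
    have M1 : 0 < M^-1 by rewrite invr_gt0.
    exact: filterS3 (nbhs_right_gt 0) (nbhs_right_lt r2) (nbhs_right_lt M1).
  move=> [w rho] /= [[h1 h2] [h3 h4 h5]].
  have h6 : M <= rho^-1 by rewrite -[M]invrK lef_pV2 ?posrE ?invr_gt0 // ltW.
  split.
    have b' : bounded_on_ball h (z0 + gam w) rho B.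
      by apply: bounded_on_ball_sub bb _; rewrite opprD addrACA subrr add0r; lra.
    move=> u /b'[u1 u2]; split => //; apply: le_trans u2 _; apply: le_trans h6.
    by rewrite /M lerDl addr_ge0 // rnorm_ge0.
  apply: le_trans h6; apply: le_trans (rnorm_triB (V := C) _ (k t)) _.
  by rewrite /M; lra.
move=> r /= r0 H; exists (r / 2); first by rewrite divr_gt0.
have hr : 0 < r / 2 by rewrite divr_gt0.
apply: H => //=; rewrite ?sub0r ?normrN ?gtr0_norm //; lra.
Qed.

(** Differentiation under the integral sign: the second-order estimates are uniform along
    the contour. All holomorphic extensions below are obtained in this way. *)
Theorem param_differentiable U h (k : C -> C) (gam : C -> V) z0 : open U -> hol U h ->
  (forall t, on_square t -> {for t, continuous gam}) -> square_cont k ->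
  (forall t, on_square t -> U (z0 + gam t)) ->
  differentiable (fun w => cauchy_int (fun t => k t * h (w + gam t))) z0.
Proof.
move=> oU hU cg ck Ug.
have [rho r0 H] := param_uniform k oU hU cg ck Ug.
have cgz t w : on_square t -> {for t, continuous (fun t => w + gam t)}.
  by move=> ht; apply: contVD; [exact: contV_cst|exact: cg].
have ch w : rnorm (w - z0) < rho -> square_cont (fun t => k t * h (w + gam t)).
  move=> wz t ht; apply: contCM; first exact: ck.
  apply: (continuous_comp (cgz t w ht)); apply: differentiable_continuous.
  by have [b _] := H _ ht; have [] := b (w + gam t) _; rewrite // opprD addrACA subrr addr0.
have cd v : square_cont (fun t => k t * 'd h (z0 + gam t) v).
  move=> t ht; apply: contCM; first exact: ck.
  have cdz : {for z0 + gam t, continuous (fun z => 'd h z v)}.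
    by apply: diff_dir_cont oU hU _; exact: Ug.
  exact: (continuous_comp (cgz t z0 ht) cdz).
pose L v := cauchy_int (fun t => k t * 'd h (z0 + gam t) v).
have lL : linear L.
  move=> a u v; rewrite /L -[a *: cauchy_int _]/(a * cauchy_int _) -cauchy_intZ; last exact: cd.
  rewrite -cauchy_intD; [|by move=> t ht; apply: contCM; [exact: contC_cst|exact: cd]|exact: cd].
  by congr cauchy_int; apply/funext => t; rewrite linearP mulrDr; congr (_ + _); rewrite mulrCA.
have cs := cauchy_cst_ge0 R; have ri0 : 0 < rho^-1 by rewrite invr_gt0.
suff [] : differentiable (fun w => cauchy_int (fun t => k t * h (w + gam t))) z0 /\
  'd (fun w => cauchy_int (fun t => k t * h (w + gam t))) z0 = L :> (V -> C) by [].
apply: differentiable_of_estimate => //.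
  apply: (@bounded_linear_continuous _ _ _ (cauchy_cst R * (rho^-1 * (4 * cauchy_cst R * rho^-1 / rho)))) => // v.
  rewrite -mulrA; apply: cauchy_int_bound; first exact: cd.
  move=> t ht; have [b kb] := H _ ht; rewrite rnormM -(mulrA rho^-1).
  by apply: ler_pM; rewrite ?rnorm_ge0 //; exact: bounded_on_ball_diff.
move=> e e0; pose K := cauchy_cst R * (rho^-1 * (32 * cauchy_cst R * rho^-1 / rho ^+ 2)).
have K0 : 0 <= K.
  by rewrite /K; do !apply: mulr_ge0 => //; rewrite ?invr_ge0 ?exprn_ge0 // ltW.
exists (Num.min (rho / 8) (e / (K + 1))); first by rewrite lt_min !divr_gt0 // ltr_wpDl.
move=> v; rewrite lt_min => /andP[v1 v2].
have v8 : 8 * rnorm v <= rho by lra.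
have vr : rnorm (z0 + v - z0) < rho by rewrite addrAC subrr add0r; have := rnorm_ge0 v; lra.
have zr : rnorm (z0 - z0) < rho by rewrite subrr rnorm0.
have E : cauchy_int (fun t => k t * h (z0 + v + gam t)) - cauchy_int (fun t => k t * h (z0 + gam t)) - L v
   = cauchy_int (fun t => k t * h (z0 + v + gam t) + ((-1) * (k t * h (z0 + gam t)) + (-1) * (k t
     * 'd h (z0 + gam t) v))).
  have c1 : square_cont (fun t => (-1) * (k t * h (z0 + gam t))).
    by move=> t ht; apply: contCM; [exact: contC_cst|exact: ch].
  have c2 : square_cont (fun t => (-1) * (k t * 'd h (z0 + gam t) v)).
    by move=> t ht; apply: contCM; [exact: contC_cst|exact: cd].
  rewrite (cauchy_intD (ch _ vr)); last by move=> t ht; apply: contCD; [exact: c1|exact: c2].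
  rewrite (cauchy_intD c1 c2) (cauchy_intZ _ (ch _ zr)) (cauchy_intZ _ (cd v)) /L.
  by rewrite !mulN1r addrA.
rewrite E; apply: (@le_trans _ _ (K * rnorm v ^+ 2)).
  rewrite /K -mulrA; apply: cauchy_int_bound.
    move=> t ht; apply: contCD; first exact: ch.
    by apply: contCD; apply: contCM; [exact: contC_cst|exact: ch|exact: contC_cst|exact: cd].
  move=> t ht; have [b kb] := H _ ht.
  have -> : k t * h (z0 + v + gam t) + ((-1) * (k t * h (z0 + gam t)) + (-1) * (k t * 'd h (z0 + gam t) v))
    = k t * (h (z0 + gam t + v) - h (z0 + gam t) - 'd h (z0 + gam t) v).
    by rewrite addrAC; ring.
  rewrite rnormM -(mulrA rho^-1); apply: ler_pM; rewrite ?rnorm_ge0 //.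
  exact: bounded_on_ball_second.
rewrite expr2 mulrA; apply: ler_wpM2r; first exact: rnorm_ge0.
have Kv : rnorm v * (K + 1) <= e by rewrite -ler_pdivlMr ?ltr_wpDl // ltW.
by have := rnorm_ge0 v; nra.
Qed.

(** By Cauchy's formula the derivative along v is an integral of values of h over a small
    disc in the direction v. *)
Lemma diff_dir_hol U h v : open U -> hol U h -> hol U (fun z => 'd h z v).
Proof.
move=> oU hU z0 Uz; have [rho r0 [B B0 [bb bU]]] := locally_bounded_on_ball oU hU Uz.
have nv := rnorm_ge0 v.
pose s := rho / (8 * (rnorm v + 1)).
have a1 : 0 < 8 * (rnorm v + 1) by rewrite mulr_gt0 // ltr_wpDl.
have s0 : 0 < s by rewrite divr_gt0.
have ss : s * (8 * (rnorm v + 1)) = rho by rewrite /s divfK // lt0r_neq0.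
have ns : rnorm (rc s) = s by rewrite rnorm_rc gtr0_norm.
have s00 : rc s != 0 by rewrite -(rnorm_gt0 (V := C)) ns.
have nsv : rnorm (rc s *: v) <= rho / 8 by rewrite rnormZ ns; nra.
have cg (t : C) : on_square t -> {for t, continuous (fun t : C => t *: (rc s *: v))}.
  by move=> _; apply: contVZ; exact: contC_id.
have Ug (t : C) : on_square t -> U (z0 + t *: (rc s *: v)).
  move=> /on_square_in/in_square_le2 t2; apply: bU; rewrite addrAC subrr add0r rnormZ.
  have := rnorm_ge0 (rc s *: v); nra.
have D := param_differentiable oU hU cg (@invX_cont R 2) Ug.
have {}D : differentiable (fun w => (rc s)^-1 * cauchy_int (fun t : C => (t ^+ 2)^-1 * h (w + t *: (rc s *: v)))) z0.
  exact: (@differentiableZ _ _ _ _ ((rc s)^-1) _ D).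
suff [] : differentiable (fun z => 'd h z v) z0 /\ 'd (fun z => 'd h z v) z0 =
  'd (fun w => (rc s)^-1 * cauchy_int (fun t : C => (t ^+ 2)^-1 * h (w + t *: (rc s *: v)))) z0 :> (V -> C) by [].
apply: diff_near_eq D.
apply/near_rnormP; exists (rho / 2); first by rewrite divr_gt0.
move=> w wz.
have bw : bounded_on_ball h w (rho / 2) B by apply: bounded_on_ball_sub bb _; lra.
have sv2 : 2 * rnorm (rc s *: v) < rho / 2 by lra.
have [ld _] := bounded_on_ball_line bw sv2.
have := line_coef1 ld; rewrite linearZ /= /line_coef /taylor_coef => e1.
have -> : cauchy_int (fun t : C => (t ^+ 2)^-1 * h (w + t *: (rc s *: v))) =
  cauchy_int (fun t : C => h (w + t *: (rc s *: v)) / t ^+ 2).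
  by congr cauchy_int; apply/funext => t; rewrite mulrC.
by rewrite e1 -[_ *: _]/(rc s * _) mulKf.
Qed.

(** On each complex line through z all Taylor coefficients vanish, by induction on their
    order. *)
Lemma identity_ball h z (rho : R) : (forall u, rnorm (u - z) < rho -> differentiable h u) ->
  (\forall u \near z, h u = 0) -> forall u, rnorm (u - z) < rho / 4 -> h u = 0.
Proof.
move=> hd /near_rnormP[d d0 h0] u uz.
pose v := (2 : C) *: (u - z).
have n2 : rnorm (2 : C) = 2.
  have -> : (2 : C) = rc 2 by rewrite rmorph_nat.
  by rewrite rnorm_rc ger0_norm.
have nv : rnorm v < rho / 2 by rewrite rnormZ n2; lra.
have ld : disc_differentiable h z v.
  move=> t t2; apply: hd; rewrite addrAC subrr add0r rnormZ.
  have := rnorm_ge0 v; have := rnorm_ge0 (V := C) t; nra.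
have [B B0 hB] : exists2 B : R, 0 < B & forall t, on_square t -> rnorm (h (z + t *: v)) <= B.
  by apply: square_bounded => t /on_square_in ht; apply: differentiable_continuous; exact: disc_differentiable_in.
have tay := @taylor_remainder _ (fun t : C => h (z + t *: v)) B _ _ _ (disc_differentiable_in ld) hB.
have co k : line_coef h z v k = 0.
  elim/ltn_ind: k => k IH.
  apply/eqP; rewrite -(rnorm_eq0 (V := C)) eq_le rnorm_ge0 andbT.
  have nv1 : 0 < rnorm v + 1 by rewrite ltr_wpDl // rnorm_ge0.
  apply: (@le0_of_linear _ (2 * cauchy_cst R * B) (Num.min 2^-1 (d / (rnorm v + 1)))).
    by rewrite lt_min invr_gt0 ltr0n divr_gt0.
  move=> r rr0; rewrite lt_min => /andP[r2]; rewrite ltr_pdivlMr // => rd.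
  have nr : rnorm (rc r) = r by rewrite rnorm_rc gtr0_norm.
  have := tay k.+1 (rc r); rewrite nr => /(_ (ltW r2)).
  rewrite h0; last first.
    rewrite addrAC subrr add0r rnormZ nr; apply: le_lt_trans rd; rewrite mulrDr mulr1 lerDl; exact: ltW.
  rewrite big_ord_recr /= big1 => [|i _]; last by rewrite -/(line_coef h z v i) IH ?mul0r.
  rewrite sub0r add0r rnormN rnormM rnormX nr exprS mulrA ler_pM2r ?exprn_gt0 //.
have E : u = z + (2^-1 : C) *: v.
  by rewrite /v scalerA mulVf ?pnatr_eq0 // scale1r addrC subrK.
rewrite E; apply/eqP; rewrite -(rnorm_eq0 (V := C)) eq_le rnorm_ge0 andbT.
have n2' : rnorm (2^-1 : C) = 2^-1 by rewrite rnormV n2.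
apply: (@le0_of_geometric _ _ (2 * cauchy_cst R * B) 2^-1).
  by rewrite invr_ge0 ler0n /= invf_lt1 // ltr1n.
move=> N; have := tay N (2^-1 : C); rewrite n2' lexx => /(_ isT).
by rewrite big1 ?subr0 // => i _; rewrite -/(line_coef h z v i) co mul0r.
Qed.

(** The radius in identity_ball depends only on the distance to the complement of U, so a
    close enough point u reaches z. *)
Lemma identity_closure U h z : open U -> hol U h -> U z ->
  (forall e : R, 0 < e -> exists2 u, rnorm (u - z) < e & \forall w \near u, h w = 0) ->
  \forall w \near z, h w = 0.
Proof.
move=> oU hU Uz H.
have : \forall u \near z, U u by apply: open_nbhs_nbhs; split.
move=> /near_rnormP[r r0 H1].
have r16 : 0 < r / 16 by rewrite divr_gt0.
have [u uz hu] := H _ r16.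
apply/near_rnormP; exists (r / 16) => // w wz.
apply: (@identity_ball h u (r / 2)) => //.
  move=> u' uu; apply: hU; apply: H1.
  have -> : u' - z = (u' - u) + (u - z) by rewrite addrA subrK.
  by apply: le_lt_trans (rnormD _ _) _; lra.
have -> : w - u = (w - z) - (u - z) by rewrite opprB addrA subrK.
by apply: le_lt_trans (rnormB _ _) _; lra.
Qed.

(** The set of points near which h and f agree is open, and it is closed in A by
    identity_closure. *)
Theorem identity_connected U (A : set V) h f z0 : open U -> hol U h -> hol U f ->
  connected A -> A `<=` U -> A z0 -> (\forall w \near z0, h w = f w) ->
  forall z, A z -> \forall w \near z, h w = f w.
Proof.
move=> oU hU fU cA AU Az0 H0.
pose D w := h w - f w.
have DU : hol U D by move=> z Uz; apply: differentiableB; [exact: hU|exact: fU].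
pose Z := [set z : V | \forall w \near z, D w = 0].
have ZE z : Z z <-> \forall w \near z, h w = f w.
  by split; apply: filterS => w /eqP; rewrite ?subr_eq0 ?/D => /eqP // ->; rewrite subrr.
have oZ : open Z.
  rewrite openE => z /near_rnormP[e e0 He]; apply/near_rnormP; exists (e / 2); first by rewrite divr_gt0.
  move=> w wz; apply/near_rnormP; exists (e / 2); first by rewrite divr_gt0.
  move=> u uw; apply: He; have -> : u - z = (u - w) + (w - z) by rewrite addrA subrK.
  by apply: le_lt_trans (rnormD _ _) _; lra.
suff AZ : A `&` Z = A by rewrite -AZ => z [_ /ZE].
apply: cA.
- by exists z0; split => //; apply/ZE.
- by exists Z.
- exists (closure Z); first exact: closed_closure.
  apply/seteqP; split => z [Az hz]; split => //; first exact: subset_closure.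
  apply: (identity_closure oU DU (AU _ Az)) => e e0.
  have : nbhs z [set u | rnorm (u - z) < e] by apply/near_rnormP; exists e.
  by move=> /hz[u [Zu uz]]; exists u.
Qed.

Lemma segment_connected_complex z v : connected [set u | exists2 t : R, 0 <= t <= 1 & u = z + rc t *: v].
Proof.
have -> : [set u | exists2 t : R, 0 <= t <= 1 & u = z + rc t *: v] = (fun t : R => z + rc t *: v) @` `[0, 1].
  apply/seteqP; split => u [t ht]; first by move=> ->; exists t; rewrite //= in_itv.
  by move=> <-; exists t => //; move: ht; rewrite /= in_itv.
apply: connected_continuous_connected; first exact: segment_connected.
suff H t : {for t, continuous (fun t : R => z + rc t *: v)}.
  by apply: continuous_subspaceT => t; exact: H.
apply: contVD; first exact: contV_cst.
apply: (@contVZ _ (fun t : R => rc t)).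
apply: cont_Complex; [exact: cvg_id|exact: cst_continuous].
Qed.

End V.
End Holomorphic.

(** * Quadratic models and local holomorphic extension *)

Section RowVectors.
Variables (R : realType) (n : nat).
Notation C := (Cx R).
Notation rc x := (real_complex R x : Cx R).
Notation V := 'rV[C]_n.
Implicit Types (u v w z b : V) (M : 'M[C]_n).

Lemma rnorm_coord v j : rnorm (v 0 j) <= rnorm v.
Proof.
rewrite -lecR -!normE.
have [->|v0] := eqVneq v 0; first by rewrite mxE normr0.
rewrite [`|v|]mx_normE.
exact: (@le_bigmax_cond _ _ _ _ (0, j) _ (fun i => `|v i.1 i.2|%:nng)).
Qed.

Lemma rnorm_entry v : v != 0 -> exists j, rnorm v = rnorm (v 0 j).
Proof.
move=> v0; have : mx_norm v != 0 by rewrite -[mx_norm v]/(`|v|) normr_eq0.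
move=> /mx_norm_neq0[[i j] /= e]; exists j; apply: (@complexI R).
by rewrite -!normE [LHS]e ord1.
Qed.

Definition N2 v : R := \sum_j rnorm (v 0 j) ^+ 2.

Lemma N2_ge0 v : 0 <= N2 v.
Proof. by apply: sumr_ge0 => j _; rewrite sqr_ge0. Qed.

Lemma N2_coord v j : rnorm (v 0 j) ^+ 2 <= N2 v.
Proof.
rewrite /N2 (bigD1 j) //= lerDl; apply: sumr_ge0 => i _; exact: sqr_ge0.
Qed.

Lemma rnorm_N2 v : rnorm v ^+ 2 <= N2 v.
Proof.
have [->|v0] := eqVneq v 0; first by rewrite rnorm0 expr0n N2_ge0.
by have [j ->] := rnorm_entry v0; exact: N2_coord.
Qed.

Lemma N2_gt0 v : (0 < N2 v) = (v != 0).
Proof.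
apply/idP/idP => [|v0].
  by apply: contraTneq => ->; rewrite /N2 big1 ?ltxx // => j _; rewrite mxE rnorm0 expr0n.
by apply: lt_le_trans (rnorm_N2 v); rewrite exprn_gt0 // rnorm_gt0.
Qed.

Lemma N2Z (c : C) v : N2 (c *: v) = rnorm c ^+ 2 * N2 v.
Proof. by rewrite /N2 mulr_sumr; apply: eq_bigr => j _; rewrite mxE rnormM exprMn. Qed.

Lemma N2_half u v : N2 u / 2 - N2 v <= N2 (u + v).
Proof.
rewrite /N2 mulr_suml -sumrB; apply: ler_sum => j _; rewrite mxE.
have := rnorm_triB (V := C) (u 0 j) (- v 0 j); rewrite opprK rnormN.
have := rnorm_ge0 (V := C) (u 0 j); have := rnorm_ge0 (V := C) (v 0 j).
have := rnorm_ge0 (V := C) (u 0 j + v 0 j).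
move: (rnorm (u 0 j + v 0 j)) (rnorm (u 0 j)) (rnorm (v 0 j)) => x y t x0 y0 t0 h.
have h2 : y ^+ 2 <= (x + t) ^+ 2 by rewrite lerXn2r ?nnegrE ?addr_ge0.
have := sqr_ge0 (x - t); rewrite !expr2 in h2 *; nra.
Qed.

Definition herm u v : C := \sum_j (u 0 j)^*%C * v 0 j.

Lemma N2D u v : N2 (u + v) = N2 u + N2 v + 2 * complex.Re (herm u v).
Proof.
rewrite /N2 /herm -big_split /= (big_morph (@complex.Re R) (@CReD R) (erefl : complex.Re (0 : C) = 0)).
rewrite mulr_sumr -big_split /=; apply: eq_bigr => j _; rewrite mxE !rnorm_sqr CReD CImD.
by case: (u 0 j) (v 0 j) => [a c] [d e] /=; ring.
Qed.

Lemma Re_sum (I : Type) (r : seq I) (F : I -> C) : complex.Re (\sum_(i <- r) F i) = \sum_(i <- r) complex.Re (F i).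
Proof. exact: (big_morph (@complex.Re R) (@CReD R) (erefl : complex.Re (0 : C) = 0)). Qed.

Definition dotC b v : C := \sum_j b 0 j * v 0 j.

Lemma dotCD b u v : dotC b (u + v) = dotC b u + dotC b v.
Proof. by rewrite /dotC -big_split /=; apply: eq_bigr => j _; rewrite mxE mulrDr. Qed.
Lemma dotCZ b (c : C) v : dotC b (c *: v) = c * dotC b v.
Proof. by rewrite /dotC mulr_sumr; apply: eq_bigr => j _; rewrite mxE mulrCA. Qed.

Definition Bq M u v : C := \sum_j \sum_k u 0 j * v 0 k * M j k.

Lemma BqDl M u u' v : Bq M (u + u') v = Bq M u v + Bq M u' v.
Proof.
rewrite /Bq -big_split /=; apply: eq_bigr => j _; rewrite -big_split /=.
by apply: eq_bigr => k _; rewrite mxE !mulrDl.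
Qed.
Lemma BqDr M u v v' : Bq M u (v + v') = Bq M u v + Bq M u v'.
Proof.
rewrite /Bq -big_split /=; apply: eq_bigr => j _; rewrite -big_split /=.
by apply: eq_bigr => k _; rewrite mxE mulrDr !mulrDl.
Qed.
Lemma BqZl M (c : C) u v : Bq M (c *: u) v = c * Bq M u v.
Proof.
rewrite /Bq mulr_sumr; apply: eq_bigr => j _; rewrite mulr_sumr.
by apply: eq_bigr => k _; rewrite mxE !mulrA.
Qed.
Lemma BqZr M (c : C) u v : Bq M u (c *: v) = c * Bq M u v.
Proof.
rewrite /Bq mulr_sumr; apply: eq_bigr => j _; rewrite mulr_sumr.
by apply: eq_bigr => k _; rewrite mxE !mulrA [u 0 j * c]mulrC.
Qed.

(** The general quadratic function without constant term whose Levi form is ka times the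
    identity: these are the local models of strictly plurisubharmonic functions. *)
Definition qf (ka : R) b M v : R := ka * N2 v + complex.Re (dotC b v + Bq M v v).

Lemma Re_ge (z : C) : - rnorm z <= complex.Re z.
Proof. by have := Re_le z; rewrite ler_norml => /andP[]. Qed.
Lemma Re_leN (z : C) : complex.Re z <= rnorm z.
Proof. by have := Re_le z; rewrite ler_norml => /andP[]. Qed.

(** A nonzero linear form in at least two variables has a nontrivial kernel. This is what
    makes analytic discs available. *)
Lemma kernel_and_dual_vector b : (1 < n)%N -> b != 0 ->
  exists u v0, [/\ dotC b u = 0, dotC b v0 = 1 & u != 0].
Proof.
move=> n1 b0.
have [j0 bj] : exists j, b 0 j != 0.
  apply: contrapT => H; move/eqP: b0; apply; apply/rowP => j; rewrite mxE.
  by apply/eqP; apply: contrapT => /negP h; apply: H; exists j.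
have [j1 j01] : exists j1 : 'I_n, j1 != j0.
  have n0 : (0 < n)%N by apply: ltn_trans n1.
  have [e|e] := eqVneq j0 (Ordinal n0); last by exists (Ordinal n0); rewrite eq_sym.
  by exists (Ordinal n1); rewrite e.
have dd j : dotC b (delta_mx 0 j) = b 0 j.
  rewrite /dotC (bigD1 j) //= mxE !eqxx mulr1 big1 ?addr0 // => i ij.
  by rewrite mxE eqxx /= (negbTE ij) mulr0.
exists (delta_mx 0 j1 - (b 0 j1 / b 0 j0) *: delta_mx 0 j0), ((b 0 j0)^-1 *: delta_mx 0 j0).
split.
- by rewrite -scaleN1r dotCD !dotCZ !dd mulfVK // mulN1r subrr.
- by rewrite dotCZ dd mulVf.
- apply/eqP => /rowP/(_ j1); rewrite !mxE !eqxx /= (negbTE j01) mulr0 subr0.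
  by move/eqP; rewrite oner_eq0.
Qed.

(** On the parabola with tangent u and second-order term - Bq M u u along v0, the terms of
    order at most 2 of dotC b + Bq M cancel; sg is a further shift along v0. *)
Lemma qf_disc (ka : R) b M u v0 (eta sg : C) :
  dotC b u = 0 -> dotC b v0 = 1 ->
  let tau := sg - eta ^+ 2 * Bq M u u in
  qf ka b M (eta *: u + tau *: v0) = ka * N2 (eta *: u + tau *: v0) +
   complex.Re (sg + eta * tau * (Bq M u v0 + Bq M v0 u) + tau ^+ 2 * Bq M v0 v0).
Proof.
move=> bu bv tau; rewrite /qf; congr (_ + complex.Re _).
rewrite dotCD !dotCZ bu bv !BqDl !BqDr !BqZl !BqZr /tau.
ring.
Qed.

(** The real inequality behind bent_disc: E, sg and ta bound the sizes of the disc
    parameter, of the shift, and of the component along v0, which is sg plus a term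
    quadratic in E. *)
Lemma disc_inequality (ka U Vv Qu be Q0 : R) : 0 < ka -> 0 < U -> 0 <= Vv -> 0 <= Qu -> 0 <= be -> 0 <= Q0 ->
  exists2 s0 : R, 0 < s0 & forall E sg ta : R, 0 <= E -> E <= s0 -> 0 <= sg -> sg <= s0 ->
    0 <= ta -> ta <= sg + E ^+ 2 * Qu ->
    ka * U / 4 * E ^+ 2 + sg / 2 <= ka * (E ^+ 2 * U / 2 - ta ^+ 2 * Vv) + sg - E * ta * be - ta ^+ 2 * Q0.
Proof.
move=> k0 U0 V0 Q10 b0 Q00.
pose W := ka * Vv + Q0; have W0 : 0 <= W by rewrite addr_ge0 // mulr_ge0 // ltW.
have kU : 0 < ka * U by rewrite mulr_gt0.
pose c1 := 4 * (Qu * be + 2 * Qu ^+ 2 * W) + 1.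
pose c2 := 2 * (be + 2 * W) + 1.
have c10 : 0 < c1 by rewrite ltr_wpDl // mulr_ge0 // addr_ge0 ?mulr_ge0 ?sqr_ge0.
have c20 : 0 < c2 by rewrite ltr_wpDl // mulr_ge0 // addr_ge0 ?mulr_ge0.
exists (Num.min 1 (Num.min (ka * U / c1) (1 / c2))).
  by rewrite !lt_min ltr01 !divr_gt0.
move=> E sg ta E0; rewrite !le_min !ler_pdivlMr // => /and3P[E1 E2 E3] s0 /and3P[s1 s2 s3] t0 ht.
have hE : E ^+ 2 * (E * Qu * be + 2 * E ^+ 2 * Qu ^+ 2 * W) <= E ^+ 2 * (ka * U / 4).
  apply: ler_wpM2l; first exact: sqr_ge0.
  have e1 : E ^+ 2 <= E by rewrite expr2 ler_piMr.
  have a1 : 0 <= Qu ^+ 2 * W by rewrite mulr_ge0 ?sqr_ge0.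
  rewrite /c1 in E2; nra.
have hs : sg * (E * be + 2 * sg * W) <= sg * (1 / 2).
  apply: ler_wpM2l => //; rewrite /c2 in E3 s3; nra.
have ht2 : ta ^+ 2 <= 2 * sg ^+ 2 + 2 * (E ^+ 2 * Qu) ^+ 2.
  have a1 : ta ^+ 2 <= (sg + E ^+ 2 * Qu) ^+ 2 by rewrite lerXn2r ?nnegrE ?addr_ge0 ?mulr_ge0 ?sqr_ge0.
  apply: le_trans a1 _; have := sqr_ge0 (sg - E ^+ 2 * Qu); rewrite !expr2; nra.
have h1 : ta ^+ 2 * W <= 2 * sg ^+ 2 * W + 2 * (E ^+ 2 * Qu) ^+ 2 * W by rewrite -mulrDl ler_wpM2r.
have h2 : E * be * ta <= E * be * sg + E * be * (E ^+ 2 * Qu) by rewrite -mulrDr ler_wpM2l // mulr_ge0.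
have e : ka * (E ^+ 2 * U / 2 - ta ^+ 2 * Vv) + sg - E * ta * be - ta ^+ 2 * Q0 =
  ka * U / 2 * E ^+ 2 + sg - E * be * ta - ta ^+ 2 * W by rewrite /W; field.
rewrite e.
have e1 : E ^+ 2 * (E * Qu * be + 2 * E ^+ 2 * Qu ^+ 2 * W) = E * be * (E ^+ 2 * Qu) + 2 * (E ^+ 2 * Qu) ^+
  2 * W by ring.
have e2 : sg * (E * be + 2 * sg * W) = E * be * sg + 2 * sg ^+ 2 * W by ring.
rewrite e1 in hE; rewrite e2 in hs.
move: h1 h2 hE hs; move: (ta ^+ 2 * W) (E * be * ta) => X Y.
move: (2 * sg ^+ 2 * W) (2 * (E ^+ 2 * Qu) ^+ 2 * W) (E * be * sg) (E * be * (E ^+ 2 * Qu)) => a1 a2 a3 a4.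
move: (E ^+ 2) => EE. clear. lra.
Qed.

(** Bend the complex line in the kernel of b so that dotC b + Bq M vanishes on it to third
    order; then the term ka N2 dominates. The resulting disc lies in {qf > 0} except for its
    centre, and after a shift by a small positive multiple of v0 it lies there entirely. *)
Lemma bent_disc (ka r : R) b M : (1 < n)%N -> 0 < ka -> b != 0 -> 0 < r ->
  exists (a c v0 : V) (s0 : R), [/\ 0 < s0,
    forall t : C, on_square t -> 0 < qf ka b M (t *: a + t ^+ 2 *: c),
    forall (sg : R) (t : C), 0 < sg -> sg < s0 -> in_square t ->
      0 < qf ka b M (rc sg *: v0 + (t *: a + t ^+ 2 *: c)) &
    forall t, in_square t -> rnorm (t *: a + t ^+ 2 *: c) < r].
Proof.
move=> n1 k0 b0 r0.
have [u [v0 [bu bv u0]]] := kernel_and_dual_vector n1 b0.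
have U0 : 0 < N2 u by rewrite N2_gt0.
have [s0 s00 H] := disc_inequality k0 U0 (N2_ge0 v0) (rnorm_ge0 (V := C) (Bq M u u))
  (rnorm_ge0 (V := C) (Bq M u v0 + Bq M v0 u)) (rnorm_ge0 (V := C) (Bq M v0 v0)).
pose Qu := Bq M u u.
pose s := Num.min (s0 / 2) (Num.min 1 (r / (2 * rnorm u + 4 * rnorm Qu * rnorm v0 + 1))).
have a0 : 0 < 2 * rnorm u + 4 * rnorm Qu * rnorm v0 + 1.
  by rewrite ltr_wpDl // addr_ge0 ?mulr_ge0 ?rnorm_ge0.
have sp : 0 < s by rewrite !lt_min ltr01 !divr_gt0.
have ss0 : s * 2 <= s0 by rewrite -ler_pdivlMr // ge_min lexx.
have s1 : s <= 1 by rewrite !ge_min lexx orbT.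
have sr : s * (2 * rnorm u + 4 * rnorm Qu * rnorm v0 + 1) <= r.
  by rewrite -ler_pdivlMr // !ge_min lexx !orbT.
have ns : rnorm (rc s) = s by rewrite rnorm_rc gtr0_norm.
pose a := rc s *: u; pose c := (- (rc s ^+ 2 * Qu)) *: v0.
have E t : t *: a + t ^+ 2 *: c = (rc s * t) *: u + (- ((rc s * t) ^+ 2 * Qu)) *: v0.
  by rewrite /a /c !scalerA; congr (_ *: _ + _ *: _); ring.
have key (sg : R) (t : C) : 0 <= sg -> sg <= s0 -> in_square t ->
    ka * N2 u / 4 * rnorm (rc s * t) ^+ 2 + sg / 2 <= qf ka b M (rc sg *: v0 + (t *: a + t ^+ 2 *: c)).
  move=> sg0 sg1 /in_square_le2 t2.
  set eta := rc s * t; pose tau := rc sg - eta ^+ 2 * Qu.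
  have -> : rc sg *: v0 + (t *: a + t ^+ 2 *: c) = eta *: u + tau *: v0.
    by rewrite E addrCA -scalerDl.
  rewrite (qf_disc ka M eta (rc sg) bu bv).
  have Eh : rnorm eta <= s0 by rewrite /eta rnormM ns; apply: le_trans ss0; rewrite ler_wpM2l // ltW.
  have ht : rnorm tau <= sg + rnorm eta ^+ 2 * rnorm Qu.
    apply: le_trans (rnormB (V := C) _ _) _.
    by rewrite rnorm_rc ger0_norm // rnormM rnormX.
  apply: le_trans (H (rnorm eta) sg (rnorm tau) (rnorm_ge0 (V := C) _) Eh sg0 sg1 (rnorm_ge0 (V := C) _) ht) _.
  rewrite -/Qu -/tau.
  have h1 := N2_half (eta *: u) (tau *: v0); rewrite !N2Z in h1.
  have h1' := ler_wpM2l (ltW k0) h1.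
  have h2 : - rnorm eta * rnorm tau * rnorm (Bq M u v0 + Bq M v0 u) <=
    complex.Re (eta * tau * (Bq M u v0 + Bq M v0 u)).
    by rewrite !mulNr -!rnormM; exact: Re_ge.
  have h3 : - (rnorm tau ^+ 2 * rnorm (Bq M v0 v0)) <= complex.Re (tau ^+ 2 * Bq M v0 v0).
    by rewrite -rnormX -rnormM; exact: Re_ge.
  rewrite !CReD /=; move: h1' h2 h3; rewrite !mulNr.
  move: (complex.Re _) (complex.Re _) => x1 x2.
  move: (rnorm eta * rnorm tau * _) (rnorm tau ^+ 2 * rnorm (Bq M v0 v0)) => x3 x4.
  move: (ka * _) (ka * _) => x5 x6; clear; lra.
exists a, c, v0, s0; split => //.
- move=> t ht; have := key 0 t (lexx _) (ltW s00) (on_square_in ht).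
  rewrite rmorph0 scale0r add0r mul0r addr0; apply: lt_le_trans.
  have t0 : 0 < rnorm t by apply: lt_le_trans (on_square_ge1 ht).
  rewrite rnormM ns; apply: mulr_gt0; first by rewrite divr_gt0 // mulr_gt0 //.
  by apply: exprn_gt0; exact: mulr_gt0.
- move=> sg t sg0 sg1 ht; apply: lt_le_trans (key sg t (ltW sg0) (ltW sg1) ht).
  by rewrite ltr_wpDl ?divr_gt0 // mulr_ge0 ?sqr_ge0 // divr_ge0 // mulr_ge0 // ltW.
- move=> t /in_square_le2 t2; rewrite E; apply: le_lt_trans (rnormD _ _) _.
  rewrite !rnormZ rnormN.
  rewrite [rnorm (_ * Qu)]rnormM rnormX [rnorm (rc s * t)]rnormM ns.
  apply: lt_le_trans sr.
  have p1 : s * rnorm t <= s * 2 by rewrite ler_wpM2l // ltW.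
  have p0 : 0 <= s * rnorm t by rewrite mulr_ge0 ?rnorm_ge0 // ltW.
  have p2 : (s * rnorm t) ^+ 2 <= s * 4.
    rewrite expr2; have : s * rnorm t * (s * rnorm t) <= s * 2 * (s * 2) by apply: ler_pM.
    move/le_trans; apply; have := ltW sp; nra.
  have p3 : s * rnorm t * rnorm u <= s * 2 * rnorm u by rewrite ler_wpM2r ?rnorm_ge0.
  have p4 : (s * rnorm t) ^+ 2 * (rnorm Qu * rnorm v0) <= s * 4 * (rnorm Qu * rnorm v0).
    by rewrite ler_wpM2r // mulr_ge0 ?rnorm_ge0.
  apply: (@le_lt_trans _ _ (s * 2 * rnorm u + s * 4 * (rnorm Qu * rnorm v0))).
    by rewrite -[X in _ + X]mulrA; exact: lerD.
  by move: sp; clear; move: s (rnorm Qu) (rnorm v0) (rnorm u) => x1 x2 x3 x4; lra.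
Qed.

Lemma near_compact_in (T : topologicalType) (K : set T) (gam : T -> V) (U : set V) z0 : compact K ->
  (forall t, {for t, continuous gam}) -> open U -> (forall t, K t -> U (z0 + gam t)) ->
  \forall w \near z0, forall t, K t -> U (w + gam t).
Proof.
move=> cK cg oU H; move: cK; rewrite compact_near_coveringP => /(_ V (nbhs z0)
  (fun w t => U (w + gam t)) _); apply.
move=> t Kt; have c2 : {for (t, z0), continuous (fun p : T * V => p.2 + gam p.1)}.
  apply: contVD; first exact: cvg_snd.
  apply: (@continuous_comp _ _ _ (fun p : T * V => p.1) gam); first exact: cvg_fst.
  exact: cg.
apply: c2; apply: open_nbhs_nbhs; split => //; exact: H.
Qed.

Lemma disc_cont (a c : V) t : {for t, continuous (fun t : C => t *: a + t ^+ 2 *: c)}.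
Proof.
apply: contVD; apply: contVZ; first exact: contC_id.
by apply: contCX; exact: contC_id.
Qed.

Lemma disc_diff (a c w : V) t : differentiable (fun t : C => w + (t *: a + t ^+ 2 *: c)) t.
Proof.
apply: differentiableD; first exact: differentiable_cst.
apply: differentiableD; apply: differentiableZl; first exact: differentiableC_id.
apply/derivable1_diffP; exact: exprn_derivable.
Qed.

(** The boundaries of the discs w + gam, with w near z0, stay in U, so that the Cauchy
    integral of h over them defines a holomorphic function near z0. For w = z0 + sg v0 the
    whole disc lies in U, and Cauchy's formula says that the integral is h w. *)
Lemma local_extension (ka r : R) b M z0 (U : set V) (h : V -> C) : (1 < n)%N -> 0 < ka -> b != 0 -> 0 < r ->
  open U -> hol U h -> (forall v, rnorm v < r -> 0 < qf ka b M v -> U (z0 + v)) ->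
  exists beta (H : V -> C), [/\ 0 < beta, hol [set w | rnorm (w - z0) < beta] H &
    forall be' : R, 0 < be' -> exists v, [/\ rnorm v < be', 0 < qf ka b M v & 
      \forall w \near z0 + v, H w = h w]].
Proof.
move=> n1 k0 b0 r0 oU hU HU.
have r2 : 0 < r / 2 by rewrite divr_gt0.
have [a [c [v0 [s0 [s00 h1 h2 h3]]]]] := bent_disc M n1 k0 b0 r2.
pose gam (t : C) := t *: a + t ^+ 2 *: c.
have cg t : {for t, continuous gam} by exact: disc_cont.
have Ug t : on_square t -> U (z0 + gam t).
  move=> ht; apply: HU; last exact: h1.
  by have := h3 _ (on_square_in ht); rewrite -/(gam t); lra.
have /near_rnormP[beta be0 Hb] := near_compact_in (@on_square_compact R) cg oU Ug.
pose H w := cauchy_int (fun t => t^-1 * h (w + gam t)).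
exists beta, H; split; first exact: be0.
  by move=> w wz; exact: (param_differentiable oU hU (fun t _ => cg t) (@inv_cont R) (Hb w wz)).
move=> be' b'0.
have nv := rnorm_ge0 v0.
have v1 : 0 < rnorm v0 + 1 by rewrite ltr_wpDl.
pose sg := Num.min (s0 / 2) (Num.min (be' / 2 / (rnorm v0 + 1)) (r / 4 / (rnorm v0 + 1))).
have sg0 : 0 < sg by rewrite !lt_min !divr_gt0.
have sgs : sg < s0 by apply: (@le_lt_trans _ _ (s0 / 2)); [rewrite ge_min lexx|lra].
have sgb : sg * (rnorm v0 + 1) <= be' / 2 by rewrite -ler_pdivlMr // !ge_min lexx orbT.
have sgr : sg * (rnorm v0 + 1) <= r / 4 by rewrite -ler_pdivlMr // !ge_min lexx !orbT.
have nsv : rnorm (rc sg *: v0) = sg * rnorm v0 by rewrite rnormZ rnorm_rc gtr0_norm.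
exists (rc sg *: v0); split.
- rewrite nsv; lra.
- have i0 : in_square (0 : C) by split; rewrite /= lerN10 ler01.
  have := h2 sg 0 sg0 sgs i0.
  by rewrite expr0n /= !scale0r !addr0.
- have UQ t : in_square t -> U (z0 + rc sg *: v0 + gam t).
    move=> ht; rewrite -addrA; apply: HU; last exact: h2.
    by apply: le_lt_trans (rnormD _ _) _; rewrite nsv; have := h3 _ ht; rewrite -/(gam t); lra.
  have := near_compact_in (@in_square_compact R) cg oU UQ; apply: filterS => w Hw.
  have hd t : in_square t -> differentiable (fun t : C => h (w + gam t)) t.
    move=> ht; apply: differentiable_comp; first exact: disc_diff.
    by apply: hU; exact: Hw.
  have := @cauchy_int_kernel R (fun t : C => h (w + gam t)) 0; rewrite rnorm0 => /(_ ltr01 hd).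
  rewrite /gam expr0n /= !scale0r !addr0 => <-.
  by rewrite /H; congr cauchy_int; apply/funext => t; rewrite subr0 mulrC.
Qed.

End RowVectors.

(** * Second-order Taylor expansion *)

Section Taylor.
Variables (R : realType).
Notation C := (Cx R).
Notation rc x := (real_complex R x : Cx R).

(** The difference of the two sides is the integral of the derivative of h (z + t v) /
    t^(k+1). *)
Lemma line_coefS (V : normedModType C) (U : set V) (h : V -> C) (z v : V) k : open U -> hol U h ->
  (forall t : C, rnorm t <= 2 -> U (z + t *: v)) ->
  line_coef (fun z => 'd h z v) z v k = k.+1%:R * line_coef h z v k.+1.
Proof.
move=> oU hU Uv.
have ld : disc_differentiable h z v by move=> t /Uv /hU.
have dU := diff_dir_hol v oU hU.
have ld' : disc_differentiable (fun z => 'd h z v) z v by move=> t /Uv /dU.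
pose P (t : C) := h (z + t *: v) * (t ^+ k.+1)^-1.
have c1 : square_cont (fun t : C => 'd h (z + t *: v) v * (t ^+ k.+1)^-1) by exact: (line_coef_cont ld').
have c2 : square_cont (fun t : C => h (z + t *: v) * (t ^+ k.+2)^-1) by exact: (line_coef_cont ld).
have c3 : square_cont (fun t : C => (- k.+1%:R) * (h (z + t *: v) * (t ^+ k.+2)^-1)).
  by move=> t ht; apply: contCM; [exact: contC_cst|exact: c2].
have c4 : square_cont (fun t : C => 'd h (z + t *: v) v * (t ^+ k.+1)^-1 +
    (- k.+1%:R) * (h (z + t *: v) * (t ^+ k.+2)^-1)).
  by move=> t ht; apply: contCD; [exact: c1|exact: c3].
have := cauchy_int_FTC (P := P) c4 _;
  rewrite (cauchy_intD c1 c3) (cauchy_intZ _ c2) -/(taylor_coef _ k) -/(taylor_coef _ k.+1).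
rewrite mulNr => E; apply/eqP; rewrite -subr_eq0; apply/eqP; apply: E => t ht.
have t0 := on_square_neq0 ht; have t2 := in_square_le2 (on_square_in ht).
have := is_deriveC_mul (line_is_deriveC (ld t t2)) (is_deriveC_invX k.+1 t0); congr is_derive.
by rewrite addrC; congr (_ + _); [exact: mulrC|exact: mulrCA].
Qed.

Variable n : nat.
Notation V := 'rV[C]_n.
Implicit Types (u v w z b : V) (M : 'M[C]_n) (U : set V) (h : V -> C).

Definition pd h j : V -> C := fun z => 'd h z (delta_mx 0 j).

Lemma pd_hol U h j : open U -> hol U h -> hol U (pd h j).
Proof. by move=> oU hU; exact: diff_dir_hol. Qed.

Lemma diff_pd h z v : 'd h z v = \sum_j v 0 j * pd h j z.
Proof.
rewrite {1}(row_sum_delta v) linear_sum; apply: eq_bigr => j _.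
by rewrite linearZ.
Qed.

Definition hess h z : 'M[C]_n := \matrix_(j, k) pd (pd h j) k z.

Definition grad h z : V := \row_j pd h j z.

Lemma diff_grad h z v : 'd h z v = dotC (grad h z) v.
Proof. by rewrite diff_pd; apply: eq_bigr => j _; rewrite mxE mulrC. Qed.

Lemma diff_sum (I : Type) (r : seq I) (c : I -> C) (f : I -> V -> C) z v :
  (forall i, differentiable (f i) z) ->
  differentiable (fun z => \sum_(i <- r) c i * f i z) z /\
  'd (fun z => \sum_(i <- r) c i * f i z) z v = \sum_(i <- r) c i * 'd (f i) z v.
Proof.
move=> fd; elim: r => [|i r [IH1 IH2]].
  have -> : (fun z : V => \sum_(i <- [::]) c i * f i z) = cst 0.
    by apply/funext => y; rewrite big_nil.
  by split; [exact: differentiable_cst|rewrite big_nil diff_cst].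
have -> : (fun z : V => \sum_(i <- i :: r) c i * f i z) =
  (c i *: f i) + (fun z => \sum_(i <- r) c i * f i z).
  by apply/funext => y; rewrite big_cons.
have d1 : differentiable (c i *: f i) z by exact: differentiableZ.
split; first exact: differentiableD.
rewrite big_cons -IH2.
have -> : c i * 'd (f i) z v = 'd (c i *: f i) z v.
  exact: (esym (congr1 (fun L : V -> C => L v) (diffZ (c i) (fd i)))).
exact: (congr1 (fun L : V -> C => L v) (diffD d1 IH1)).
Qed.

Lemma line_coef2 U h z v : open U -> hol U h -> (forall t : C, rnorm t <= 2 -> U (z + t *: v)) ->
  line_coef h z v 2 = 2^-1 * Bq (hess h z) v v.
Proof.
move=> oU hU Uv.
have Uz : U z by have := Uv 0; rewrite rnorm0 scale0r addr0; apply.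
have := line_coefS 1 oU hU Uv; rewrite line_coef1; last by move=> t /Uv; exact: diff_dir_hol.
move=> E; have -> : line_coef h z v 2 = 2^-1 * 'd (fun z => 'd h z v) z v.
  by rewrite E mulKf // pnatr_eq0.
congr (_ * _).
have -> : (fun z => 'd h z v) = (fun z => \sum_j v 0 j * pd h j z).
  by apply/funext => y; exact: diff_pd.
have [_ ->] := @diff_sum _ (index_enum 'I_n) (fun j => v 0 j) (pd h) z v (fun j => pd_hol j oU hU Uz).
rewrite /Bq; apply: eq_bigr => j _; rewrite diff_pd mulr_sumr; apply: eq_bigr => k _.
by rewrite mxE mulrA.
Qed.

(** Cauchy's estimate of the third-order remainder on the complex line through v. *)
Lemma quad_taylor U h z : open U -> hol U h -> U z ->
  exists2 r : R, 0 < r & exists2 K : R, 0 < K & forall v, rnorm v <= r ->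
    rnorm (h (z + v) - h z - dotC (grad h z) v - 2^-1 * Bq (hess h z) v v) <= K * rnorm v ^+ 3.
Proof.
move=> oU hU Uz; have [rho r0 [B B0 [bb bU]]] := locally_bounded_on_ball oU hU Uz.
exists (rho / 8); first by rewrite divr_gt0.
have cs := cauchy_cst_ge0 R.
exists (2 * cauchy_cst R * B * (4 / rho) ^+ 3 + 1).
  have a1 : 0 <= (4 / rho) ^+ 3 by apply: exprn_ge0; apply: divr_ge0; [exact: ler0n|exact: ltW].
  have a2 : 0 <= 2 * cauchy_cst R * B by apply: mulr_ge0; [apply: mulr_ge0|exact: ltW].
  by rewrite ltr_wpDl // mulr_ge0.
move=> v vr.
have [->|v0] := eqVneq v 0.
  have -> : Bq (hess h z) (0 : V) 0 = 0.
    by rewrite -(scale0r (0 : V)) BqZl mul0r.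
  rewrite addr0 subrr mulr0 subr0 -diff_grad linear0 subr0 !rnorm0 expr0n mulr0 //.
have nv : 0 < rnorm v by rewrite rnorm_gt0.
have nv0 := lt0r_neq0 nv; have r00 := lt0r_neq0 r0.
pose s := 4 * rnorm v / rho; have s0 : 0 < s by rewrite divr_gt0 // mulr_gt0.
have s00 : rc s != 0 by rewrite -(rnorm_gt0 (V := C)) rnorm_rc gtr0_norm.
pose v' := (rc s)^-1 *: v.
have nv' : rnorm v' = rho / 4.
  by rewrite rnormZ rnormV rnorm_rc gtr0_norm // /s; field; rewrite nv0 r00.
have v'2 : 2 * rnorm v' < rho by rewrite nv'; lra.
have [ld lB] := bounded_on_ball_line bb v'2.
have Uv (t : C) : rnorm t <= 2 -> U (z + t *: v').
  move=> t2; apply: bU; rewrite addrAC subrr add0r rnormZ; apply: le_lt_trans v'2.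
  by rewrite ler_wpM2r // rnorm_ge0.
have E : rc s *: v' = v by rewrite scalerA mulfV // scale1r.
have ws : rnorm (rc s) = s by rewrite rnorm_rc gtr0_norm.
have s2 : s <= 2^-1 by rewrite /s ler_pdivrMr //; lra.
have := line_taylor 3 ld lB (w := rc s); rewrite ws => /(_ s2).
rewrite !big_ord_recl big_ord0 /= line_coef0 // expr0 mulr1 addr0 /bump /= addn0 line_coef1 // expr1.
rewrite add1n (line_coef2 oU hU Uv) E.
have -> : 'd h z v' * rc s = dotC (grad h z) v.
  rewrite -diff_grad; have -> : 'd h z v = rc s * 'd h z v' by rewrite -{1}E; exact: linearZ.
  exact: mulrC.
have -> : 2^-1 * Bq (hess h z) v' v' * rc s ^+ 2 = 2^-1 * Bq (hess h z) v v.
  clearbody v'; rewrite -[in RHS]E BqZl BqZr; move: (rc s : C) (Bq _ _ _) (2^-1 : C) => a b c; ring.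
set X := _ - (_ + _).
have -> : X = h (z + v) - h z - dotC (grad h z) v - 2^-1 * Bq (hess h z) v v.
  by rewrite /X; ring.
move/le_trans; apply.
have -> : s ^+ 3 = (4 / rho) ^+ 3 * rnorm v ^+ 3 by rewrite /s -exprMn; congr (_ ^+ _); field.
by rewrite mulrA; apply: ler_wpM2r; [exact: exprn_ge0 (ltW nv)|rewrite lerDl].
Qed.

End Taylor.

(** * Real vectors, compactness and maxima *)

Section RealPart.
Variables (R : realType) (n : nat).
Notation C := (Cx R).
Notation rc x := (real_complex R x : Cx R).
Notation V := 'rV[C]_n.
Notation E := 'rV[R]_n.
Implicit Types (u v w z b : V) (M : 'M[C]_n) (e : E).

Lemma rcD (x y : R) : rc (x + y) = rc x + rc y. Proof. exact: rmorphD. Qed.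
Lemma rcM (x y : R) : rc (x * y) = rc x * rc y. Proof. exact: rmorphM. Qed.
Lemma rcN (x : R) : rc (- x) = - rc x. Proof. exact: rmorphN. Qed.
Lemma ReMrc (s : R) (c : C) : complex.Re (rc s * c) = s * complex.Re c.
Proof. by case: c => a d /=; rewrite mul0r subr0. Qed.

Definition rv e : V := \row_j rc (e 0 j).

Lemma rvD e e' : rv (e + e') = rv e + rv e'.
Proof. by apply/rowP => j; rewrite !mxE rcD. Qed.
Lemma rvZ (s : R) e : rv (s *: e) = rc s *: rv e.
Proof. by apply/rowP => j; rewrite !mxE rcM. Qed.
Lemma rvN e : rv (- e) = - rv e.
Proof. by apply/rowP => j; rewrite !mxE rcN. Qed.
Lemma rv_eq0 e : (rv e == 0) = (e == 0).
Proof.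
apply/eqP/eqP => [h|->]; apply/rowP => j; last by rewrite !mxE.
by move/rowP/(_ j): h; rewrite !mxE => -[].
Qed.

Lemma reV_rv e : reV (rv e) = e.
Proof. by apply/rowP => j; rewrite !mxE. Qed.
Lemma imV_rv e : imV (rv e) = 0.
Proof. by apply/rowP => j; rewrite !mxE. Qed.
Lemma cvecK z : cvec (reV z) (imV z) = z.
Proof. by apply/rowP => j; rewrite !mxE; case: (z 0 j). Qed.
Lemma reV_cvec e e' : reV (cvec e e') = e.
Proof. by apply/rowP => j; rewrite !mxE. Qed.
Lemma imV_cvec e e' : imV (cvec e e') = e'.
Proof. by apply/rowP => j; rewrite !mxE. Qed.

Definition e2 e : R := \sum_j e 0 j ^+ 2.

Lemma e2_ge0 e : 0 <= e2 e.
Proof. by apply: sumr_ge0 => j _; rewrite sqr_ge0. Qed.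
Lemma enorm2 e : enorm e ^+ 2 = e2 e.
Proof. by rewrite sqr_sqrtr // e2_ge0. Qed.
Lemma N2E z : N2 z = e2 (reV z) + e2 (imV z).
Proof. by rewrite /N2 -big_split /=; apply: eq_bigr => j _; rewrite rnorm_sqr !mxE. Qed.

Lemma coord_cont j v : {for v, continuous (fun v : V => v 0 j)}.
Proof.
apply/continuous_rnormP => e e0; apply/near_rnormP; exists e => // w wv.
by apply: le_lt_trans wv; have := rnorm_coord (w - v) j; rewrite !mxE.
Qed.

Lemma contC_sum (T : topologicalType) (I : Type) (r : seq I) (f : I -> T -> C) (x : T) :
  (forall i, {for x, continuous (f i)}) -> {for x, continuous (fun y => \sum_(i <- r) f i y)}.
Proof.
move=> cf; elim: r => [|i r IH].
  have -> : (fun y => \sum_(i <- [::]) f i y) = (fun=> 0 : C) by apply/funext => y; rewrite big_nil.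
  exact: contC_cst.
have -> : (fun y => \sum_(i <- i :: r) f i y) = (fun y => f i y + \sum_(i <- r) f i y).
  by apply/funext => y; rewrite big_cons.
by apply: contCD; [exact: cf|exact: IH].
Qed.

Lemma conj_cont (c : C) : {for c, continuous (fun c : C => c^*%C : C)}.
Proof.
apply/continuous_rnormP => e e0; apply/near_rnormP; exists e => // w wv; apply: le_lt_trans wv.
by rewrite !rnormE; move: w c => [a d] [a' d'] /=; rewrite -opprD sqrrN.
Qed.

Lemma herm_cont v : {for v, continuous (fun v : V => herm v v)}.
Proof.
apply: contC_sum => j; apply: contCM; last exact: coord_cont.
exact: (continuous_comp (@coord_cont j v) (@conj_cont _)).
Qed.

Lemma N2_herm v : N2 v = complex.Re (herm v v).
Proof.
rewrite /N2 /herm Re_sum; apply: eq_bigr => j _; rewrite rnorm_sqr.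
by case: (v 0 j) => a d /=; ring.
Qed.

Lemma dotC_cont b v : {for v, continuous (dotC b)}.
Proof. by apply: contC_sum => j; apply: contCM; [exact: contC_cst|exact: coord_cont]. Qed.

Lemma Bq_cont M v : {for v, continuous (fun v => Bq M v v)}.
Proof.
apply: contC_sum => j; apply: contC_sum => k; apply: contCM; last exact: contC_cst.
by apply: contCM; exact: coord_cont.
Qed.

Lemma qf_Re ka b M v : qf ka b M v = complex.Re (rc ka * herm v v + (dotC b v + Bq M v v)).
Proof. by rewrite /qf N2_herm [in RHS]CReD ReMrc. Qed.

Lemma Re_comp_cont (T : topologicalType) (f : T -> C) (x : T) : {for x, continuous f} ->
  {for x, continuous (fun y => complex.Re (f y))}.
Proof. by move=> cf; exact: (continuous_comp cf (@Re_cont R _)). Qed.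

Lemma qf_cont ka b M v : {for v, continuous (qf ka b M)}.
Proof.
have -> : qf ka b M = fun v => complex.Re (rc ka * herm v v + (dotC b v + Bq M v v)).
  by apply/funext => u; exact: qf_Re.
apply: Re_comp_cont; apply: contCD; first by apply: contCM; [exact: contC_cst|exact: herm_cont].
by apply: contCD; [exact: dotC_cont|exact: Bq_cont].
Qed.

Lemma rgt_near (T : topologicalType) (f : T -> R) (x : T) (a : R) : {for x, continuous f} ->
  a < f x -> \forall y \near x, a < f y.
Proof.
move=> /continuous_normP cf h; have h0 : 0 < f x - a by rewrite subr_gt0.
have := cf _ h0; apply: filterS => y; rewrite ltr_norml => /andP[h1 _]; lra.
Qed.

Lemma rlt_near (T : topologicalType) (f : T -> R) (x : T) (a : R) : {for x, continuous f} ->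
  f x < a -> \forall y \near x, f y < a.
Proof.
move=> /continuous_normP cf h; have h0 : 0 < a - f x by rewrite subr_gt0.
have := cf _ h0; apply: filterS => y; rewrite ltr_norml => /andP[_ h1]; lra.
Qed.

Lemma open_superlevel (T : topologicalType) (f : T -> R) (a : R) : (forall x, {for x, continuous f}) ->
  open [set x | a < f x].
Proof. by move=> cf; rewrite openE => x /= h; apply: rgt_near. Qed.

Lemma closed_sublevel (T : topologicalType) (f : T -> R) (a : R) : (forall x, {for x, continuous f}) ->
  closed [set x | f x <= a].
Proof.
move=> cf; have -> : [set x | f x <= a] = ~` [set x | a < f x].
  by apply/seteqP; split => x /=; rewrite leNgt => /negP.
by apply: open_closedC; exact: open_superlevel.
Qed.

Lemma open_ball0 z (r : R) : open [set w : V | rnorm (w - z) < r].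
Proof.
rewrite openE => w h; apply/(@near_rnormP _ V w); exists (r - rnorm (w - z)); first by rewrite subr_gt0.
move=> u h2; rewrite /=; have -> : u - z = (u - w) + (w - z) by rewrite addrA subrK.
by apply: le_lt_trans (rnormD _ _) _; lra.
Qed.

Lemma rnorm_cont v : {for v, continuous (fun v : V => rnorm v)}.
Proof.
apply/continuous_normP => e e0; apply/near_rnormP; exists e => // w wv; apply: le_lt_trans wv.
rewrite ler_norml; apply/andP; split.
  by have := rnorm_triB v w; rewrite rnorm_distC; lra.
by have := rnorm_triB w v; lra.
Qed.

Lemma disc_compact (B : R) : compact [set c : C | rnorm c <= B].
Proof.
apply: (@subclosed_compact _ _ ((fun p : R * R => cx p.1 p.2) @` (`[- B, B] `*` `[- B, B]))).
- apply: (@closed_sublevel _ (fun c : C => rnorm c)) => c.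
  apply/continuous_normP => e e0; apply/(@near_rnormP _ C); exists e => // w wv; apply: le_lt_trans wv.
  rewrite ler_norml; apply/andP; split.
    by have := rnorm_triB (V := C) c w; rewrite rnorm_distC; lra.
  by have := rnorm_triB (V := C) w c; lra.
- apply: continuous_compact; last by apply: compact_setX; exact: segment_compact.
  apply: continuous_subspaceT => p; apply: cont_Complex; [exact: cvg_fst|exact: cvg_snd].
- move=> c /= h; exists (complex.Re c, complex.Im c); last by case: (c).
  by split; rewrite /= in_itv /= -ler_norml; apply: le_trans h; [exact: Re_le|exact: Im_le].
Qed.

Lemma ball_compact (B : R) : compact [set v : V | rnorm v <= B].
Proof.
have cB : compact [set v : V | forall j, [set c : C | rnorm c <= B] (v ord0 j)].
  by apply: (@rV_compact C n (fun _ => [set c : C | rnorm c <= B])) => _; exact: disc_compact.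
apply: (subclosed_compact _ cB); first by apply: closed_sublevel => v; exact: rnorm_cont.
by move=> v h j; apply: le_trans h; exact: rnorm_coord.
Qed.

Lemma closed_bounded_compact (A : set V) (B : R) : closed A -> (forall v, A v -> rnorm v <= B) -> compact A.
Proof. by move=> cA AB; exact: (subclosed_compact cA (@ball_compact B)). Qed.

Lemma max_on (T : topologicalType) (A : set T) (f : T -> R) : A !=set0 -> compact A ->
  (forall x, {for x, continuous f}) -> exists2 c, A c & forall t, A t -> f t <= f c.
Proof.
move=> A0 cA cf; have [|c /set_mem Ac H] := @compact_EVT_max _ _ f A A0 cA.
  by apply: continuous_subspaceT => x; exact: cf.
by exists c => // t At; apply: H; exact: mem_set.
Qed.

(** The linear part of qf ka b M when it is expanded at v: see qf_add. *)
Definition qgrad (ka : R) b M v : V :=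
  \row_j (b 0 j + rc (2 * ka) * (v 0 j)^*%C + \sum_k v 0 k * (M j k + M k j)).

Lemma qf_add ka b M v w : qf ka b M (v + w) = qf ka b M v + qf ka (qgrad ka b M v) M w.
Proof.
rewrite /qf N2D dotCD BqDl !BqDr.
have -> : dotC (qgrad ka b M v) w = dotC b w + rc (2 * ka) * herm v w + (Bq M v w + Bq M w v).
  rewrite /dotC /herm mulr_sumr -big_split /=.
  have -> : Bq M v w + Bq M w v = \sum_j (\sum_k v 0 k * (M j k + M k j)) * w 0 j.
    rewrite /Bq exchange_big -big_split /=; apply: eq_bigr => j _.
    rewrite mulr_suml -big_split /=; apply: eq_bigr => k _.
    by move: (v 0 k) (w 0 j) (M k j) (M j k) => c1 c2 c3 c4; ring.
  rewrite -big_split /=; apply: eq_bigr => j _; rewrite mxE.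
  by move: (b 0 j) (rc _) ((v 0 j)^*%C) (\sum_k _) (w 0 j) => c1 c2 c3 c4 c5; ring.
rewrite !CReD ReMrc; move: (complex.Re (herm v w)) => h.
by move: (complex.Re _) (complex.Re _) (complex.Re _) (complex.Re _) (complex.Re _) (complex.Re _) => *; ring.
Qed.

Lemma qf_lin ka b M w : qf ka b M w = complex.Re (dotC b w) + qf ka 0 M w.
Proof.
rewrite /qf !CReD; have -> : dotC 0 w = 0 by rewrite /dotC big1 // => j _; rewrite mxE mul0r.
by rewrite /= add0r addrCA.
Qed.

Lemma qf2Z ka M (s : R) w : qf ka 0 M (rc s *: w) = s ^+ 2 * qf ka 0 M w.
Proof.
rewrite /qf N2Z rnorm_rc real_normK ?num_real // BqZl BqZr.
have -> : dotC 0 (rc s *: w) = 0 by rewrite /dotC big1 // => j _; rewrite mxE mul0r.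
have -> : dotC 0 w = 0 by rewrite /dotC big1 // => j _; rewrite mxE mul0r.
by rewrite !add0r !ReMrc expr2; ring.
Qed.

Lemma qf_line ka b M v (s : R) w : qf ka b M (v + rc s *: w) =
  qf ka b M v + s * complex.Re (dotC (qgrad ka b M v) w) + s ^+ 2 * qf ka 0 M w.
Proof. by rewrite qf_add [qf ka (qgrad ka b M v) M _]qf_lin qf2Z dotCZ ReMrc addrA. Qed.

Lemma qf0 ka b M : qf ka b M 0 = 0.
Proof. by rewrite -(scaler0 _ (rc 0)) qf_lin qf2Z dotCZ ReMrc expr0n !mul0r addr0. Qed.

End RealPart.

(** Norms are generalised to variables before the linear arithmetic, which then does not
    look inside them. *)
Ltac lra_rnorm := repeat (match goal with |- context [@rnorm ?R ?V ?x] => let a :=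
  fresh in generalize (@rnorm R V x); intro a end); clear; lra.

(** * Extension across one boundary point *)

Section Aux.
Variables (R : realType).
Notation C := (Cx R).
Notation rc x := (real_complex R x : Cx R).

Lemma contRD (T : topologicalType) (f g : T -> R) (x : T) : {for x, continuous f} ->
  {for x, continuous g} -> {for x, continuous (fun y => f y + g y)}.
Proof. by move=> cf cg; exact: (cvgD cf cg). Qed.
Lemma contRN (T : topologicalType) (f : T -> R) (x : T) : {for x, continuous f} ->
  {for x, continuous (fun y => - f y)}.
Proof. by move=> cf; exact: (cvgN cf). Qed.
Lemma contRM (T : topologicalType) (f g : T -> R) (x : T) : {for x, continuous f} ->
  {for x, continuous g} -> {for x, continuous (fun y => f y * g y)}.
Proof. by move=> cf cg; exact: (cvgM cf cg). Qed.
Lemma contR_cst (T : topologicalType) (a : R) (x : T) : {for x, continuous (fun _ : T => a)}.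
Proof. exact: cst_continuous. Qed.

Variable W : lmodType C.
Implicit Types (z v w l : W).

Lemma ray_split z w (s t : R) : z + rc t *: w + rc (s - t) *: w = z + rc s *: w.
Proof. by rewrite -addrA -scalerDl -rcD; congr (_ + rc _ *: _); ring. Qed.
Lemma ray_back z w (t : R) : z + rc t *: w + rc t *: (- w) = z.
Proof. by rewrite scalerN addrK. Qed.
Lemma chord_shift z v v' l (t : R) : z + v + l + rc t *: (v' - v) = z + (rc (1 - t) *: v + rc t *: v' + l).
Proof.
rewrite rcD rcN scalerBl scale1r scalerBr -!addrA; congr (_ + (_ + _)).
by rewrite addrC -addrA addrCA.
Qed.
Lemma shift_end z v v' l : z + v + l + (v' - v) = z + v' + l.
Proof. by rewrite -!addrA; congr (_ + _); rewrite addrA addrC addrA subrK. Qed.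
Lemma ray_return z v l (t a : R) : z + v + rc a *: l + rc t *: (rc (- a) *: l) = z + (v + rc ((1 - t) * a) *: l).
Proof.
rewrite -!addrA scalerA -scalerDl; congr (_ + (_ + _ *: _)).
by rewrite -rcM -rcD; congr (rc _); ring.
Qed.
Lemma ray_opp z w (t : R) : z + rc t *: (- w) = z + rc (- t) *: w.
Proof. by rewrite scalerN rcN scaleNr. Qed.
Lemma shift_sub2 z v w : z + v + w - z = v + w.
Proof. by rewrite -(addrA z) [LHS]addrC addKr. Qed.
Lemma shift_sub z v : z + v - z = v.
Proof. by rewrite addrC addKr. Qed.
Lemma ray_scale z v l (t a : R) : z + v + rc t *: (rc a *: l) = z + (v + rc (t * a) *: l).
Proof. by rewrite scalerA -rcM addrA. Qed.

Lemma rnorm_subl (V : normedModType C) (u v : V) : rnorm v <= rnorm (u + v) + rnorm u.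
Proof. by have := rnorm_triB v (- u); rewrite opprK rnormN (addrC v). Qed.
Lemma rnorm_subr (V : normedModType C) (u v : V) : rnorm u <= rnorm (u + v) + rnorm v.
Proof. by have := rnorm_triB u (- v); rewrite opprK rnormN. Qed.
Lemma rnorm_ray (V : normedModType C) (t : R) (v : V) : 0 <= t -> rnorm (rc t *: v) = t * rnorm v.
Proof. by move=> t0; rewrite rnormZ rnorm_rc ger0_norm. Qed.

End Aux.

Section LocalStep.
Variables (R : realType) (n : nat).
Notation C := (Cx R).
Notation rc x := (real_complex R x : Cx R).
Notation V := 'rV[C]_n.
Notation E := 'rV[R]_n.
Implicit Types (u v w z b : V) (M : 'M[C]_n) (e : E).

Lemma germ_along_segment (W : set V) (h f : V -> C) z v : open W -> hol W h -> hol W f ->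
  (forall t : R, 0 <= t <= 1 -> W (z + rc t *: v)) ->
  (\forall w \near z + v, h w = f w) -> \forall w \near z, h w = f w.
Proof.
move=> oW hW fW HW germ.
apply: (identity_connected (A := [set u | exists2 t : R, 0 <= t <= 1 & u = z + rc t *: v]) oW hW fW
  (@segment_connected_complex R V z v) _ _ germ).
- by move=> _ [t ht ->]; exact: HW.
- by exists 1; rewrite ?scale1r // lexx ler01.
- by exists 0; rewrite ?scale0r ?addr0 // lexx ler01.
Qed.

(** Convexity of the slices with fixed imaginary part. Taking the intermediate point as base
    point avoids a parametrisation of the segment. *)
Definition slice_convex (A : set V) := forall z e (s1 s2 : R), 0 <= s1 -> 0 <= s2 ->
  A (z + rc s1 *: rv e) -> A (z + rc s2 *: rv (- e)) -> A z.

Lemma slice_convex_between (A : set V) z e (s t : R) : slice_convex A -> 0 <= t -> t <= s -> A z ->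
  A (z + rc s *: rv e) -> A (z + rc t *: rv e).
Proof.
move=> cA t0 ts Az As.
have st : 0 <= s - t by rewrite subr_ge0.
apply: (cA _ e (s - t) t st t0); first by rewrite ray_split.
by rewrite rvN ray_back.
Qed.

Lemma two_indices (n1 : (1 < n)%N) : exists j0 j1 : 'I_n, j1 != j0.
Proof.
have n0 : (0 < n)%N by apply: ltn_trans n1.
by exists (Ordinal n0), (Ordinal n1).
Qed.

Lemma dotC_delta b j : dotC b (rv (delta_mx 0 j)) = b 0 j.
Proof.
rewrite /dotC (bigD1 j) //= !mxE !eqxx mulr1 big1 ?addr0 // => i ij.
by rewrite !mxE eqxx /= (negbTE ij) mulr0.
Qed.

(** One real linear equation in at least two real unknowns. *)
Lemma real_kernel_vector b : (1 < n)%N -> exists2 d : E, d != 0 & complex.Re (dotC b (rv d)) = 0.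
Proof.
move=> n1; have [j0 [j1 j01]] := two_indices n1.
have dn (j : 'I_n) : delta_mx 0 j != 0 :> E.
  by apply/eqP => /rowP/(_ j)/eqP; rewrite !mxE !eqxx oner_eq0.
have [h|h] := eqVneq (complex.Re (b 0 j0)) 0.
  by exists (delta_mx 0 j0); rewrite ?dotC_delta.
exists (complex.Re (b 0 j1) *: delta_mx 0 j0 - complex.Re (b 0 j0) *: delta_mx 0 j1).
  apply: contra_neq h => /rowP/(_ j1); rewrite !mxE !eqxx /= (negbTE j01) mulr0 mulr1 sub0r.
  by move/eqP; rewrite oppr_eq0 => /eqP.
rewrite -scaleNr rvD !rvZ dotCD !dotCZ !dotC_delta CReD !ReMrc.
by rewrite mulNr mulrC subrr.
Qed.

(** On a real line qf is a quadratic polynomial a + s L + s^2 c in the parameter s; this is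
    its convexity. *)
Lemma convex_quad_le (a L c s1 s2 ep : R) : 0 <= c -> 0 <= s1 -> 0 <= s2 ->
  a + s1 * L + s1 ^+ 2 * c <= - ep -> a - s2 * L + s2 ^+ 2 * c <= - ep -> a <= - ep.
Proof.
move=> c0 s10 s20 h1 h2; rewrite leNgt; apply/negP => h.
have [s1e|s1e] := eqVneq s1 0.
  by move: h1; rewrite s1e mul0r expr0n mul0r !addr0 leNgt h.
have s1p : 0 < s1 by rewrite lt_def s1e.
have : 0 <= s1 ^+ 2 * c by rewrite mulr_ge0 ?sqr_ge0.
have : 0 <= s2 ^+ 2 * c by rewrite mulr_ge0 ?sqr_ge0.
move: h1 h2 h; move: (s1 ^+ 2 * c) (s2 ^+ 2 * c) => X Y h1 h2 h Y0 X0.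
have L0 : s1 * L < 0 by lra.
have : 0 <= s2 * - L by rewrite mulr_ge0 // oppr_ge0 ltW //; rewrite pmulr_rlt0 in L0.
lra.
Qed.

Lemma outside_neg (U : set V) z0 ka b M (r de : R) : 0 < de ->
  (forall v, rnorm v < r -> ~ U (z0 + v) -> qf ka b M v <= - (de * rnorm v ^+ 2)) ->
  forall v, rnorm v < r -> 0 < qf ka b M v -> U (z0 + v).
Proof.
move=> de0 qA v vr qv; apply: contrapT => /(qA v vr); rewrite leNgt => /negP; apply; apply: le_lt_trans qv.
by rewrite oppr_le0 mulr_ge0 ?sqr_ge0 // ltW.
Qed.

(** Along a suitable real direction the linear part of qf has slope 1; by continuity of the
    gradient the slope is at least 1/2 near 0, and the convexity of qf in real directions
    keeps it so along the ray. *)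
Lemma steep_direction ka b M : (exists j, complex.Re (b 0 j) != 0) -> (forall e, 0 <= qf ka 0 M (rv e)) ->
  exists e0, exists2 r1 : R, 0 < r1 & forall v (t : R), rnorm v < r1 -> 0 <= t ->
  qf ka b M v + t / 2 <= qf ka b M (v + rc t *: rv e0).
Proof.
move=> [j bj0] q2; exists ((complex.Re (b 0 j))^-1 *: delta_mx 0 j); set e0 := _ *: _.
have be0 : complex.Re (dotC b (rv e0)) = 1 by rewrite rvZ dotCZ ReMrc dotC_delta mulVf.
pose G v := qf ka b M (v + rv e0) + (- qf ka b M v - qf ka 0 M (rv e0)).
have GE v : G v = complex.Re (dotC (qgrad ka b M v) (rv e0)).
  by rewrite /G qf_add [qf ka (qgrad ka b M v) M _]qf_lin; ring.
have cG : {for 0, continuous G}.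
  have c1 : {for 0, continuous (fun v : V => v + rv e0)} by apply: contVD; [exact: contV_id|exact: contV_cst].
  have c2 := continuous_comp c1 (@qf_cont _ _ ka b M _).
  by apply: (contRD c2); apply: contRD; [apply: contRN; exact: qf_cont|exact: contR_cst].
have G0 : 1 / 2 < G 0.
  rewrite /G add0r qf0 qf_lin be0; lra.
have /near_rnormP[r1 r10 H] := rgt_near cG G0; exists r1 => // v t vr t0.
rewrite qf_line; have := H v; rewrite subr0 => /(_ vr); rewrite GE => h.
have h1 : t * (1 / 2) <= t * complex.Re (dotC (qgrad ka b M v) (rv e0)) by rewrite ler_wpM2l // ltW.
have h2 : 0 <= t ^+ 2 * qf ka 0 M (rv e0) by rewrite mulr_ge0 ?sqr_ge0.
lra.
Qed.

(** The piece to be added to the domain of extension. *)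
Definition cap ka b M (rr ep : R) : set V := [set v | rnorm v < rr /\ - ep < qf ka b M v].

Lemma cap_open ka b M (rr ep : R) z0 : open [set z : V | cap ka b M rr ep (z - z0)].
Proof.
rewrite openE => z [h1 h2].
have c3 : {for z, continuous (fun z : V => z - z0)} by apply: contVD; [exact: contV_id|exact: contV_cst].
have c4 : {for z, continuous (fun z : V => qf ka b M (z - z0))}.
  exact: (continuous_comp c3 (@qf_cont _ _ ka b M _)).
have c5 : {for z, continuous (fun z : V => rnorm (z - z0))}.
  exact: (continuous_comp c3 (@rnorm_cont R n _)).
have := filterI (rlt_near c5 h1) (rgt_near c4 h2).
exact.
Qed.

(** Inside the ball of radius r the complement of U is in {qf <= - de |v|^2}, which is at
    most - ep from distance rr on. So a real segment in the complement that leaves the cap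
    meets {qf <= - ep}: at its end if this is still in the ball, and otherwise at an
    intermediate point at distance about 2 rr. *)
Lemma exit_point (D U : set V) z0 ka b M (r de rr ep : R) v e (s : R) : 0 < de -> slice_convex (D `\` U) ->
  (forall v, rnorm v < r -> ~ U (z0 + v) -> qf ka b M v <= - (de * rnorm v ^+ 2)) ->
  0 < rr -> 3 * rr < r -> ep <= de * rr ^+ 2 -> cap ka b M rr ep v -> 0 <= s ->
  (D `\` U) (z0 + v) -> (D `\` U) (z0 + v + rc s *: rv e) -> ~ cap ka b M rr ep (v + rc s *: rv e) ->
  exists2 s', 0 <= s' & qf ka b M (v + rc s' *: rv e) <= - ep.
Proof.
move=> de0 cA qA rr0 rr3 epd [c1 c2] s0 Az As nc.
have far (t : R) : rr <= rnorm (v + rc t *: rv e) -> rnorm (v + rc t *: rv e) < r ->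
    (D `\` U) (z0 + v + rc t *: rv e) -> qf ka b M (v + rc t *: rv e) <= - ep.
  move=> h1 h2 [_]; rewrite -addrA => /(qA _ h2) h3; apply: le_trans h3 _.
  rewrite lerN2; apply: le_trans epd _; rewrite ler_wpM2l ?(ltW de0) //.
  by rewrite lerXn2r ?nnegrE ?rnorm_ge0 // ltW.
have [h1|h1] := ltP (rnorm (v + rc s *: rv e)) rr.
  exists s => //; rewrite leNgt; apply/negP => h; apply: nc; by split.
have [h2|h2] := ltP (rnorm (v + rc s *: rv e)) r.
  by exists s => //; apply: far.
have h3 : r <= rnorm v + s * rnorm (rv e).
  by apply: le_trans h2 _; apply: le_trans (rnormD _ _) _; rewrite rnorm_ray.
have w0 : 0 < rnorm (rv e).
  rewrite lt_def rnorm_ge0 andbT; apply/eqP => we; move: h3 c1 rr0 rr3; rewrite we mulr0; lra_rnorm.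
pose t := 2 * rr / rnorm (rv e).
have t0 : 0 <= t by rewrite divr_ge0 ?rnorm_ge0 // mulr_ge0 // ltW.
have nt : rnorm (rc t *: rv e) = 2 * rr by rewrite rnorm_ray // /t divfK // lt0r_neq0.
have ts : t <= s by rewrite ler_pdivrMr //; move: h3 c1 rr0 rr3; lra_rnorm.
have u1 : rnorm (v + rc t *: rv e) <= rnorm v + 2 * rr by rewrite -nt rnormD.
have u2 : 2 * rr <= rnorm (v + rc t *: rv e) + rnorm v by rewrite -nt; exact: rnorm_subl.
exists t => //; apply: far.
- by move: u2 c1; lra_rnorm.
- by move: u1 c1 rr3; lra_rnorm.
- exact: (slice_convex_between cA t0 ts Az As).
Qed.

(** A point of the cap between two points outside the enlarged set would lie, on a real
    line, between two points with qf <= - ep, and qf is convex on the line. *)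
Lemma cap_slice_convex (D U : set V) z0 ka b M (r de rr ep : R) : 0 < de -> slice_convex (D `\` U) ->
  (forall e, 0 <= qf ka 0 M (rv e)) ->
  (forall v, rnorm v < r -> ~ U (z0 + v) -> qf ka b M v <= - (de * rnorm v ^+ 2)) ->
  0 < rr -> 3 * rr < r -> ep <= de * rr ^+ 2 ->
  slice_convex (D `\` (U `|` [set z | cap ka b M rr ep (z - z0)])).
Proof.
move=> de0 cA q2 qA rr0 rr3 epd z e s1 s2 s10 s20.
have -> : z = z0 + (z - z0) by rewrite addrC subrK.
move: (z - z0) => v [D1 /not_orP[U1 C1]] [D2 /not_orP[U2 C2]].
have E1 : z0 + v + rc s1 *: rv e - z0 = v + rc s1 *: rv e by exact: shift_sub2.
have E2 : z0 + v + rc s2 *: rv (- e) - z0 = v + rc s2 *: rv (- e) by exact: shift_sub2.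
have E3 : z0 + v - z0 = v by exact: shift_sub.
have {}C1 : ~ cap ka b M rr ep (v + rc s1 *: rv e) by move=> h; apply: C1; exact: (eq_ind_r (cap ka b M rr ep) h E1).
have {}C2 : ~ cap ka b M rr ep (v + rc s2 *: rv (- e)) by move=> h; apply: C2;
  exact: (eq_ind_r (cap ka b M rr ep) h E2).
have [Dz Uz] := cA _ e s1 s2 s10 s20 (conj D1 U1) (conj D2 U2).
split; first exact: Dz.
case; first exact: Uz.
move=> /(eq_ind _ (cap ka b M rr ep))/(_ _ E3) c3.
have [t1 t10 h1] := exit_point de0 cA qA rr0 rr3 epd c3 s10 (conj Dz Uz) (conj D1 U1) C1.
have [t2 t20 h2] := exit_point de0 cA qA rr0 rr3 epd c3 s20 (conj Dz Uz) (conj D2 U2) C2.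
have [_] := c3; apply/negP; rewrite -leNgt.
rewrite rvN ray_opp qf_line sqrrN mulNr in h2; rewrite qf_line in h1.
exact: (convex_quad_le (q2 e) t10 t20 h1 h2).
Qed.

(** The extension H of local_extension agrees with k near some arbitrarily small point where
    q > 0. Agreement is transported along segments in U. It first reaches all small points
    with q > 0, by climbing along the steep direction, moving across, and descending. A
    point v of the cap in U is then joined to such a point: move from v along a real
    direction d in which q has slope 0, so that q does not decrease, to a distance from 0
    where the complement of U lies below q = - ep, and climb from there to q > 0. The first
    move stays in U for one of the directions d and - d, because the slices of the
    complement of U are convex. *)
Lemma local_step (D U : set V) (k : V -> C) z0 ka b M (r de : R) :
  (1 < n)%N -> 0 < ka -> 0 < r -> 0 < de -> open U -> hol U k -> U `<=` D ->
  (forall v, rnorm v < r -> D (z0 + v)) -> slice_convex (D `\` U) ->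
  (forall v, rnorm v < r -> ~ U (z0 + v) -> qf ka b M v <= - (de * rnorm v ^+ 2)) ->
  (exists j, complex.Re (b 0 j) != 0) -> (forall e, 0 <= qf ka 0 M (rv e)) ->
  exists (U' : set V) (k' : V -> C),
  [/\ open U', hol U' k', U `<=` U', U' `<=` D & U' z0] /\ slice_convex (D `\` U') /\ (forall z, U z -> k' z = k z).
Proof.
move=> n1 ka0 r0 de0 oU hU UD Dr cA qA bj q2; pose q := qf ka b M.
have L1 := outside_neg de0 qA.
have [e0 [r1 r10 inc]] := steep_direction bj q2.
set w0 := rv e0 in inc; pose N := rnorm w0; have N0 : 0 <= N := rnorm_ge0 w0.
have b0 : b != 0.
  by have [j] := bj; apply: contraNneq => ->; rewrite mxE.
have [beta [H [be0 hH HE]]] := local_extension n1 ka0 b0 r0 oU hU L1.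
pose rm := Num.min r (Num.min beta r1).
have rm0 : 0 < rm by rewrite !lt_min r0 be0.
have [rmr rmb rm1] : [/\ rm <= r, rm <= beta & rm <= r1] by rewrite /rm !ge_min !lexx !orbT.
clearbody rm.
have N1 : 0 < N + 1 by rewrite ltr_wpDl.
(* la is the height of the climb, and r3 the radius of a ball where q > - la / 2, so that a
   climb by la leads to q > 0 *)
pose la := rm / (4 * (N + 1)).
have la0 : 0 < la by rewrite divr_gt0 // mulr_gt0.
have laN : la * N <= rm / 4.
  have : la * (4 * (N + 1)) = rm by rewrite /la divfK // lt0r_neq0 // mulr_gt0.
  lra.
have [r3 [r30 r3m q3]] : exists r3 : R, [/\ 0 < r3, r3 <= rm / 4 & forall v, rnorm v < r3 -> - (la / 2) < q v].
  have h : - (la / 2) < q 0 by rewrite /q qf0; lra.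
  have /near_rnormP[d d0 Hd] := rgt_near (@qf_cont _ _ ka b M 0) h.
  exists (Num.min d (rm / 4)); split; first by rewrite lt_min d0 divr_gt0.
    by rewrite ge_min lexx orbT.
  by move=> v; rewrite lt_min => /andP[vd _]; apply: Hd; rewrite subr0.
clearbody la.
pose W := U `&` [set z | rnorm (z - z0) < rm].
have oW : open W by apply: openI => //; exact: open_ball0.
have hW : hol W k by move=> z [Uz _]; exact: hU.
have HW : hol W H by move=> z [_ zz]; apply: hH; apply: lt_le_trans rmb.
have nzz v : z0 + v - z0 = v by rewrite addrC addKr.
have WU v : rnorm v < rm -> U (z0 + v) -> W (z0 + v) by move=> vr Uv; split => //=; rewrite nzz.
have Wq v : rnorm v < rm -> 0 < q v -> W (z0 + v).
  by move=> vr qv; apply: WU => //; apply: L1 => //; exact: lt_le_trans rmr.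
have nla (t : R) : 0 <= t -> t <= 1 -> rnorm (rc (t * la) *: w0) <= rm / 4.
  move=> t0 t1; rewrite rnormZ rnorm_rc ger0_norm; last by rewrite mulr_ge0 // ltW.
  apply: le_trans laN; rewrite ler_wpM2r // ler_piMl // ltW //.
have c1 v : rnorm v < r3 -> 0 < q v -> \forall w \near z0 + v, H w = k w.
  move=> vr qv; have [v' [v'r qv' germ]] := HE _ r30.
  have up u (t : R) : rnorm u < r3 -> 0 < q u -> 0 <= t -> t <= 1 -> W (z0 + (u + rc (t * la) *: w0)).
    move=> ur qu t0 t1; have tl : 0 <= t * la by rewrite mulr_ge0 // ltW.
    apply: Wq; first by apply: le_lt_trans (rnormD _ _) _; have := nla t t0 t1; lra.
    apply: lt_le_trans (inc u (t * la) _ tl); last by lra.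
    by rewrite ltr_wpDr // divr_ge0.
  apply: (germ_along_segment (v := rc la *: w0) oW HW hW) => [t /andP[t0 t1]|].
    by rewrite ray_scale; exact: up.
  apply: (germ_along_segment (v := v' - v) oW HW hW) => [t /andP[t0 t1]|].
    rewrite chord_shift.
    have ur : rnorm (rc (1 - t) *: v + rc t *: v') < r3.
      apply: le_lt_trans (rnormD _ _) _; rewrite !rnormZ !rnorm_rc !ger0_norm ?subr_ge0 //.
      have a1 : (1 - t) * rnorm v <= (1 - t) * Num.max (rnorm v) (rnorm v').
        by rewrite ler_wpM2l ?subr_ge0 // le_max lexx.
      have a2 : t * rnorm v' <= t * Num.max (rnorm v) (rnorm v').
        by rewrite ler_wpM2l // le_max lexx orbT.
      have : Num.max (rnorm v) (rnorm v') < r3 by rewrite gt_max vr.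
      lra.
    have l1 := nla 1 ler01 (lexx _); rewrite mul1r in l1.
    apply: Wq; first by apply: le_lt_trans (rnormD _ _) _; lra.
    have ur1 : rnorm (rc (1 - t) *: v + rc t *: v') < r1 by apply: lt_le_trans ur _; lra.
    apply: lt_le_trans (inc _ la ur1 (ltW la0)).
    by have := q3 _ ur; rewrite -(subr_gt0 (- _)) opprK.
  rewrite shift_end.
  apply: (germ_along_segment (v := rc (- la) *: w0) oW HW hW) => [t /andP[t0 t1]|].
    by rewrite ray_return; apply: up => //; lra.
  by rewrite rcN scaleNr addrK.
pose rr := r3 / 8; have rr0 : 0 < rr by rewrite divr_gt0.
have rrE : r3 = 8 * rr by rewrite /rr; field.
clearbody rr.
(* 2 rr is the length of the move along d; a climb by 3 ep raises q by at least 3 ep / 2,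
   from above - ep to above 0 *)
pose ep := Num.min (de * rr ^+ 2 / 4) (rr / (12 * (N + 1))).
have ep0 : 0 < ep by rewrite lt_min !divr_gt0 ?mulr_gt0 ?exprn_gt0.
have ep1 : ep <= de * rr ^+ 2 / 4 by rewrite ge_min lexx.
have ep2 : 3 * ep * N <= rr / 4.
  have : ep * (12 * (N + 1)) <= rr by rewrite -ler_pdivlMr ?mulr_gt0 // ge_min lexx orbT.
  lra.
clearbody ep.
have near0 v : rnorm v < r -> ~ U (z0 + v) -> - ep <= q v -> rnorm v <= rr / 2.
  move=> vr nUv qv; have := qA v vr nUv; rewrite -/q => h.
  have : de * rnorm v ^+ 2 <= de * (rr / 2) ^+ 2 by rewrite exprMn; move: ep1 h qv; rewrite expr2; lra.
  by rewrite ler_pM2l // ler_pXn2r ?nnegrE ?rnorm_ge0 ?divr_ge0 // ltW.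
have c2 v : cap ka b M rr ep v -> U (z0 + v) -> \forall w \near z0 + v, H w = k w.
  move=> [vr qv] Uv.
  have [d [dn dl dU]] : exists d : E, [/\ rnorm (rv d) = 2 * rr, complex.Re (dotC (qgrad ka b M v) (rv d)) = 0 &
      forall t : R, 0 <= t -> t <= 1 -> U (z0 + v + rc t *: rv d)].
    have [d1 d10 dl1] := real_kernel_vector (qgrad ka b M v) n1.
    have nd1 : 0 < rnorm (rv d1) by rewrite rnorm_gt0 rv_eq0.
    pose d := (2 * rr / rnorm (rv d1)) *: d1.
    have nd : rnorm (rv d) = 2 * rr.
      rewrite rvZ rnormZ rnorm_rc ger0_norm; last by rewrite divr_ge0 ?mulr_ge0 // ltW.
      by rewrite divfK // lt0r_neq0.
    have dl : complex.Re (dotC (qgrad ka b M v) (rv d)) = 0 by rewrite rvZ dotCZ ReMrc dl1 mulr0.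
    have Dd (t : R) e : 0 <= t -> t <= 1 -> rnorm (rv e) = 2 * rr -> D (z0 + v + rc t *: rv e).
      move=> t0 t1 ne; rewrite -addrA; apply: Dr; apply: le_lt_trans (rnormD _ _) _.
      rewrite rnormZ rnorm_rc ger0_norm // ne.
      have : t * (2 * rr) <= 1 * (2 * rr) by rewrite ler_wpM2r // mulr_ge0 // ltW.
      by move: vr r3m rmr rr0; rewrite rrE; lra_rnorm.
    have ndN : rnorm (rv (- d)) = 2 * rr by rewrite rvN rnormN.
    have [h1|h1] := pselect (forall t : R, 0 <= t -> t <= 1 -> U (z0 + v + rc t *: rv d)); first by exists d.
    exists (- d); split => //; first by rewrite rvN -scaleN1r dotCZ mulN1r CReN dl oppr0.
    move=> t t0 t1; apply: contrapT => nUt; apply: h1 => s s0 s1; apply: contrapT => nUs.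
    have [//] : (D `\` U) (z0 + v).
    by apply: (cA _ d s t s0 t0); split; [exact: Dd|exact: nUs|exact: Dd|exact: nUt].
  have qd (t : R) : q v <= q (v + rc t *: rv d).
    by rewrite /q qf_line dl mulr0 addr0 lerDl mulr_ge0 ?sqr_ge0.
  have u1 : rnorm (v + rv d) <= rnorm v + 2 * rr by rewrite -dn rnormD.
  have u2 : 2 * rr <= rnorm (v + rv d) + rnorm v by rewrite -dn; exact: rnorm_subl.
  pose u := v + rv d; rewrite -/u in u1 u2.
  have qu : - ep < q u by apply: lt_le_trans qv _; have := qd 1; rewrite scale1r.
  have ne (t : R) : 0 <= t -> t <= 1 -> rnorm (rc (t * (3 * ep)) *: w0) <= rr / 4.
    move=> t0 t1; have tp : 0 <= 3 * ep by rewrite mulr_ge0 // ltW.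
    rewrite rnormZ rnorm_rc ger0_norm; last by rewrite mulr_ge0.
    by apply: le_trans ep2; rewrite ler_wpM2r // ler_piMl.
  apply: (germ_along_segment (v := rv d) oW HW hW) => [t /andP[t0 t1]|].
    rewrite -addrA; apply: WU; last by rewrite addrA; exact: dU.
    apply: le_lt_trans (rnormD _ _) _; rewrite rnormZ rnorm_rc ger0_norm // dn.
    have : t * (2 * rr) <= 1 * (2 * rr) by rewrite ler_wpM2r // mulr_ge0 // ltW.
    by move: vr r3m rr0; rewrite rrE; lra_rnorm.
  rewrite -addrA -/u.
  have ur1 : rnorm u < r1 by move: vr r3m rm1 rr0 u1; rewrite rrE; lra_rnorm.
  apply: (germ_along_segment (v := rc (3 * ep) *: w0) oW HW hW) => [t /andP[t0 t1]|].
    rewrite ray_scale.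
    have tp : 0 <= t * (3 * ep) by rewrite !mulr_ge0 // ltW.
    have n1' := ne t t0 t1.
    have u3 : rnorm (u + rc (t * (3 * ep)) *: w0) <= rnorm u + rnorm (rc (t * (3 * ep)) *: w0) by exact: rnormD.
    have u4 : rnorm u <= rnorm (u + rc (t * (3 * ep)) *: w0) + rnorm (rc (t * (3 * ep)) *: w0) by exact: rnorm_subr.
    have uw : rnorm (u + rc (t * (3 * ep)) *: w0) < rm.
      by apply: le_lt_trans u3 _; move: vr r3m rr0 u1 n1'; rewrite rrE; lra_rnorm.
    apply: (WU _ uw).
    apply: contrapT => nUu; have := near0 _ _ nUu _.
    have e1 : rnorm (u + rc (t * (3 * ep)) *: w0) < r by move: vr r3m rmr rr0 u1 u3 n1'; rewrite rrE; lra_rnorm.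
    have e3 : - ep <= q (u + rc (t * (3 * ep)) *: w0).
      by have := inc u _ ur1 tp; move: qu tp; rewrite -/q; move: (q u) (q _) => a a'; clear; lra.
    by move=> /(_ e1 e3); move: u2 u4 n1' vr rr0; lra_rnorm.
  rewrite -addrA; apply: c1.
    have n1' := ne 1 ler01 (lexx _); rewrite mul1r in n1'.
    apply: le_lt_trans (rnormD _ _) _; move: vr rr0 u1 n1'; rewrite rrE; lra_rnorm.
  have ep3 : 0 <= 3 * ep by rewrite mulr_ge0 // ltW.
  by have := inc u _ ur1 ep3; move: qu ep0; rewrite -/q; move: (q u) (q _) => a a'; clear; lra.
have ocap : open [set z | cap ka b M rr ep (z - z0)] by exact: cap_open.
exists (U `|` [set z | cap ka b M rr ep (z - z0)]), (fun z => if pselect (U z) then k z else H z).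
have r38 : 3 * rr < r by move: r3m rmr rr0; rewrite rrE; lra_rnorm.
split; last split.
- split.
  + exact: openU.
  + move=> z [Uz|cz].
      have := @diff_near_eq _ _ (fun z => if pselect (U z) then k z else H z) k z.
      have Hn : \forall w \near z, (if pselect (U w) then k w else H w) = k w.
        have : nbhs z U by apply: open_nbhs_nbhs; split.
        by apply: filterS => w Uw; case: pselect.
      by move=> /(_ Hn (hU z Uz)) [].
    have := @diff_near_eq _ _ (fun z => if pselect (U z) then k z else H z) H z.
    have Hn : \forall w \near z, (if pselect (U w) then k w else H w) = H w.
      have : nbhs z [set z | cap ka b M rr ep (z - z0)] by apply: open_nbhs_nbhs; split.
      apply: filterS => w cw; case: pselect => // Uw.
      have wE : z0 + (w - z0) = w by rewrite addrC subrK.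
      have := c2 _ cw; rewrite wE => /(_ Uw)/nbhs_singleton e; exact: esym.
    have Hz : differentiable H z.
      by apply: hH; have [] := cz; rewrite /=; move: r3m rmb rr0; rewrite rrE; lra_rnorm.
    by move=> /(_ Hn Hz) [].
  + by left.
  + move=> z [/UD//|[cz _]]; have <- : z0 + (z - z0) = z by rewrite addrC subrK.
    by apply: Dr; apply: lt_trans cz _; move: r38 rr0; clear; lra.
  + by right; rewrite /= subrr /cap /= rnorm0 /q qf0 oppr_lt0.
- apply: (cap_slice_convex de0 cA q2 qA rr0 r38); apply: le_trans ep1 _; have : 0 <= de * rr ^+ 2
  by rewrite mulr_ge0 ?sqr_ge0 // ltW.
  by clear; lra.
- by move=> z Uz; case: pselect.
Qed.

End LocalStep.

(** * Quadratic models at a maximum *)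

Section Touch.
Variables (R : realType) (n : nat).
Notation C := (Cx R).
Notation rc x := (real_complex R x : Cx R).
Notation V := 'rV[C]_n.
Notation E := 'rV[R]_n.
Implicit Types (u v w z b : V) (M : 'M[C]_n) (e : E) (A : set V).

Lemma BqMl (c : C) M u v : Bq (c *: M) u v = c * Bq M u v.
Proof.
rewrite /Bq mulr_sumr; apply: eq_bigr => j _; rewrite mulr_sumr.
by apply: eq_bigr => k _; rewrite mxE mulrCA.
Qed.

Lemma dotC0 w : dotC 0 w = 0.
Proof. by rewrite /dotC big1 // => j _; rewrite mxE mul0r. Qed.

(** The complex linear part at z of Re h + ep N2; the conjugate comes from N2. *)
Definition touch_grad (ep : R) (h : V -> C) z : V := \row_j (grad h z 0 j + rc (2 * ep) * (z 0 j)^*%C).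

Lemma touch_gradE ep h z v : dotC (touch_grad ep h z) v = dotC (grad h z) v + rc (2 * ep) * herm z v.
Proof.
rewrite /dotC /herm mulr_sumr -big_split /=; apply: eq_bigr => j _.
rewrite mxE; move: (grad h z 0 j) (rc _) ((z 0 j)^*%C) (v 0 j) => c1 c2 c3 c4.
by rewrite mulrDl mulrA.
Qed.

(** At a maximum over A the second-order expansion of Re h + ep N2 is at most 0 on A, up to
    a cubic remainder. Giving up half of ep N2 absorbs the remainder and leaves a negative
    multiple of |v|^2. *)
Lemma model_at_max (U : set V) (h : V -> C) z0 (ep : R) A : open U -> hol U h -> U z0 -> 0 < ep ->
  (forall z, A z -> complex.Re (h z) + ep * N2 z <= complex.Re (h z0) + ep * N2 z0) ->
  exists2 r : R, 0 < r & forall v, rnorm v < r -> A (z0 + v) ->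
    qf (ep / 2) (touch_grad ep h z0) (2^-1 *: hess h z0) v <= - (ep / 4 * rnorm v ^+ 2).
Proof.
move=> oU hU Uz e0 HA; have [r1 r10 [K K0 HK]] := quad_taylor oU hU Uz.
have eK : 0 < ep / (4 * K) by rewrite divr_gt0 // mulr_gt0.
exists (Num.min r1 (ep / (4 * K))); first by rewrite lt_min r10.
move=> v; rewrite lt_min => /andP[/ltW vr]; rewrite ltr_pdivlMr ?mulr_gt0 // => vK Av.
have := HA _ Av; rewrite N2D.
have := le_trans (Re_ge _) (lexx (complex.Re (h (z0 + v) - h z0 - dotC (grad h z0) v - 2^-1 * Bq (hess h z0) v v))).
have := HK v vr; have := rnorm_N2 v.
have v3 : K * rnorm v ^+ 3 <= ep / 4 * rnorm v ^+ 2.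
  by rewrite exprS mulrA ler_wpM2r ?sqr_ge0 //; move: vK; clear; move: (rnorm v) => x; lra.
rewrite /qf touch_gradE BqMl !CReD !CReN ReMrc; move: v3.
move: (rnorm _) (K * _) (rnorm v ^+ 2) (N2 v) (N2 z0) (complex.Re (herm _ _)) => x1 x2 x3 x4 x5 x6.
move: (complex.Re _) (complex.Re _) (complex.Re _) (complex.Re _) => x7 x8 x9 x10 h1 h2 h3 h4 h5.
have h6 : ep * x3 <= ep * x4 by rewrite ler_wpM2l // ltW.
have -> : 2 * ep * x6 = 2 * (ep * x6) by rewrite mulrA.
move: h5; rewrite !mulrDr (mulrCA ep 2).
move: h1 h3 h4 h6; rewrite ![ep / _ * _]mulrAC.
move: (ep * x3) (ep * x4) (ep * x5) (ep * x6) => y1 y2 y3 y4; clear; lra.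
Qed.

(** On the sphere of radius r the model is negative on A, and it remains so after a small
    translation; hence the translated model has its maximum over A in the open ball. *)
Lemma translated_max A ka b M (r de : R) : 0 < r -> 0 < de -> compact (A `&` [set v | rnorm v <= r]) -> A 0 ->
  (forall v, rnorm v <= r -> A v -> qf ka b M v <= - (de * rnorm v ^+ 2)) ->
  exists2 d : R, 0 < d & forall u, rnorm u < d -> 0 < qf ka b M u ->
    exists v, [/\ A v, rnorm v < r, 0 < qf ka b M (u + v) &
      forall v', A v' -> rnorm v' <= r -> qf ka b M (u + v') <= qf ka b M (u + v)].
Proof.
move=> r0 de0 cA A0 HA; pose q := qf ka b M.
pose Sr := (A `&` [set v | rnorm v <= r]) `&` [set v | - rnorm v <= - r].
have cS : compact Sr.
  apply: compact_closedI; first exact: cA.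
  have cN : forall v : V, {for v, continuous (fun v : V => - rnorm v)}.
    by move=> v; apply: contRN; exact: rnorm_cont.
  exact: (closed_sublevel (a := - r) cN).
have oq : open [set v : V | 0 < - q v].
  have cN : forall v : V, {for v, continuous (fun v : V => - q v)}.
    by move=> v; apply: contRN; exact: qf_cont.
  exact: (open_superlevel 0 cN).
have cid : forall v : V, {for v, continuous (fun v : V => v)} by move=> v; exact: contV_id.
have HS v : Sr v -> [set v : V | 0 < - q v] (0 + v).
  move=> [[Av vr] rv0]; rewrite /mkset add0r oppr_gt0; rewrite /mkset lerN2 in rv0.
  apply: le_lt_trans (HA v vr Av) _; rewrite oppr_lt0 mulr_gt0 // exprn_gt0 //.
  exact: lt_le_trans rv0.
have /near_rnormP[d d0 Hd] := near_compact_in cS cid oq HS.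
exists d => // u ud qu.
have cq : forall v : V, {for v, continuous (fun v : V => q (u + v))}.
  move=> v; have c1 : {for v, continuous (fun v : V => u + v)} by apply: contVD; [exact: contV_cst|exact: contV_id].
  exact: (continuous_comp c1 (@qf_cont _ _ ka b M _)).
have ne : A `&` [set v | rnorm v <= r] !=set0.
  by exists 0; split => //; rewrite /mkset rnorm0 ltW.
have [v [Av vr] vm] := max_on ne cA cq; exists v.
have qv : 0 < q (u + v).
  apply: lt_le_trans qu _; have := vm 0; rewrite addr0; apply.
  by split => //; rewrite /mkset rnorm0 ltW.
split => //; last by move=> v' Av' v'r; apply: vm; split.
rewrite lt_neqAle; rewrite /mkset in vr; rewrite vr andbT; apply/eqP => vE.
have Sv : Sr v by split; [split|rewrite /mkset vE].
have := Hd u; rewrite subr0 => /(_ ud v Sv); rewrite /mkset oppr_gt0.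
by rewrite ltNge (ltW qv).
Qed.

(** If the linear part is useless in the direction u, touch A at a new point v by the model
    translated by a small multiple s u. Expanding at v gives the gradient at s u + v as the
    new linear part, and the next two lemmas show that it is as wanted. *)
Lemma shifted_model A ka b M (r de : R) (u : V) : 0 < ka -> 0 < r -> 0 < de ->
  compact (A `&` [set v | rnorm v <= r]) -> A 0 ->
  (forall v, rnorm v <= r -> A v -> qf ka b M v <= - (de * rnorm v ^+ 2)) ->
  complex.Re (dotC b u) = 0 -> 0 < qf ka 0 M u ->
  exists v (s : R), [/\ A v, rnorm v < r, 0 < qf ka b M (rc s *: u + v), qf ka b M v <= 0 &
    forall w, A (v + w) -> rnorm (v + w) <= r ->
      qf (ka / 2) (qgrad ka b M (rc s *: u + v)) M w <= - (ka / 2 * rnorm w ^+ 2)].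
Proof.
move=> ka0 r0 de0 cA A0 HA bu qu; have [d d0 Hd] := translated_max r0 de0 cA A0 HA.
have u1 : 0 < rnorm u + 1 by rewrite ltr_wpDl // rnorm_ge0.
pose s := d / 2 / (rnorm u + 1).
have s0 : 0 < s by rewrite !divr_gt0.
have sd : rnorm (rc s *: u) < d.
  have : s * (rnorm u + 1) = d / 2 by rewrite /s divfK // lt0r_neq0.
  rewrite (rnorm_ray _ (ltW s0)); move: d0 s0; move: (rnorm u) => x; clear; lra.
have qs : 0 < qf ka b M (rc s *: u).
  by rewrite qf_lin dotCZ ReMrc bu mulr0 add0r qf2Z mulr_gt0 // exprn_gt0.
have [v [Av vr qv vm]] := Hd _ sd qs; exists v, s; split => //.
  by apply: le_trans (HA v (ltW vr) Av) _; rewrite oppr_le0 mulr_ge0 ?sqr_ge0 // ltW.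
move=> w Aw wr; have := vm _ Aw wr; rewrite addrA (qf_add ka b M (rc s *: u + v) w) gerDl.
rewrite /qf; have := rnorm_N2 w; move=> h.
have : ka * rnorm w ^+ 2 <= ka * N2 w by rewrite ler_wpM2l // ltW.
move: (complex.Re _) (rnorm w ^+ 2) (N2 w) => x1 x2 x3; rewrite ![ka / _ * _]mulrAC.
by move: (ka * x2) (ka * x3) => y1 y2; clear; lra.
Qed.

Lemma halved_model A ka b M (r de : R) : 0 < ka ->
  (forall v, rnorm v <= r -> A v -> qf ka b M v <= - (de * rnorm v ^+ 2)) ->
  forall v, rnorm v <= r -> A v -> qf (ka / 2) b M v <= - (de * rnorm v ^+ 2).
Proof.
move=> ka0 HA v vr Av; apply: le_trans (HA v vr Av); rewrite /qf lerD2r.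
by rewrite ler_wpM2r ?N2_ge0 //; move: ka0; clear; lra.
Qed.

Lemma dotC_real0 b : (forall j, complex.Re (b 0 j) = 0) -> forall e, complex.Re (dotC b (rv e)) = 0.
Proof.
move=> H e; rewrite /dotC Re_sum big1 // => j _.
by rewrite mxE mulrC ReMrc H mulr0.
Qed.

Lemma Re_ge0_pos ka M e : 0 <= ka -> e != 0 -> 0 < complex.Re (Bq M (rv e) (rv e)) -> 0 < qf ka 0 M (rv e).
Proof. by move=> k0 e0 h; rewrite /qf dotC0 add0r ltr_wpDl // mulr_ge0 // N2_ge0. Qed.

(** For u a real direction the new linear part has a nonzero real entry: otherwise moving
    back by s u, along which the quadratic part is positive, would show that the model is
    positive at v, a point of A, where it is at most 0. *)
Lemma model_real_gradient A ka b M (r de : R) : (1 < n)%N -> 0 < ka -> 0 < r -> 0 < de ->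
  compact (A `&` [set v | rnorm v <= r]) -> A 0 ->
  (forall v, rnorm v <= r -> A v -> qf ka b M v <= - (de * rnorm v ^+ 2)) ->
  (forall e, e != 0 -> 0 < complex.Re (Bq M (rv e) (rv e))) ->
  exists v0 b' (de' : R), [/\ A v0, rnorm v0 < r, 0 < de', exists j, complex.Re (b' 0 j) != 0 &
    forall w, A (v0 + w) -> rnorm (v0 + w) <= r -> qf (ka / 2) b' M w <= - (de' * rnorm w ^+ 2)].
Proof.
move=> n1 ka0 r0 de0 cA A0 HA Hp.
have [hb|hb] := pselect (exists j, complex.Re (b 0 j) != 0).
  exists 0, b, de; split; rewrite ?rnorm0 // => w; rewrite add0r => Aw wr.
  exact: (halved_model ka0 HA).
have {}hb j : complex.Re (b 0 j) = 0.
  by apply/eqP; apply: contrapT => /negP h; apply: hb; exists j.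
have [j0 _] := two_indices n1.
have dn : delta_mx 0 j0 != 0 :> E.
  by apply/eqP => /rowP/(_ j0)/eqP; rewrite !mxE !eqxx oner_eq0.
have qp e : e != 0 -> 0 < qf ka 0 M (rv e) by move=> e0; apply: Re_ge0_pos (ltW ka0) e0 (Hp e e0).
have [v [s [Av vr qv qv0 H]]] := shifted_model ka0 r0 de0 cA A0 HA (dotC_real0 hb (delta_mx 0 j0)) (qp _ dn).
exists v, (qgrad ka b M (rc s *: rv (delta_mx 0 j0) + v)), (ka / 2); split => //; first by rewrite divr_gt0.
apply: contrapT => hb'.
have {}hb' j : complex.Re (qgrad ka b M (rc s *: rv (delta_mx 0 j0) + v) 0 j) = 0.
  by apply/eqP; apply: contrapT => /negP h; apply: hb'; exists j.
have := qf_line ka b M (rc s *: rv (delta_mx 0 j0) + v) (- s) (rv (delta_mx 0 j0)).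
rewrite rcN scaleNr addrAC subrr add0r (dotC_real0 hb') mulr0 addr0 sqrrN => h.
move: qv0; rewrite h leNgt => /negP; apply.
by rewrite ltr_wpDr // mulr_ge0 ?sqr_ge0 // ltW // qp.
Qed.

(** A model without linear part is homogeneous of degree 2, so it vanishes at its critical
    points; but it is positive at s u + v. A vector u where it is positive exists, as
    multiplication by 'i changes the sign of the holomorphic part and preserves N2. *)
Lemma model_nonzero_gradient A ka b M (r de : R) : (1 < n)%N -> 0 < ka -> 0 < r -> 0 < de ->
  compact (A `&` [set v | rnorm v <= r]) -> A 0 ->
  (forall v, rnorm v <= r -> A v -> qf ka b M v <= - (de * rnorm v ^+ 2)) ->
  exists v0 b' (de' : R), [/\ A v0, rnorm v0 < r, 0 < de', b' != 0 &
    forall w, A (v0 + w) -> rnorm (v0 + w) <= r -> qf (ka / 2) b' M w <= - (de' * rnorm w ^+ 2)].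
Proof.
move=> n1 ka0 r0 de0 cA A0 HA.
have [hb|hb] := eqVneq b 0; last first.
  exists 0, b, de; split; rewrite ?rnorm0 // => w; rewrite add0r => Aw wr.
  exact: (halved_model ka0 HA).
rewrite hb in HA *.
have [u qu] : exists u, 0 < qf ka 0 M u.
  have [j0 _] := two_indices n1; pose u := rv (delta_mx 0 j0 : E).
  have u0 : 0 < N2 u.
    rewrite N2_gt0 rv_eq0; apply/eqP => /rowP/(_ j0)/eqP; by rewrite !mxE !eqxx oner_eq0.
  have [h|h] := ltP 0 (qf ka 0 M u); first by exists u.
  exists ('i%C *: u : V); move: h; rewrite /qf !dotC0 !add0r N2Z BqZl BqZr.
  have -> : rnorm ('i%C : C) = 1 by rewrite rnormE /= expr0n add0r expr1n sqrtr1.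
  rewrite expr1n mul1r mulrA -expr2 sqr_i mulN1r CReN.
  have : 0 < ka * N2 u by rewrite mulr_gt0.
  by move: (ka * _) (complex.Re _) => x y; clear; lra.
have d0 : complex.Re (dotC (0 : V) u) = 0 by rewrite dotC0.
have [v [s [Av vr qv qv0 H]]] := shifted_model ka0 r0 de0 cA A0 HA d0 qu.
exists v, (qgrad ka 0 M (rc s *: u + v)), (ka / 2); split => //; first by rewrite divr_gt0.
apply/eqP => hb'.
have := qf_line ka 0 M (rc s *: u + v) (- 1) (rc s *: u + v).
rewrite hb' dotC0 mulr0 addr0 sqrrN expr1n mul1r rcN scaleN1r subrr qf0.
by move: qv; move: (qf _ _ _ _) => x; clear; lra.
Qed.

End Touch.

(** * Extension to the hull domain *)

Section Extension.
Variables (R : realType) (n : nat).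
Notation C := (Cx R).
Notation rc x := (real_complex R x : Cx R).
Notation V := 'rV[C]_n.
Notation E := 'rV[R]_n.
Implicit Types (u v w z b : V) (M : 'M[C]_n) (e : E) (X : set E) (U S : set V).

Lemma reV_cont z : {for z, continuous (@reV R n)}.
Proof.
move=> P /nbhs_ballP[e e0 He]; apply/(@near_rnormP _ V z); exists e => // w wz; apply: He; split => // i j.
rewrite ord1 !mxE; apply: le_lt_trans wz; rewrite rnorm_distC.
have := rnorm_coord (z - w) j; rewrite !mxE; apply: le_trans.
by rewrite -CReN -CReD; exact: Re_le.
Qed.

Lemma e2im z : e2 (imV z) = (N2 z - complex.Re (dotC z z)) / 2.
Proof.
rewrite /e2 /N2 /dotC Re_sum -sumrB mulr_suml; apply: eq_bigr => j _.
by rewrite mxE rnorm_sqr; case: (z 0 j) => a c /=; field.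
Qed.

Lemma N2_cont z : {for z, continuous (@N2 R n)}.
Proof.
have -> : @N2 R n = (fun v => complex.Re (herm v v)) by apply/funext => v; exact: N2_herm.
by apply: Re_comp_cont; exact: herm_cont.
Qed.

Lemma sq_cont z : {for z, continuous (fun z : V => dotC z z)}.
Proof. by apply: contC_sum => j; apply: contCM; exact: coord_cont. Qed.

Lemma e2im_cont z : {for z, continuous (fun z : V => e2 (imV z))}.
Proof.
have -> : (fun z : V => e2 (imV z)) = (fun z => (N2 z + - complex.Re (dotC z z)) * 2^-1).
  by apply/funext => v; exact: e2im.
apply: contRM; last exact: contR_cst.
by apply: contRD; [exact: N2_cont|apply: contRN; apply: Re_comp_cont; exact: sq_cont].
Qed.

Definition open_tube X (r2 : R) : set V := [set z | X (reV z) /\ e2 (imV z) < r2].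
Definition closed_tube X (r2 : R) : set V := [set z | closure X (reV z) /\ e2 (imV z) <= r2].

Lemma open_tube_open X r2 : open X -> open (open_tube X r2).
Proof.
move=> oX; rewrite openE => z [h1 h2].
have c1 : nbhs z (@reV R n @^-1` X) by apply: (@reV_cont z); apply: open_nbhs_nbhs; split.
exact: filterI c1 (rlt_near (@e2im_cont z) h2).
Qed.

Lemma closed_tube_closed X r2 : closed (closed_tube X r2).
Proof.
have -> : closed_tube X r2 = (@reV R n @^-1` closure X) `&` [set z | e2 (imV z) <= r2] by [].
apply: closedI; last by apply: closed_sublevel => z; exact: e2im_cont.
apply: preimage_closed; first by move=> z _; exact: reV_cont.
exact: closed_closure.
Qed.

Lemma closed_tube_bounded X r2 (B : R) z : (forall x, closure X x -> e2 x <= B) -> closed_tube X r2 z ->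
  rnorm z <= B + r2 + 1.
Proof.
move=> HB [h1 h2]; have := rnorm_N2 z; rewrite N2E => h.
have := HB _ h1 => h3.
have h4 : rnorm z ^+ 2 <= B + r2 by apply: le_trans h _; apply: lerD.
rewrite leNgt; apply/negP => h5.
have : rnorm z * 1 <= rnorm z * rnorm z.
  rewrite ler_wpM2l ?rnorm_ge0 //; apply: le_trans (ltW h5).
  by rewrite lerDr; apply: le_trans h4; exact: sqr_ge0.
by rewrite -expr2; move: h5 h4; clear; move: (rnorm z) => x; lra.
Qed.

Lemma closed_tube_compact X r2 (B : R) : (forall x, closure X x -> e2 x <= B) -> compact (closed_tube X r2).
Proof.
move=> HB; apply: (@closed_bounded_compact _ _ _ (B + r2 + 1)); first exact: closed_tube_closed.
by move=> z; exact: closed_tube_bounded.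
Qed.

(** What the argument uses of the data, r2 being the squared radius of the ball Y. The real
    part of g is |x|^2 - (alpha + f) + r2 - |y|^2, so that the special domain is where it
    exceeds r2 - |y|^2. The Hessian condition is b_pos, the absence of the fence over the
    boundary of X is b_edge, and b_slice says that the fence has convex real slices. *)
Record barrier X (r2 : R) (g : V -> C) : Prop := Barrier {
  b_open : open X ;
  b_bound : exists B : R, forall x, closure X x -> e2 x <= B ;
  b_hol : hol setT g ;
  b_pos : forall z, e2 (imV z) < r2 -> forall e, e != 0 -> 0 < complex.Re (Bq (hess g z) (rv e) (rv e)) ;
  b_edge : forall z, closure X (reV z) -> ~ X (reV z) -> e2 (imV z) <= r2 ->
    r2 - e2 (imV z) < complex.Re (g z) ;
  b_slice : slice_convex (open_tube X r2 `\` [set z | open_tube X r2 z /\ r2 - e2 (imV z) < complex.Re (g z)]) }.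

Definition core_domain X (r2 : R) (g : V -> C) : set V :=
  [set z | open_tube X r2 z /\ r2 - e2 (imV z) < complex.Re (g z)].
Definition hull_domain X (r2 : R) (g : V -> C) : set V :=
  [set z | open_tube X r2 z /\ 0 < complex.Re (g z)].

(** The convexity of the slices of the complement is both what local_step needs and what it
    preserves, so it is part of the induction. *)
Definition partial_extension X r2 g (h : V -> C) (p : set V * (V -> C)) : Prop :=
  (open p.1 /\ hol p.1 p.2) /\ (core_domain X r2 g `<=` p.1 /\ p.1 `<=` open_tube X r2) /\
  slice_convex (open_tube X r2 `\` p.1) /\ (forall z, core_domain X r2 g z -> p.2 z = h z).

Lemma Reg_cont (g : V -> C) z : hol setT g -> {for z, continuous (fun z => complex.Re (g z))}.
Proof. by move=> hg; apply: Re_comp_cont; apply: differentiable_continuous; exact: hg. Qed.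

Lemma core_domain_open X r2 (g : V -> C) : barrier X r2 g -> open (core_domain X r2 g).
Proof.
move=> [oX _ hg _ _ _].
have -> : core_domain X r2 g = open_tube X r2 `&` [set z | r2 < complex.Re (g z) + e2 (imV z)].
  by apply/seteqP; split => z [Dz h]; split => //; move: h; rewrite /= ltrBlDr.
apply: openI; first exact: open_tube_open.
by apply: open_superlevel => z; apply: contRD; [exact: Reg_cont|exact: e2im_cont].
Qed.

Lemma hull_domain_open X r2 (g : V -> C) : barrier X r2 g -> open (hull_domain X r2 g).
Proof.
move=> [oX _ hg _ _ _]; apply: openI; first exact: open_tube_open.
by apply: open_superlevel => z; exact: Reg_cont.
Qed.

(** With ep small, a maximum of Re g + ep N2 on the rest of the tube is at a point where Re
    g > 0. This excludes |y|^2 = r2, because a point outside S has Re g + |y|^2 <= r2, and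
    b_edge excludes the boundary of X. So the maximum is in the open tube, and local_step
    applies to the model given by model_at_max and model_real_gradient. *)
Lemma extend_once X r2 g h U (k : V -> C) z1 : (1 < n)%N -> barrier X r2 g ->
  partial_extension X r2 g h (U, k) -> hull_domain X r2 g z1 -> ~ U z1 ->
  exists U' k', [/\ partial_extension X r2 g h (U', k'), U `<=` U', ~ (U' `<=` U) & forall z, U z -> k' z = k z].
Proof.
move=> n1 [oX [B HB] hg hp he _] [[/= oU hU] [[SU UD] [cA kh]]] [Dz1 gz1] nUz1.
pose Bt := B + r2; have Bt0 : 0 <= Bt.
  have [cz1 yz1] : closed_tube X r2 z1 by case: Dz1 => h1 h2; split; [exact: subset_closure|exact: ltW].
  by apply: addr_ge0; [apply: le_trans (HB _ cz1)|apply: le_trans yz1]; exact: e2_ge0.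
have N2B z : closed_tube X r2 z -> N2 z <= Bt.
  by move=> [h1 h2]; rewrite N2E; apply: lerD => //; exact: HB.
pose m0 := complex.Re (g z1).
have B1 : 0 < Bt + 1 by rewrite ltr_wpDl.
(* so small that ep N2 < m0 on the tube: where Re g + ep N2 >= m0, Re g is positive *)
pose ep := m0 / 2 / (Bt + 1).
have ep0 : 0 < ep by rewrite !divr_gt0.
have epB z : closed_tube X r2 z -> ep * N2 z < m0.
  move=> /N2B hz; have h1 : ep * (Bt + 1) = m0 / 2 by rewrite /ep divfK // lt0r_neq0.
  have h2 : ep * N2 z <= ep * Bt by rewrite ler_wpM2l // ltW.
  apply: le_lt_trans h2 _; rewrite mulrDr mulr1 in h1.
  apply: (@lt_trans _ _ (m0 / 2)); first by rewrite -h1 ltrDl.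
  by rewrite ltr_pdivrMr // ltr_pMr // ltr1n.
pose Th z := complex.Re (g z) + ep * N2 z.
have cTh z : {for z, continuous Th}.
  apply: contRD; first exact: Reg_cont.
  by apply: contRM; [exact: contR_cst|exact: N2_cont].
(* this compact set contains the points of D \ U where Re g + ep N2 >= m0; the condition Re
   g + |y|^2 <= r2 holds outside S and is kept in the limit, to exclude |y|^2 = r2 *)
pose Am := closed_tube X r2 `&` (~` U `&` ([set z | complex.Re (g z) + e2 (imV z) <=
  r2] `&` [set z | - Th z <= - m0])).
have cAm : compact Am.
  apply: compact_closedI; first exact: (closed_tube_compact HB).
  apply: closedI; first exact: open_closedC.
  apply: closedI; apply: closed_sublevel => z.
    by apply: contRD; [exact: Reg_cont|exact: e2im_cont].
  by apply: contRN; exact: cTh.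
have notS z : open_tube X r2 z -> ~ U z -> complex.Re (g z) + e2 (imV z) <= r2.
  move=> Dz nUz; rewrite leNgt; apply/negP => hz; apply: nUz; apply: SU; split => //.
  by rewrite ltrBlDr.
have DC z : open_tube X r2 z -> closed_tube X r2 z.
  by case=> h1 h2; split; [exact: subset_closure|exact: ltW].
have Am1 : Am z1.
  split; first exact: DC.
  split; first exact: nUz1.
  split; first exact: notS.
  by rewrite /mkset lerN2 lerDl mulr_ge0 ?N2_ge0 // ltW.
have [z0 [Cz0 [nUz0 [gz0 mz0]]] zmax] := max_on (ex_intro _ z1 Am1) cAm cTh.
rewrite /mkset in gz0; rewrite /mkset lerN2 in mz0.
have g0 : 0 < complex.Re (g z0).
  by have := lt_le_trans (epB _ Cz0) mz0; rewrite /Th ltrDr.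
have Dz0 : open_tube X r2 z0.
  case: (Cz0) => c1 c2; split; last first.
    by move: gz0 g0; move: (complex.Re _) (e2 _) => a b; clear; lra.
  apply: contrapT => nX; have := he _ c1 nX c2.
  by move: gz0; move: (complex.Re _) (e2 _) => a b; clear; lra.
pose A := open_tube X r2 `\` U.
have Amax z : A z -> Th z <= Th z0.
  move=> [Dz nUz]; have [hm|hm] := leP m0 (Th z).
    apply: zmax; split; first exact: DC.
    split; first exact: nUz.
    split; first exact: notS.
    by rewrite /mkset lerN2.
  by apply: le_trans (ltW hm) _.
have [r1 r10 Ht] := model_at_max openT hg I ep0 Amax.
have /near_rnormP[rD rD0 HD] : \forall z \near z0, open_tube X r2 z.
  by apply: open_nbhs_nbhs; split => //; exact: open_tube_open.
pose r := Num.min r1 rD / 2.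
have r0 : 0 < r by rewrite divr_gt0 // lt_min r10.
have rr : r < r1 /\ r < rD.
  have : Num.min r1 rD <= r1 by rewrite ge_min lexx.
  have : Num.min r1 rD <= rD by rewrite ge_min lexx orbT.
  by move: r0; rewrite /r; move: (Num.min _ _) => x; clear; split; lra.
have [rr1 rrD] := rr.
have Dr v : rnorm v <= r -> open_tube X r2 (z0 + v).
  by move=> vr; apply: HD; rewrite shift_sub; apply: le_lt_trans rrD.
pose Av := [set v | ~ U (z0 + v)].
have cAv : compact (Av `&` [set v | rnorm v <= r]).
  rewrite setIC; apply: compact_closedI; first exact: ball_compact.
  have c1 : forall v : V, {for v, continuous (fun v : V => z0 + v)}.
    by move=> v; apply: contVD; [exact: contV_cst|exact: contV_id].
  have -> : Av = ~` ((fun v : V => z0 + v) @^-1` U) by [].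
  by apply: open_closedC; apply: open_comp => // v _; exact: c1.
have Av0 : Av 0 by rewrite /Av /mkset addr0.
have HA v : rnorm v <= r -> Av v ->
  qf (ep / 2) (touch_grad ep g z0) (2^-1 *: hess g z0) v <= - (ep / 4 * rnorm v ^+ 2).
  by move=> vr nU; apply: Ht; [apply: le_lt_trans rr1|split => //; exact: Dr].
have Hp e : e != 0 -> 0 < complex.Re (Bq (2^-1 *: hess g z0) (rv e) (rv e)).
  move=> e0; rewrite BqMl; have -> : (2^-1 : C) = rc 2^-1 by rewrite fmorphV rmorph_nat.
  by rewrite ReMrc mulr_gt0 ?invr_gt0 ?ltr0n //; apply: hp => //; case: Dz0.
have e20 : 0 < ep / 2 by rewrite divr_gt0.
have e40 : 0 < ep / 4 by rewrite divr_gt0.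
have [v0 [b' [de' [nU0 v0r de0 bj Hq]]]] := model_real_gradient n1 e20 r0 e40 cAv Av0 HA Hp.
pose r' := r - rnorm v0.
have r'0 : 0 < r' by rewrite subr_gt0.
have vr' w : rnorm w < r' -> rnorm (v0 + w) <= r.
  by move=> wr; apply: le_trans (rnormD _ _) _; move: wr; rewrite /r' ltrBrDl => /ltW.
have e22 : 0 < ep / 2 / 2 by rewrite divr_gt0.
have q2 e : 0 <= qf (ep / 2 / 2) 0 (2^-1 *: hess g z0) (rv e).
  have [->|e0] := eqVneq e 0.
    by have -> : rv (0 : E) = 0 :> V; [apply/eqP; rewrite rv_eq0|rewrite qf0].
  by apply: ltW; apply: Re_ge0_pos; [exact: ltW|exact: e0|exact: Hp].
have Dw w : rnorm w < r' -> open_tube X r2 (z0 + v0 + w).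
  by move=> /vr' h1; rewrite -addrA; exact: Dr.
have qw w : rnorm w < r' -> ~ U (z0 + v0 + w) -> qf (ep / 2 / 2) b' (2^-1 *: hess g z0) w <= - (de' * rnorm w ^+ 2).
  by move=> /vr' h1; rewrite -addrA => h2; exact: Hq.
have [U' [k' [[oU' hU' UU' UD' U'z] [cU' kk']]]] := local_step n1 e22 r'0 de0 oU hU UD Dw cA qw bj q2.
exists U', k'; split => //.
- split; first by split.
  split; first by split => // z /SU /UU'.
  by split => // z Sz /=; rewrite kk' ?kh //; exact: SU.
- by move=> /(_ _ U'z).
Qed.

(** Zorn's lemma for partial extensions: the union of a chain is a partial extension, and a
    maximal one covers the hull domain by extend_once. *)
Theorem extension X r2 g h : (1 < n)%N -> barrier X r2 g -> hol (core_domain X r2 g) h ->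
  exists2 k, hol (hull_domain X r2 g) k & forall z, core_domain X r2 g z -> k z = h z.
Proof.
move=> n1 bg hh; pose D := open_tube X r2; pose S := core_domain X r2 g.
have oS : open S by exact: core_domain_open.
pose T := {p : set V * (V -> C) | partial_extension X r2 g h p}.
have p0 : partial_extension X r2 g h (S, h).
  split; first by split.
  split; first by split => // z [].
  by split; [exact: b_slice bg|].
pose le (s t : T) : bool := `[< (sval s).1 `<=` (sval t).1 /\ forall z, (sval s).1 z ->
  (sval t).2 z = (sval s).2 z >].
have [t tmax] : exists t, premaximal le t.
  apply: (@ZL_preorder T (exist _ _ p0)).
  - by move=> t; apply/asboolP; split.
  - move=> r s t /asboolP[h1 h2] /asboolP[h3 h4]; apply/asboolP; split.
      by move=> z /h1 /h3.
    by move=> z rz; rewrite h4 ?h2 //; exact: h1.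
  - move=> A tot.
    have [[t0 At0]|nA] := pselect (A !=set0); last first.
      by exists (exist _ _ p0) => s As; exfalso; apply: nA; exists s.
    pose W := [set z | exists2 t, A t & (sval t).1 z].
    pose k z := if pselect (exists2 t, A t & (sval t).1 z) is left H then (sval (s2val (cid2 H))).2 z else 0.
    have kE s z : A s -> (sval s).1 z -> k z = (sval s).2 z.
      move=> As sz; rewrite /k; case: pselect => [H|]; last by case; exists s.
      case: (cid2 H) => t At tz /=.
      by have [/asboolP[_ ->]|/asboolP[_ ->]] := tot _ _ At As.
    have pW : partial_extension X r2 g h (W, k).
      have [[oU0 hU0] [[SU0 U0D] [c0 k0]]] := svalP t0.
      split; first split.
      + have -> : (W, k).1 = \bigcup_(t in A) (sval t).1.
          by apply/seteqP; split => z [t At tz]; exists t.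
        by apply: bigcup_open => t At; have [[]] := svalP t.
      + move=> z [s As sz]; have [[os hs] _] := svalP s.
        have Hn : \forall w \near z, k w = (sval s).2 w.
          have : nbhs z (sval s).1 by apply: open_nbhs_nbhs; split.
          by apply: filterS => w sw; exact: kE.
        by have [] := diff_near_eq Hn (hs z sz).
      split; first split.
      + by move=> z /SU0 hz; exists t0.
      + by move=> z [s As sz]; have [_ [[_ sD] _]] := svalP s; exact: sD.
      split; last by move=> z Sz /=; rewrite (kE _ _ At0 (SU0 _ Sz)) k0.
      move=> z e s1 s2 s10 s20 [D1 W1] [D2 W2].
      have out s : A s -> (open_tube X r2 `\` (sval s).1) z.
        move=> As; have [_ [_ [cs _]]] := svalP s.
        have n1' : ~ (sval s).1 (z + rc s1 *: rv e) by move=> hz; apply: W1; exists s.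
        have n2' : ~ (sval s).1 (z + rc s2 *: rv (- e)) by move=> hz; apply: W2; exists s.
        exact: (cs z e s1 s2 s10 s20 (conj D1 n1') (conj D2 n2')).
      split; first by have [] := out _ At0.
      by move=> [s As sz]; have [_] := out _ As.
    exists (exist _ _ pW) => s As; apply/asboolP; split.
      by move=> z sz; exists s.
    by move=> z sz; exact: kE.
have pt := svalP t; case: t tmax pt => [[U k] /= pU] tmax _.
have HU : hull_domain X r2 g `<=` U.
  move=> z Dz; apply: contrapT => nUz.
  have [U' [k' [p' UU' nU'U kk']]] := extend_once n1 bg pU Dz nUz.
  have /tmax/asboolP[/=] : le (exist _ _ pU) (exist _ _ p') by apply/asboolP; split.
  by move=> /nU'U.
have [[_ hU] [_ [_ kh]]] := pU.
by exists k => // z /HU; exact: hU.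
Qed.

End Extension.

(** * Polynomial approximation of entire functions *)

Section Polynomials.
Variables (R : realType) (n : nat).
Notation C := (Cx R).
Notation rc x := (real_complex R x : Cx R).
Notation V := 'rV[C]_n.
Notation mpoly := (mpoly.mpoly n C).
Implicit Types (u v w z b : V) (h : V -> C) (p : mpoly).

Definition peval p : V -> C := fun z => mpoly.meval (fun j => z 0 j) p.

Lemma hol_cst (U : set V) (c : C) : hol U (fun=> c).
Proof. by move=> z _; exact: differentiable_cst. Qed.
Lemma hol_add (U : set V) h1 h2 : hol U h1 -> hol U h2 -> hol U (fun z => h1 z + h2 z).
Proof. by move=> H1 H2 z Uz; apply: differentiableD; [exact: H1|exact: H2]. Qed.
Lemma hol_mul (U : set V) h1 h2 : hol U h1 -> hol U h2 -> hol U (fun z => h1 z * h2 z).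
Proof. by move=> H1 H2 z Uz; apply: differentiableM; [exact: H1|exact: H2]. Qed.
Lemma hol_inv (U : set V) h : hol U h -> (forall z, U z -> h z != 0) -> hol U (fun z => (h z)^-1).
Proof. by move=> H1 H2 z Uz; apply: differentiableV; [exact: H1|exact: H2]. Qed.
Lemma hol_coord (U : set V) j : hol U (fun z => z 0 j).
Proof. by move=> z _; exact: differentiable_coord. Qed.

Lemma hol_sum (U : set V) (I : Type) (r : seq I) (f : I -> V -> C) : (forall i, hol U (f i)) ->
  hol U (fun z => \sum_(i <- r) f i z).
Proof.
move=> hf; elim: r => [|i r IH].
  have -> : (fun z : V => \sum_(i <- [::]) f i z) = (fun=> 0) by apply/funext => y; rewrite big_nil.
  exact: hol_cst.
have -> : (fun z : V => \sum_(i <- i :: r) f i z) = (fun z => f i z + \sum_(i <- r) f i z).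
  by apply/funext => y; rewrite big_cons.
exact: hol_add.
Qed.

Lemma hol_prod (U : set V) (I : Type) (r : seq I) (f : I -> V -> C) : (forall i, hol U (f i)) ->
  hol U (fun z => \prod_(i <- r) f i z).
Proof.
move=> hf; elim: r => [|i r IH].
  have -> : (fun z : V => \prod_(i <- [::]) f i z) = (fun=> 1) by apply/funext => y; rewrite big_nil.
  exact: hol_cst.
have -> : (fun z : V => \prod_(i <- i :: r) f i z) = (fun z => f i z * \prod_(i <- r) f i z).
  by apply/funext => y; rewrite big_cons.
exact: hol_mul.
Qed.

Lemma hol_exp (U : set V) h k : hol U h -> hol U (fun z => h z ^+ k).
Proof.
move=> hh; elim: k => [|k IH].
  have -> : (fun z : V => h z ^+ 0) = (fun=> 1) by apply/funext => y; rewrite expr0.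
  exact: hol_cst.
have -> : (fun z : V => h z ^+ k.+1) = (fun z => h z * h z ^+ k).
  by apply/funext => y; rewrite exprS.
exact: hol_mul.
Qed.

Lemma hol_peval (U : set V) p : hol U (peval p).
Proof.
have -> : peval p = fun z => \sum_(m <- mpoly.msupp p) mpoly.mcoeff m p * \prod_(i < n) z 0 i ^+
  mpoly.fun_of_multinom m i.
  by apply/funext => z; rewrite /peval mpoly.mevalE.
apply: hol_sum => m; apply: hol_mul; first exact: hol_cst.
by apply: hol_prod => i; apply: hol_exp; exact: hol_coord.
Qed.

(** The k-th homogeneous Taylor polynomial at 0 in the variable 2 z, obtained from those of
    the partial derivatives by Euler's identity. The factor 2 puts z at the parameter 1/2 of
    the line through 2 z, where Taylor's formula converges. *)
Fixpoint taylor_mpoly (k : nat) (h : V -> C) : mpoly :=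
  if k is k'.+1 then
    mpoly.mpolyC n (k'.+1%:R^-1 : C) *
      \sum_(j < n) (mpoly.mpolyC n (2 : C) * mpoly.mpolyX C (mpoly.mnm1 j)) * taylor_mpoly k' (pd h j)
  else mpoly.mpolyC n (h 0).

Lemma line_coef_sum (I : Type) (r : seq I) (c : I -> C) (f : I -> V -> C) v k :
  (forall i, hol setT (f i)) ->
  line_coef (fun z => \sum_(i <- r) c i * f i z) 0 v k = \sum_(i <- r) c i * line_coef (f i) 0 v k.
Proof.
move=> hf; elim: r => [|i r IH].
  rewrite big_nil /line_coef /taylor_coef -[RHS](mul0r (cauchy_int (fun t : C => 0))) -cauchy_intZ; last
    by move=> t _; exact: contC_cst.
  by congr cauchy_int; apply/funext => t; rewrite big_nil !mul0r.
have ch g : hol setT g -> square_cont (fun t : C => g (0 + t *: v) * (t ^+ k.+1)^-1).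
  by move=> hg; apply: line_coef_cont => t _; exact: hg.
have h2 : hol setT (fun z => \sum_(i <- r) c i * f i z).
  by apply: hol_sum => i'; apply: hol_mul; [exact: hol_cst|exact: hf].
rewrite big_cons -IH /line_coef /taylor_coef -(cauchy_intZ _ (ch _ (hf i))) -cauchy_intD.
- by congr cauchy_int; apply/funext => t; rewrite big_cons mulrDl mulrA.
- by move=> t ht; apply: contCM; [exact: contC_cst|exact: ch].
- exact: (ch _ h2).
Qed.

Lemma taylor_mpolyE k h v : hol setT h -> peval (taylor_mpoly k h) v = line_coef h 0 (2 *: v) k.
Proof.
elim: k h => [|k IH] h hh.
  by rewrite /peval mpoly.mevalC line_coef0 // => t _; exact: hh.
rewrite /peval /= mpoly.mevalM mpoly.mevalC.
have k0 : (k.+1%:R : C) != 0 by rewrite pnatr_eq0.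
apply: (mulfI k0); rewrite mulVKf // -(line_coefS k openT hh) //.
have -> : (fun z => 'd h z (2 *: v)) = fun z => \sum_(j < n) (2 * v 0 j) * pd h j z.
  by apply/funext => z; rewrite diff_pd; apply: eq_bigr => j _; rewrite mxE.
rewrite line_coef_sum; last by move=> j; exact: pd_hol openT hh.
rewrite (raddf_sum (mpoly.meval (fun j => v 0 j))) /=; apply: eq_bigr => j _.
by rewrite !mpoly.mevalM mpoly.mevalC mpoly.mevalXU -IH //; exact: pd_hol openT hh.
Qed.

Lemma hol_rnorm_cont (h : V -> C) v : hol setT h -> {for v, continuous (fun v => rnorm (h v))}.
Proof.
move=> hh; apply/continuous_normP => e e0; have /continuous_rnormP/(_ _ e0) := differentiable_continuous (hh v I).
apply: filterS => w hw; apply: le_lt_trans hw; rewrite ler_norml; apply/andP; split.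
  by have := rnorm_triB (V := C) (h v) (h w); rewrite rnorm_distC lerNl opprB lerBlDr.
by have := rnorm_triB (V := C) (h w) (h v); rewrite lerBlDr.
Qed.

Lemma ball_bounded (B : R) h : hol setT h -> exists2 K : R, 0 <= K & forall v, rnorm v <= B -> rnorm (h v) <= K.
Proof.
move=> hh; have [B0|B0] := ltP B 0.
  by exists 0 => // v vB; have := rnorm_ge0 v; move: (le_lt_trans vB B0) => /lt_geF ->.
have c1 v := @hol_rnorm_cont h v hh.
have ne : [set v : V | rnorm v <= B] !=set0 by exists 0; rewrite /mkset rnorm0.
have [c _ cm] := max_on ne (@ball_compact _ _ B) c1.
by exists (rnorm (h c)); [exact: rnorm_ge0|exact: cm].
Qed.

(** The remainder of Taylor's formula at the parameter 1/2 is at most a multiple of 2^-N,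
    uniformly on the ball. *)
Lemma polynomial_approximation h (B eta : R) : hol setT h -> 0 < eta ->
  exists p, forall z, rnorm z <= B -> rnorm (peval p z - h z) <= eta.
Proof.
move=> hh e0; have [K K0 HK] := ball_bounded (2 * (2 * B)) hh.
pose A := 2 * cauchy_cst R * K.
have A0 : 0 <= A by rewrite /A mulr_ge0 // mulr_ge0 // cauchy_cst_ge0.
have [N HN] : exists N : nat, A <= eta * 2 ^+ N.
  exists (Num.bound (A / eta)); have h1 := archi_boundP (divr_ge0 A0 (ltW e0)).
  rewrite mulrC -ler_pdivrMr //; apply: le_trans (ltW h1) _.
  by rewrite -natrX ler_nat ltnW // ltn_expl.
have n2 : rnorm (2 : C) = 2.
  have -> : (2 : C) = rc 2 by rewrite rmorph_nat.
  by rewrite rnorm_rc ger0_norm.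
exists (\sum_(k < N) mpoly.mpolyC n ((2^-1 : C) ^+ k) * taylor_mpoly k h) => z zB.
have hl : disc_differentiable h 0 (2 *: z) by move=> t _; exact: hh.
have hB (t : C) : rnorm t <= 2 -> rnorm (h (0 + t *: (2 *: z))) <= K.
  move=> t2; apply: HK; rewrite add0r !rnormZ n2.
  by apply: ler_pM => //; rewrite ?rnorm_ge0 ?mulr_ge0 ?rnorm_ge0 // ler_wpM2l.
have n2' : rnorm (2^-1 : C) = 2^-1 by rewrite rnormV n2.
have := line_taylor N hl hB (w := 2^-1); rewrite n2' => /(_ (lexx _)).
have -> : 0 + (2^-1 : C) *: (2 *: z) = z.
  by rewrite add0r scalerA mulVf ?pnatr_eq0 // scale1r.
rewrite rnorm_distC; have -> : \sum_(k < N) line_coef h 0 (2 *: z) k * 2^-1 ^+ k =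
  peval (\sum_(k < N) mpoly.mpolyC n ((2^-1 : C) ^+ k) * taylor_mpoly k h) z.
  rewrite /peval (raddf_sum (mpoly.meval (fun j => z 0 j))) /=; apply: eq_bigr => k _.
  by rewrite mpoly.mevalM mpoly.mevalC -(taylor_mpolyE k z hh) mulrC.
move/le_trans; apply; rewrite -/A exprVn ler_pdivrMr ?exprn_gt0 //.
Qed.

End Polynomials.

(** * The polynomial hull *)

Section Hull.
Variables (R : realType) (n : nat).
Notation C := (Cx R).
Notation rc x := (real_complex R x : Cx R).
Notation V := 'rV[C]_n.
Notation E := 'rV[R]_n.
Implicit Types (u v w z b : V) (X : set E).

Definition edge X (r2 : R) (g : V -> C) : set V :=
  [set z | X (reV z) /\ e2 (imV z) = r2 /\ complex.Re (g z) <= 0].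

(** If the level set of g through w1 were below a quadratic model near w1, local_extension
    would extend 1 / (g - g w1) to a neighbourhood of w1. The product with g - g w1 would be
    1 there, but it is 0 at w1. *)
Lemma inverse_blocked (g : V -> C) ka b M w1 (r de : R) : (1 < n)%N -> hol setT g -> 0 < ka -> 0 < r ->
  b != 0 -> 0 < de ->
  (forall w, rnorm w < r -> g (w1 + w) = g w1 -> qf ka b M w <= - (de * rnorm w ^+ 2)) -> False.
Proof.
move=> n1 hg ka0 r0 b0 de0 Hq.
pose U := [set z | g z - g w1 != 0].
have hgc : hol setT (fun z => g z - g w1) by apply: hol_add => //; exact: hol_cst.
have oU : open U.
  have -> : U = [set z | 0 < rnorm (g z - g w1)].
    by apply/seteqP; split => z; rewrite /U /mkset rnorm_gt0.
  apply: open_superlevel => z; exact: (@hol_rnorm_cont R n (fun z => g z - g w1) z hgc).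
have hU : hol U (fun z => (g z - g w1)^-1).
  by apply: hol_inv => // z _; exact: hgc.
have HU v : rnorm v < r -> 0 < qf ka b M v -> U (w1 + v).
  move=> vr qv; rewrite /U /mkset subr_eq0; apply/eqP => e.
  move: (lt_le_trans qv (Hq v vr e)); apply/negP; rewrite -leNgt oppr_le0.
  by rewrite mulr_ge0 ?sqr_ge0 // ltW.
have [beta [H [be0 hH HE]]] := local_extension n1 ka0 b0 r0 oU hU HU.
have b8 : 0 < Num.min (beta / 8) r by rewrite lt_min r0 divr_gt0.
have [v []] := HE _ b8; rewrite lt_min => /andP[vb vr] qv germ.
pose f z := H z * (g z - g w1) - 1.
have hf u : rnorm (u - (w1 + v)) < beta / 2 -> differentiable f u.
  move=> hu; apply: differentiableB; last exact: differentiable_cst.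
  apply: differentiableM; last exact: hgc.
  apply: hH; rewrite /mkset; have -> : u - w1 = (u - (w1 + v)) + v by rewrite opprD addrA subrK.
  apply: le_lt_trans (rnormD _ _) _; move: hu vb be0; lra_rnorm.
have f0 : \forall u \near w1 + v, f u = 0.
  have : \forall u \near w1 + v, U u.
    by apply: open_nbhs_nbhs; split => //; apply: HU.
  move=> hn; apply: filterS2 hn germ => u Uu; rewrite /f => ->.
  by rewrite mulVf // subrr.
have := @identity_ball _ _ f (w1 + v) (beta / 2) hf f0 w1.
have -> : w1 - (w1 + v) = - v by rewrite opprD addrA subrr add0r.
rewrite rnormN => H0; have : f w1 = 0 by apply: H0; move: vb; lra_rnorm.
by rewrite /f subrr mulr0 sub0r => /eqP; rewrite oppr_eq0 oner_eq0.
Qed.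

(** Makes |P|^2 at least the real part of a holomorphic function, with equality where P has
    the value a. *)
Lemma Re_conj_le (a c : C) : 2 * complex.Re (a^*%C * c) <= rnorm a ^+ 2 + rnorm c ^+ 2.
Proof.
rewrite !rnorm_sqr; case: a c => [a1 a2] [c1 c2] /=.
by have := sqr_ge0 (a1 - c1); have := sqr_ge0 (a2 - c2); rewrite !expr2; lra.
Qed.

(** Suppose that |P| is smaller on the edge than at z0, and maximise |P|^2 + ep N2 over the
    level set of g through z0 in the closed tube. For small ep the maximum is not over |y|^2
    = r2, where the level set is in the edge, and b_edge excludes the boundary of X; so it
    is in the open tube. Replacing |P|^2 by 2 Re (P w0)^* P preserves the maximum; by
    model_at_max the level set is below a quadratic model, which inverse_blocked forbids. *)
Lemma hull_contains_fence X r2 (g P : V -> C) z0 : (1 < n)%N -> barrier X r2 g -> hol setT P ->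
  open_tube X r2 z0 -> complex.Re (g z0) <= 0 -> exists2 w, edge X r2 g w & rnorm (P z0) <= rnorm (P w).
Proof.
move=> n1 [oX [B HB] hg _ he _] hP Dz0 gz0; apply: contrapT => HK.
have {}HK w : edge X r2 g w -> rnorm (P w) < rnorm (P z0).
  by move=> Kw; rewrite ltNge; apply/negP => h; apply: HK; exists w.
pose c := g z0; pose Vc := closed_tube X r2 `&` [set z | rnorm (g z - c) <= 0].
have VcP z : Vc z -> g z = c.
  by move=> [_ h]; apply/eqP; rewrite -subr_eq0 -(rnorm_eq0 (V := C)) eq_le rnorm_ge0 andbT.
have hgc : hol setT (fun z => g z - c) by apply: hol_add => //; exact: hol_cst.
have cVc : compact Vc.
  apply: compact_closedI; first exact: (closed_tube_compact HB).
  have c1 : forall z : V, {for z, continuous (fun z : V => rnorm (g z - c))}.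
    by move=> z; exact: (@hol_rnorm_cont R n (fun z => g z - c) z hgc).
  exact: closed_sublevel c1.
pose Vb := Vc `&` [set z | - e2 (imV z) <= - r2].
have cVb : compact Vb.
  apply: compact_closedI; first exact: cVc.
  have c1 : forall z : V, {for z, continuous (fun z : V => - e2 (imV z))}.
    by move=> z; apply: contRN; exact: e2im_cont.
  exact: closed_sublevel c1.
have inX z : Vc z -> X (reV z).
  move=> Vz; apply: contrapT => nX; case: (Vz) => [[h1 h2] _].
  have := he z h1 nX h2; rewrite (VcP z Vz); move: h2 gz0; rewrite -/c.
  by move: (e2 _) (complex.Re _) => a b; clear; lra.
have VbK z : Vb z -> edge X r2 g z.
  move=> [Vz]; rewrite /mkset lerN2 => h; split; first exact: inX.
  split; last by rewrite (VcP z Vz).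
  by apply/eqP; rewrite eq_le h andbT; case: Vz => [[]].
have DC : closed_tube X r2 z0 by case: Dz0 => h1 h2; split; [exact: subset_closure|exact: ltW].
have Vz0 : Vc z0 by split => //; rewrite /mkset subrr rnorm0.
have cP v : {for v, continuous (fun v => rnorm (P v) ^+ 2)}.
  have c1 := @hol_rnorm_cont R n P v hP; exact: (contRM c1 c1).
have [eta e0 Heta] : exists2 eta : R, 0 < eta & forall w, Vb w -> rnorm (P w) ^+ 2 + eta <= rnorm (P z0) ^+ 2.
  have [ne|ne] := pselect (Vb !=set0); last first.
    by exists 1 => // w Vw; exfalso; apply: ne; exists w.
  have [w1 Vw1 wmax] := max_on ne cVb cP.
  exists (rnorm (P z0) ^+ 2 - rnorm (P w1) ^+ 2).
    by rewrite subr_gt0 ltr_pXn2r ?nnegrE ?rnorm_ge0 //; apply: HK; exact: VbK.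
  by move=> w Vw; rewrite addrCA gerDl subr_le0; exact: wmax.
pose Bt := B + r2.
have Bt0 : 0 <= Bt.
  by case: DC => h1 h2; apply: addr_ge0; [apply: le_trans (HB _ h1)|apply: le_trans h2]; exact: e2_ge0.
have B1 : 0 < Bt + 1 by rewrite ltr_wpDl.
(* so small that adding ep N2 does not raise any point of Vb to the level of z0 *)
pose ep := eta / (Bt + 1).
have ep0 : 0 < ep by rewrite divr_gt0.
have epB z : closed_tube X r2 z -> ep * N2 z < eta.
  move=> [h1 h2]; rewrite /ep mulrAC ltr_pdivrMr // ltr_pM2l //.
  rewrite N2E; apply: (@le_lt_trans _ _ Bt); last by rewrite ltrDl.
  by apply: lerD => //; exact: HB.
pose Ph z := rnorm (P z) ^+ 2 + ep * N2 z.
have cPh z : {for z, continuous Ph}.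
  apply: contRD; first exact: cP.
  by apply: contRM; [exact: contR_cst|exact: N2_cont].
have [w0 Vw0 wmax] := max_on (ex_intro _ z0 Vz0) cVc cPh.
have Dw0 : open_tube X r2 w0.
  split; first exact: inX.
  rewrite ltNge; apply/negP => h.
  have Vbw : Vb w0 by split => //; rewrite /mkset lerN2.
  have := Heta _ Vbw; have := wmax _ Vz0; rewrite /Ph.
  have [Cw0 _] := Vw0; have := epB _ Cw0; have : 0 <= ep * N2 z0 by rewrite mulr_ge0 ?N2_ge0 // ltW.
  move: (ep * N2 z0) (ep * N2 w0) (rnorm _ ^+ 2) (rnorm _ ^+ 2) => a1 a2 a3 a4; clear.
  by move=> *; lra.
pose h z := 2 * ((P w0)^*%C * P z).
have hh : hol setT h by do 2 (apply: hol_mul; first exact: hol_cst).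
have Reh z : complex.Re (h z) = 2 * complex.Re ((P w0)^*%C * P z).
  by rewrite /h (_ : (2 : C) = rc 2) ?ReMrc // rmorph_nat.
have Reh0 : complex.Re (h w0) = 2 * rnorm (P w0) ^+ 2.
  by rewrite Reh rnorm_sqr; case: (P w0) => a1 a2 /=; ring.
have Hmax z : Vc z -> complex.Re (h z) + ep * N2 z <= complex.Re (h w0) + ep * N2 w0.
  move=> Vz; rewrite Reh0 Reh; have := Re_conj_le (P w0) (P z); have := wmax _ Vz; rewrite /Ph.
  move: (2 * complex.Re _) (rnorm (P z) ^+ 2) (rnorm _ ^+ 2) (ep * N2 z) (ep * N2 w0) => a1 a2 a3 a4 a5.
  by clear; lra.
have [r1 r10 Ht] := model_at_max openT hh I ep0 Hmax.
have /near_rnormP[rD rD0 HD] : \forall z \near w0, open_tube X r2 z.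
  by apply: open_nbhs_nbhs; split => //; exact: open_tube_open.
pose r := Num.min r1 rD / 2.
have m0 : 0 < Num.min r1 rD by rewrite lt_min r10.
have r0 : 0 < r by rewrite divr_gt0.
have rm : r < Num.min r1 rD by rewrite ltr_pdivrMr // ltr_pMr // ltr1n.
have rr1 : r < r1 by apply: lt_le_trans rm _; rewrite ge_min lexx.
have rrD : r < rD by apply: lt_le_trans rm _; rewrite ge_min lexx orbT.
pose Av := [set v : V | rnorm (g (w0 + v) - c) <= 0].
have AvP v : Av v <-> g (w0 + v) = c.
  split=> [h1|h1]; last by rewrite /Av /mkset h1 subrr rnorm0.
  by apply/eqP; rewrite -subr_eq0 -(rnorm_eq0 (V := C)) eq_le rnorm_ge0 andbT.
have cAv : compact (Av `&` [set v | rnorm v <= r]).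
  rewrite setIC; apply: compact_closedI; first exact: ball_compact.
  have c1 : forall v : V, {for v, continuous (fun v : V => rnorm (g (w0 + v) - c))}.
    move=> v; have c2 : {for v, continuous (fun v : V => w0 + v)} by apply: contVD;
      [exact: contV_cst|exact: contV_id].
    exact: (continuous_comp c2 (@hol_rnorm_cont R n (fun z => g z - c) _ hgc)).
  exact: closed_sublevel c1.
have Av0 : Av 0 by apply/AvP; rewrite addr0 (VcP w0 Vw0).
have HA v : rnorm v <= r -> Av v ->
  qf (ep / 2) (touch_grad ep h w0) (2^-1 *: hess h w0) v <= - (ep / 4 * rnorm v ^+ 2).
  move=> vr /AvP gv; apply: Ht; first exact: le_lt_trans rr1.
  split; last by rewrite /mkset gv subrr rnorm0.
  have [h1 h2] : open_tube X r2 (w0 + v) by apply: HD; rewrite shift_sub; apply: le_lt_trans rrD.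
  by split; [exact: subset_closure|exact: ltW].
have e20 : 0 < ep / 2 by rewrite divr_gt0.
have e40 : 0 < ep / 4 by rewrite divr_gt0.
have [v0 [b' [de' [Av0' v0r de0 b'0 Hq]]]] := model_nonzero_gradient n1 e20 r0 e40 cAv Av0 HA.
have r'0 : 0 < r - rnorm v0 by rewrite subr_gt0.
have e22 : 0 < ep / 2 / 2 by rewrite divr_gt0.
apply: (@inverse_blocked g _ _ _ (w0 + v0) _ _ n1 hg e22 r'0 b'0 de0 _) => w wr gw.
apply: Hq; first by apply/AvP; rewrite addrA gw; exact/AvP.
by apply: le_trans (rnormD _ _) _; rewrite ltrBrDl in wr; exact: ltW.
Qed.

(** On the edge Re g <= 0 < Re g z0. For a large real L the modulus of L + g is close to L +
    Re g, hence larger at z0 than on the edge, and a polynomial close to g has the same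
    property. *)
Lemma hull_avoids X r2 (g : V -> C) z0 : barrier X r2 g -> open_tube X r2 z0 -> 0 < complex.Re (g z0) ->
  exists p, forall w, edge X r2 g w -> rnorm (peval p w) < rnorm (peval p z0).
Proof.
move=> [oX [B HB] hg _ he _] Dz0 gz0.
pose Bt := Num.max (B + r2 + 1) 0.
have bd w : closed_tube X r2 w -> rnorm w <= Bt.
  by move=> hw; apply: le_trans (closed_tube_bounded HB hw) _; rewrite le_max lexx.
have bz0 : rnorm z0 <= Bt.
  by apply: bd; case: Dz0 => h1 h2; split; [exact: subset_closure|exact: ltW].
pose m := complex.Re (g z0); pose eta := m / 5.
have eta0 : 0 < eta by rewrite divr_gt0.
have m5 : m = 5 * eta by rewrite /eta; field.
clearbody eta.
have [p Hp] := polynomial_approximation Bt hg eta0.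
have [G G0 HG] := ball_bounded Bt hg.
(* L eta >= G^2 makes the imaginary part of g negligible in the modulus of L + g *)
pose L := G + G ^+ 2 / eta + 1.
have Gq0 : 0 <= G ^+ 2 / eta by rewrite divr_ge0 ?sqr_ge0 // ltW.
have L0 : 0 < L by rewrite ltr_wpDl // addr_ge0.
exists (mpoly.mpolyC n (rc L) + p) => w [Xw [ew gw]].
have bw : rnorm w <= Bt by apply: bd; split; [exact: subset_closure|rewrite ew].
have pE z : peval (mpoly.mpolyC n (rc L) + p) z = (rc L + g z) + (peval p z - g z).
  by rewrite /peval mpoly.mevalD mpoly.mevalC; ring.
rewrite !pE.
have up : rnorm (rc L + g w) <= L + eta.
  rewrite -(@ler_pXn2r _ 2) ?nnegrE ?rnorm_ge0 ?addr_ge0 ?(ltW L0) ?(ltW eta0) // rnorm_sqr.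
  have gG := HG w bw.
  have h1 : complex.Re (g w) ^+ 2 + complex.Im (g w) ^+ 2 <= G ^+ 2.
    by rewrite -rnorm_sqr lerXn2r ?nnegrE ?rnorm_ge0.
  have h2 : G ^+ 2 <= L * eta.
    have -> : G ^+ 2 = G ^+ 2 / eta * eta by rewrite divfK // lt0r_neq0.
    by rewrite ler_wpM2r ?(ltW eta0) // /L; move: G0 Gq0; move: (_ / eta) => x; clear; lra.
  have h3 : L * complex.Re (g w) <= 0 by rewrite mulr_ge0_le0 // ltW.
  move: h1 h2 h3 (sqr_ge0 eta) (ltW (mulr_gt0 L0 eta0)); rewrite CReD CImD /= add0r.
  by rewrite !expr2; move: (complex.Re _) (complex.Im _) (L) (eta) => a b l e; clear; nra.
have low : L + m <= rnorm (rc L + g z0).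
  by apply: le_trans (Re_leN _); rewrite CReD.
have d1 := Hp w bw; have d2 := Hp z0 bz0.
move: d1 d2; move: (peval p w - g w) (peval p z0 - g z0) => x y d1 d2.
have h1 : rnorm (rc L + g w + x) <= rnorm (rc L + g w) + rnorm x by exact: rnormD.
have h2 : rnorm (rc L + g z0) <= rnorm (rc L + g z0 + y) + rnorm y by exact: rnorm_subr.
by move: h1 h2 up low d1 d2 eta0; rewrite m5; lra_rnorm.
Qed.

End Hull.

(** * Twice differentiable boundaries *)

Section RealCalculus.
Variables (R : realType) (n : nat).
Notation E := 'rV[R]_n.
Implicit Types (x y v e p : E) (g r : E -> R) (X : set E).

Lemma enbhsP x (P : E -> Prop) : (\forall y \near x, P y) <->
  exists2 d : R, 0 < d & forall y, (forall j, `|y 0 j - x 0 j| < d) -> P y.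
Proof.
split=> [/nbhs_ballP[d /= d0 H]|[d d0 H]].
  exists d => // y hy; apply: H; split => // i j; rewrite ord1 /ball /= distrC; exact: hy.
apply/nbhs_ballP; exists d => //= y [_ hy]; apply: H => j.
by have := hy 0 j; rewrite /ball /= distrC.
Qed.

Lemma entry_le (x : E) j : `|x 0 j| <= `|x|.
Proof.
have [->|x0] := eqVneq x 0; first by rewrite mxE !normr0.
rewrite [`|x|]mx_normE.
exact: (@le_bigmax_cond _ _ _ _ (0, j) _ (fun i => `|x i.1 i.2|%:nng)).
Qed.

Lemma ecoord_cont j x : {for x, continuous (fun x : E => x 0 j)}.
Proof.
apply/continuous_normP => e e0; apply/enbhsP; exists e => // y; exact.
Qed.

Lemma cont_real_row (T : topologicalType) (f : T -> E) t : (forall j, {for t, continuous (fun t => f t 0 j)}) ->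
  {for t, continuous f}.
Proof.
move=> cf P /enbhsP[d d0 H].
have : \forall s \near t, forall j, `|f s 0 j - f t 0 j| < d.
  by apply: filter_forall => j; have /continuous_normP := cf j; apply.
by apply: filterS => s; exact: H.
Qed.

Lemma line_is_derive g x v (t : R) : derivable g (x + t *: v) v ->
  is_derive t 1 (fun s : R => g (x + s *: v)) ('D_v g (x + t *: v)).
Proof.
move=> dg; have E : (fun h : R => h^-1 *: (((fun s : R => g (x + s *: v)) \o shift t) (h *: 1) - g (x + t *: v)))
  = (fun h => h^-1 *: ((g \o shift (x + t *: v)) (h *: v) - g (x + t *: v))).
  apply/funext => h; congr (_ *: (g _ - _)); rewrite /= [h%:A]mulr1 scalerDl.
  by rewrite addrCA.
by split; [rewrite /derivable E|rewrite /derive E].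
Qed.

Lemma is_derive_cont (f : R -> R) (t l : R) : is_derive t 1 f l -> {for t, continuous f}.
Proof. by move=> [d _]; apply: differentiable_continuous; apply/derivable1_diffP. Qed.

Lemma mvt_pos (f df : R -> R) (a m e : R) : 0 <= a ->
  (forall t, 0 <= t <= a -> is_derive t 1 f (df t) /\ `|df t - m| <= e) ->
  `|f a - f 0 - m * a| <= e * a.
Proof.
move=> a0 H; have cf : {within `[0, a], continuous f}.
  apply: continuous_in_subspaceT => t; rewrite inE /= in_itv /= => ht.
  by have [h _] := H _ ht; exact: is_derive_cont h.
have [t|c hc E] := @MVT_segment R f df 0 a a0 _ cf.
  by rewrite in_itv /= => /andP[/ltW t0 /ltW ta]; have [|] := H t; rewrite ?t0.
rewrite E subr0 -mulrBl normrM (ger0_norm a0); apply: ler_wpM2r => //.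
by have [|_ h] := H c; first by move: hc; rewrite in_itv.
Qed.

Lemma is_derive_opp (f df : R -> R) (t : R) : is_derive (- t) 1 f (df (- t)) ->
  is_derive t 1 (fun s => f (- s)) (- df (- t)).
Proof.
move=> h; have h1 : is_derive t 1 (fun s : R => - s) (-1) by apply: is_deriveN.
have := is_derive1_comp (f := f) (g := fun s : R => - s) (x := t) (a := df (- t)) (b := -1).
by rewrite mulrN1; apply.
Qed.

Lemma mvt_est (f df : R -> R) (a m e : R) :
  (forall t : R, `|t| <= `|a| -> is_derive t 1 f (df t) /\ `|df t - m| <= e) ->
  `|f a - f 0 - m * a| <= e * `|a|.
Proof.
move=> H; have [a0|a0] := leP 0 a.
  rewrite (ger0_norm a0); apply: (@mvt_pos f df a m e a0) => t /andP[t0 ta].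
  by apply: H; rewrite !ger0_norm.
have a1 : 0 <= - a by rewrite oppr_ge0 ltW.
have : `|f (- - a) - f (- 0) - - m * - a| <= e * - a.
  apply: (@mvt_pos (fun s => f (- s)) (fun s => - df (- s)) (- a) (- m) e a1) => t /andP[t0 ta].
  have [|h1 h2] := H (- t); first by rewrite normrN (ger0_norm t0) (ltr0_norm a0).
  by split; [exact: is_derive_opp|rewrite -opprD normrN].
by rewrite opprK oppr0 mulrNN (ltr0_norm a0).
Qed.

Definition sgrad g p v : R := \sum_j v 0 j * partial j g p.

(** Change the coordinates one at a time and apply the mean value theorem to each. *)
Lemma C1_expand p g : C1_near p g -> forall e : R, 0 < e ->
  exists2 d : R, 0 < d & forall v, (forall j, `|v 0 j| < d) ->
    `|g (p + v) - g p - sgrad g p v| <= e * \sum_j `|v 0 j|.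
Proof.
move=> C1 e e0.
have /enbhsP[d d0 Hd] : \forall x \near p, forall j, derivable g x (delta_mx 0 j) /\
  `|partial j g x - partial j g p| < e.
  have c1 : \forall x \near p, forall j, `|partial j g x - partial j g p| < e.
    have c2 j : \forall x \near p, `|partial j g x - partial j g p| < e.
      have [_ /continuous_normP] := nbhs_singleton C1 j; exact.
    exact: filter_forall c2.
  by apply: filterS2 C1 c1 => x h1 h2 j; split => //; have [] := h1 j.
exists d => // v hv.
pose w (k : nat) : E := \row_j (if (j < k)%N then v 0 j else 0).
have w0 : w 0 = 0 by apply/rowP => j; rewrite !mxE.
have wn : w n = v by apply/rowP => j; rewrite !mxE ltn_ord.
have wS (k : 'I_n) : w k.+1 = w k + v 0 k *: delta_mx 0 k.
  apply/rowP => j; rewrite !mxE eqxx /= ltnS leq_eqVlt.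
  have [->|jk] := eqVneq j k; first by rewrite eqxx ltnn mulr1 add0r.
  have -> : ((j : nat) == k) = false by apply/negbTE; apply: contra jk => /eqP h; apply/eqP/val_inj.
  by rewrite mulr0 addr0.
have step (k : 'I_n) : `|g (p + w k.+1) - g (p + w k) - v 0 k * partial k g p| <= e * `|v 0 k|.
  pose f (t : R) := g (p + w k + t *: delta_mx 0 k).
  have -> : g (p + w k.+1) = f (v 0 k) by rewrite /f wS addrA.
  have -> : g (p + w k) = f 0 by rewrite /f scale0r addr0.
  rewrite (mulrC (v 0 k)).
  apply: (@mvt_est f (fun t => partial k g (p + w k + t *: delta_mx 0 k))) => t ht.
  have [|h1 h2] := Hd (p + w k + t *: delta_mx 0 k) _ k.
    move=> j; rewrite !mxE eqxx /= -addrA addrAC subrr add0r.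
    have [->|jk] := eqVneq j k; first by rewrite ltnn mulr1 add0r; apply: le_lt_trans ht _.
    by rewrite mulr0 addr0; case: ifP => _ //; rewrite normr0.
  by split; [exact: line_is_derive|exact: ltW].
have -> : g (p + v) - g p - sgrad g p v = \sum_(k < n) (g (p + w k.+1) - g (p + w k) - v 0 k * partial k g p).
  rewrite sumrB; congr (_ - _); have -> : g (p + v) = g (p + w n) by rewrite wn.
  rewrite -(big_mkord xpredT (fun k => g (p + w k.+1) - g (p + w k))) telescope_sumr //.
  by rewrite w0 addr0.
rewrite mulr_sumr; apply: le_trans (ler_norm_sum _ _ _) _; apply: ler_sum => k _; exact: step.
Qed.

Lemma C1_cont p g : C1_near p g -> {for p, continuous g}.
Proof.
move=> C1; apply/continuous_normP => e e0.
have [d d0 H] := C1_expand C1 ltr01.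
pose K := \sum_j (`|partial j g p| + 1).
have K0 : 0 <= K by apply: sumr_ge0 => j _; rewrite addr_ge0.
have K1 : 0 < K + 1 by rewrite ltr_wpDl.
apply/enbhsP; exists (Num.min d (e / (K + 1))); first by rewrite lt_min d0 divr_gt0.
move=> y hy; have yp : y = p + (y - p) by rewrite addrC subrK.
set d' := Num.min _ _ in hy.
have dd : d' <= d by rewrite ge_min lexx.
have de : d' * (K + 1) <= e by rewrite -ler_pdivlMr // ge_min lexx orbT.
have hv j : `|(y - p) 0 j| < d' by rewrite !mxE.
have d'0 : 0 < d' by rewrite lt_min d0 divr_gt0.
have := H (y - p) (fun j => lt_le_trans (hv j) dd); rewrite -yp mul1r => h.
have h2 : `|sgrad g p (y - p)| + \sum_j `|(y - p) 0 j| <= d' * K.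
  rewrite /K mulr_sumr; apply: le_trans (lerD (ler_norm_sum _ _ _) (lexx _)) _.
  rewrite -big_split /=; apply: ler_sum => j _; rewrite normrM mulrDr mulr1.
  by apply: lerD; [apply: ler_wpM2r|]; rewrite ?normr_ge0 // ltW.
have h3 : `|g y - g p| <= `|g y - g p - sgrad g p (y - p)| + `|sgrad g p (y - p)|.
  by rewrite -{1}(subrK (sgrad g p (y - p)) (g y - g p)) ler_normD.
move: h h2 h3 de d'0; rewrite mulrDr mulr1.
move: (d' * K) (`|_|) (`|_|) (`|_|) (\sum_j _) => a1 a2 a3 a4 a5; clear -e0; lra.
Qed.

Lemma C1_derive p g e : C1_near p g -> is_derive (0 : R) 1 (fun t : R => g (p + t *: e)) (sgrad g p e).
Proof.
move=> C1; apply: is_derive_eps => ep ep0.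
pose K := \sum_j `|e 0 j|; have K0 : 0 <= K by apply: sumr_ge0.
have K1 : 0 < K + 1 by rewrite ltr_wpDl.
have e1 : 0 < ep / (K + 1) by rewrite divr_gt0.
have [d d0 H] := C1_expand C1 e1.
exists (d / (K + 1)); first by rewrite divr_gt0.
move=> h; rewrite ltr_pdivlMr // => hd; rewrite add0r scale0r addr0.
have hj j : `|(h *: e) 0 j| <= `|h| * K.
  rewrite mxE normrM ler_wpM2l // /K (bigD1 j) //= lerDl; exact: sumr_ge0.
have hd' : `|h| * K < d by apply: le_lt_trans hd; rewrite mulrDr mulr1 lerDl.
have := H (h *: e) (fun j => le_lt_trans (hj j) hd').
have -> : sgrad g p (h *: e) = sgrad g p e * h.
  by rewrite /sgrad mulr_suml; apply: eq_bigr => j _; rewrite mxE -mulrA mulrC.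
move/le_trans; apply.
have -> : \sum_j `|(h *: e) 0 j| = K * `|h|.
  by rewrite /K mulr_suml; apply: eq_bigr => j _; rewrite mxE normrM mulrC.
rewrite mulrA; apply: ler_wpM2r => //.
by rewrite mulrAC ler_pdivrMr // ler_wpM2l ?(ltW ep0) // lerDl.
Qed.

Lemma C1_derive_at p g e (t : R) : C1_near (p + t *: e) g ->
  is_derive t 1 (fun s : R => g (p + s *: e)) (sgrad g (p + t *: e) e).
Proof.
move=> C1; have := C1_derive e C1 => H.
have h1 : is_derive t 1 (fun s : R => s - t) 1.
  by apply: is_derive_eq; rewrite subr0.
have := is_derive1_comp (f := fun t0 : R => g (p + t *: e + t0 *: e)) (g := fun s : R => s - t) (x :=
  t) (a := sgrad g (p + t *: e) e) (b := 1).
rewrite subrr mulr1 => /(_ H h1).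
have -> // : (fun t0 : R => g (p + t *: e + t0 *: e)) \o (fun s : R => s - t) = fun s : R => g (p + s *: e).
by apply/funext => s; rewrite /= -addrA -scalerDl [t + _]addrC subrK.
Qed.

Lemma C1_near_near p g : C1_near p g -> \forall x \near p, C1_near x g.
Proof. by move=> h; exact: (nbhs_interior h). Qed.

Lemma derive_eps (f : R -> R) (t l : R) : is_derive t 1 f l -> forall e : R, 0 < e ->
  exists2 d : R, 0 < d & forall h, `|h| < d -> `|f (t + h) - f t - l * h| <= e * `|h|.
Proof.
move=> [df dl] e e0; have := df; rewrite /derivable => /cvg_ex[l' cl'].
have ll : l' = l by rewrite -dl /derive; apply/esym/cvg_lim.
rewrite ll in cl'.
move/cvgrPdist_le: cl' => /(_ _ e0); rewrite near_withinE => /nbhs_normP[d d0 H].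
exists d => // h hd; have [->|h0] := eqVneq h 0.
  by rewrite addr0 mulr0 subrr subr0 !normr0 mulr0.
have := H h; rewrite /= sub0r normrN => /(_ hd h0); rewrite /shift /= [h%:A]mulr1 [h + t]addrC => hh.
rewrite -ler_pdivrMr ?normr_gt0 // -normfV -normrM.
apply: le_trans hh; rewrite -normrN le_eqVlt; apply/orP; left; apply/eqP.
by congr (`| _ |); rewrite /GRing.scale /=; field.
Qed.

(** The derivative vanishes at 0 and has slope c > 0 there, so f is increasing to the right
    of 0. *)
Lemma no_line_touch (f df : R -> R) (c d0 : R) : 0 < d0 -> 0 < c -> f 0 = 0 ->
  (forall t : R, `|t| < d0 -> is_derive t 1 f (df t)) -> df 0 = 0 -> is_derive (0 : R) 1 df c ->
  (forall t, `|t| < d0 -> f t <= 0) -> False.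
Proof.
move=> d00 c0 f0 Hf df0 ddf fneg.
have c2 : 0 < c / 2 by rewrite divr_gt0.
have [d dp H] := derive_eps ddf c2.
pose t := Num.min d0 d / 2.
have m0 : 0 < Num.min d0 d by rewrite lt_min d00.
have t0 : 0 < t by rewrite divr_gt0.
have tm : t < Num.min d0 d by rewrite ltr_pdivrMr // ltr_pMr // ltr1n.
have td0 : t < d0 by apply: lt_le_trans tm _; rewrite ge_min lexx.
have td : t < d by apply: lt_le_trans tm _; rewrite ge_min lexx orbT.
have cf : {within `[0, t], continuous f}.
  apply: continuous_in_subspaceT => s; rewrite inE /= in_itv /= => /andP[s0 st].
  apply: is_derive_cont (Hf s _); rewrite ger0_norm //; exact: le_lt_trans td0.
have [s|s] := @MVT R f df 0 t t0 _ cf.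
  by rewrite in_itv /= => /andP[s0 st]; apply: Hf; rewrite gtr0_norm //; exact: lt_trans td0.
rewrite in_itv /= => /andP[s0 st] E.
have := H s; rewrite add0r df0 subr0 gtr0_norm // => /(_ (lt_trans st td)).
rewrite ler_norml => /andP[h1 _].
have dfs : 0 < df s by have := mulr_gt0 c0 s0; move: h1; rewrite mulrAC; move: (c * s) => x; clear; lra.
have := mulr_gt0 dfs t0; have := fneg t; rewrite gtr0_norm // => /(_ td0).
by move: E; rewrite f0 !subr0 => ->; rewrite leNgt => /negP.
Qed.

Lemma deriv_zero_at_max (f : R -> R) (l d0 : R) : 0 < d0 -> is_derive (0 : R) 1 f l ->
  (forall t, `|t| < d0 -> f t <= f 0) -> l = 0.
Proof.
move=> d00 hf hm; apply/eqP; apply: contrapT => /negP l0.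
have l1 : 0 < `|l| / 2 by rewrite divr_gt0 // normr_gt0.
have [d dp H] := derive_eps hf l1.
pose t := Num.min d0 d / 2.
have m0 : 0 < Num.min d0 d by rewrite lt_min d00.
have t0 : 0 < t by rewrite divr_gt0.
have tm : t < Num.min d0 d by rewrite ltr_pdivrMr // ltr_pMr // ltr1n.
have td0 : t < d0 by apply: lt_le_trans tm _; rewrite ge_min lexx.
have td : t < d by apply: lt_le_trans tm _; rewrite ge_min lexx orbT.
pose h := Num.sg l * t.
have sl : `|Num.sg l| = 1 by rewrite normr_sg l0.
have hh : `|h| = t by rewrite normrM sl mul1r gtr0_norm.
have := H h; rewrite hh add0r => /(_ td); rewrite ler_norml => /andP[h1 _].
have lh : l * h = `|l| * t by rewrite /h mulrA [l * _]mulrC -normrEsg.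
have := hm h; rewrite hh => /(_ td0); have := mulr_gt0 l1 t0; move: h1; rewrite lh.
rewrite ![_ / 2 * _]mulrAC; move: (`|l| * t) => x; clear; lra.
Qed.

Lemma boundary_value X p r : open X -> local_defining X p r -> boundary X p ->
  r p = 0 /\ \forall x \near p, closure X x -> r x <= 0.
Proof.
move=> oX [[C1 _] _ Xr] [cp nip].
have neg : \forall x \near p, closure X x -> r x <= 0.
  apply: filterS2 (C1_near_near C1) (nbhs_interior Xr) => x C1x Xrx cx.
  rewrite leNgt; apply/negP => rx.
  have [y [Xy [h1 h2]]] := cx _ (filterI (rgt_near (C1_cont C1x) rx) Xrx).
  by move/h2: Xy; move: h1; move=> a b; move: (lt_trans a b); rewrite ltxx.
split => //; apply/eqP; rewrite eq_le (nbhs_singleton neg cp) leNgt /=.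
apply/negP => rp; apply: nip; have Xp : X p by apply/(nbhs_singleton Xr).
by move: oX; rewrite openE; apply.
Qed.

(** Along the segment a defining function is at most 0 and vanishes at p, so its derivative
    vanishes; strict convexity makes its second derivative positive, which contradicts the
    maximum. *)
Lemma no_inner_touch X p e : open X -> C2_boundary X -> strictly_convex X -> boundary X p -> e != 0 ->
  (exists2 d : R, 0 < d & forall t : R, `|t| < d -> closure X (p + t *: e)) -> False.
Proof.
move=> oX C2 sc bp e0 [d d0 Hd].
have [r rp] := C2 p bp; have [r0 rneg] := boundary_value oX rp bp.
have [[C1 C11] _ _] := rp.
have cl (t : R) : {for t, continuous (fun t : R => p + t *: e)}.
  apply: cont_real_row => j; have -> : (fun t : R => (p + t *: e) 0 j) = fun t : R => p 0 j + t * e 0 j.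
    by apply/funext => s; rewrite !mxE.
  by apply: (cvgD (cvg_cst _)); apply: (cvgM cvg_id (cvg_cst _)).
have lim0 P : (\forall x \near p, P x) -> exists2 d' : R, 0 < d' & forall t : R, `|t| < d' -> P (p + t *: e).
  move=> hP; have := cl 0 P; rewrite scale0r addr0 => /(_ hP)/nbhs_normP[d' d'0 H].
  by exists d' => // t ht; apply: H; rewrite /= sub0r normrN.
have [d1 d10 H1] := lim0 _ rneg; have [d2 d20 H2] := lim0 _ (C1_near_near C1).
pose m := Num.min d (Num.min d1 d2); have m0 : 0 < m by rewrite !lt_min d0 d10.
pose f (t : R) := r (p + t *: e).
have f0 : f 0 = 0 by rewrite /f scale0r addr0.
have fneg t : `|t| < m -> f t <= 0.
  by rewrite !lt_min => /and3P[h1 h2 h3]; apply: H1 => //; exact: Hd.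
have df (t : R) : `|t| < m -> is_derive t 1 f (sgrad r (p + t *: e) e).
  by rewrite !lt_min => /and3P[h1 h2 h3]; apply: C1_derive_at; exact: H2.
have L0 : sgrad r p e = 0.
  have := df 0; rewrite normr0 scale0r addr0 => /(_ m0) h.
  by apply: (deriv_zero_at_max m0 h) => t ht; rewrite f0; exact: fneg.
have c0 := sc p r bp rp e e0 L0.
apply: (@no_line_touch f (fun t => sgrad r (p + t *: e) e) _ m m0 c0 f0 df) => //.
  by rewrite scale0r addr0.
have h k : is_derive (0 : R) 1 (fun t : R => e 0 k * partial k r (p + t *: e)) (e 0 k * sgrad (partial k r) p e).
  have h1 := C1_derive e (C11 k).
  exact: (@is_deriveZ _ _ _ _ (e 0 k) _ _ _ h1).
have -> : \sum_j \sum_k e 0 j * e 0 k * partial j (partial k r) p = \sum_k e 0 k * sgrad (partial k r) p e.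
  rewrite exchange_big; apply: eq_bigr => k _; rewrite /sgrad mulr_sumr; apply: eq_bigr => j _.
  by rewrite mulrA (mulrC (e 0 k)).
have -> : (fun t : R => sgrad r (p + t *: e) e) = \sum_(k < n) (fun t : R => e 0 k * partial k r (p + t *: e)).
  by apply/funext => t; rewrite fct_sumE.
exact: is_derive_sum.
Qed.

End RealCalculus.

(** * Convexity of the initial domain *)

Section Convexity.
Variables (R : realType) (n : nat).
Notation E := 'rV[R]_n.
Implicit Types (x y v e p a b l c : E) (g r : E -> R) (X A : set E).

Definition seg_convex A := forall a b (t : R), A a -> A b -> 0 <= t -> t <= 1 -> A (a + t *: (b - a)).

Lemma seg_convex_rays A x e (s1 s2 : R) : seg_convex A -> 0 <= s1 -> 0 <= s2 ->
  A (x + s1 *: e) -> A (x + s2 *: (- e)) -> A x.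
Proof.
move=> cA s10 s20 A1 A2; have [s0|s0] := eqVneq (s1 + s2) 0.
  by move/eqP: s0; rewrite paddr_eq0 // => /andP[/eqP s1e _]; move: A1; rewrite s1e scale0r addr0.
have sp : 0 < s1 + s2 by rewrite lt_def s0 addr_ge0.
have -> : x = (x + s2 *: (- e)) + (s2 / (s1 + s2)) *: ((x + s1 *: e) - (x + s2 *: (- e))).
  by apply/rowP => j; rewrite !mxE; field.
apply: cA => //; first by rewrite divr_ge0 // ltW.
by rewrite ler_pdivrMr // mul1r lerDr.
Qed.

Lemma seg_cont a (t : R) b : {for (t, b), continuous (fun q : R * E => a + q.1 *: (q.2 - a))}.
Proof.
apply: cont_real_row => j.
have -> : (fun q : R * E => (a + q.1 *: (q.2 - a)) 0 j) = fun q => a 0 j + q.1 * (q.2 0 j + - a 0 j).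
  by apply/funext => q; rewrite !mxE.
apply: contRD; first exact: contR_cst.
apply: contRM; first exact: cvg_fst.
apply: contRD; last exact: contR_cst.
exact: (@continuous_comp _ _ _ (fun q : R * E => q.2) (fun x : E => x 0 j) (t, b) cvg_snd (@ecoord_cont _ _ j b)).
Qed.

Lemma seg_cont2 a (t : R) b : {for b, continuous (fun b : E => a + t *: (b - a))}.
Proof.
apply: cont_real_row => j.
have -> : (fun b : E => (a + t *: (b - a)) 0 j) = fun b => a 0 j + t * (b 0 j + - a 0 j).
  by apply/funext => q; rewrite !mxE.
apply: contRD; first exact: contR_cst.
apply: contRM; first exact: contR_cst.
apply: contRD; last exact: contR_cst.
exact: ecoord_cont.
Qed.

(** The points b for which the segment from a to b is in X form an open set. It is closed in
    X, because a limit of such segments lies in the closure of X and cannot touch the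
    boundary from inside. *)
Lemma tietze X : open X -> connected X -> C2_boundary X -> strictly_convex X -> seg_convex X.
Proof.
move=> oX cX C2 sc a b t Xa Xb t0 t1.
pose G := [set b | X b /\ forall t : R, t \in `[0, 1]%R -> X (a + t *: (b - a))].
have oG : open G.
  rewrite openE => b' [Xb' Hb'].
  have := @segment_compact R 0 1; rewrite compact_near_coveringP.
  move=> /(_ E (nbhs b') (fun b t => X (a + t *: (b - a))) _) H.
  have n1 : \forall b \near b', forall t : R, t \in `[0, 1]%R -> X (a + t *: (b - a)).
    apply: H => s hs; apply: (@seg_cont a s b' X); apply: open_nbhs_nbhs; split => //; exact: Hb'.
  by apply: filterS2 n1 (open_nbhs_nbhs (conj oX Xb')) => b'' h1 h2; split.
have GX : X `&` closure G = G.
  apply/seteqP; split => b' [h1 h2]; last by split => //; apply: subset_closure; split.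
  split => //.
  have cl s : s \in `[0, 1]%R -> closure X (a + s *: (b' - a)).
    move=> hs P /(@seg_cont2 a s b') nP; have [b'' [[_ Gb] Pb]] := h2 _ nP.
    by exists (a + s *: (b'' - a)); split => //; exact: Gb.
  move=> s hs; apply: contrapT => nXs.
  have s01 : s != 0 /\ s != 1.
    split; apply/eqP => se; apply: nXs; rewrite se; first by rewrite scale0r addr0.
    by rewrite scale1r addrC subrK.
  have := hs; rewrite in_itv /= !le_eqVlt eq_sym (negbTE s01.1) (negbTE s01.2) /= => /andP[s0 s1].
  apply: (@no_inner_touch R n X (a + s *: (b' - a)) (b' - a) oX C2 sc).
  - by split; [exact: cl|move=> /interior_subset].
  - by apply: contra_notN nXs => /eqP ->; rewrite scaler0 addr0.
  - exists (Num.min s (1 - s)); first by rewrite lt_min s0 subr_gt0.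
    move=> u; rewrite lt_min !ltr_norml => /andP[/andP[u1 u2] /andP[u3 u4]].
    rewrite -addrA -scalerDl; apply: cl; rewrite in_itv /=.
    by apply/andP; split; [move: u1; clear|move: u4; clear]; lra.
have E : G = X.
  apply: cX.
  - exists a; split => // s _; by rewrite subrr scaler0 addr0.
  - by exists G => //; apply/seteqP; split => [b' [h1 h2]|b' [_]//]; split.
  - by exists (closure G); [exact: closed_closure|rewrite GX].
have [_ H] : G b by rewrite E.
by apply: H; rewrite in_itv /= t0.
Qed.

Lemma closure_seg_convex A : seg_convex A -> seg_convex (closure A).
Proof.
move=> cA a b t ca cb t0 t1 P /enbhsP[d d0 HP].
have na : nbhs a [set x | forall j, `|x 0 j - a 0 j| < d] by apply/enbhsP; exists d.
have nb : nbhs b [set x | forall j, `|x 0 j - b 0 j| < d] by apply/enbhsP; exists d.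
have [a' [Aa ha]] := ca _ na; have [b' [Ab hb]] := cb _ nb.
exists (a' + t *: (b' - a')); split; first exact: cA.
apply: HP => j; rewrite !mxE.
have -> : a' 0 j + t * (b' 0 j - a' 0 j) - (a 0 j + t * (b 0 j - a 0 j)) =
  (1 - t) * (a' 0 j - a 0 j) + t * (b' 0 j - b 0 j) by ring.
have h1 := ha j; have h2 := hb j; rewrite /mkset in h1 h2.
have s0 : 0 <= 1 - t by rewrite subr_ge0.
apply: le_lt_trans (ler_normD _ _) _; rewrite !normrM (ger0_norm t0) (ger0_norm s0).
have m1 : Num.max `|a' 0 j - a 0 j| `|b' 0 j - b 0 j| < d by rewrite gt_max h1.
apply: le_lt_trans m1; set m := Num.max _ _.
have m2 : (1 - t) * `|a' 0 j - a 0 j| <= (1 - t) * m by rewrite ler_wpM2l // le_max lexx.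
have m3 : t * `|b' 0 j - b 0 j| <= t * m by rewrite ler_wpM2l // le_max lexx orbT.
apply: le_trans (lerD m2 m3) _; by rewrite -mulrDl subrK mul1r.
Qed.

Definition edot l x : R := \sum_j l 0 j * x 0 j.

Lemma edotD l x y : edot l (x + y) = edot l x + edot l y.
Proof. by rewrite /edot -big_split /=; apply: eq_bigr => j _; rewrite mxE mulrDr. Qed.
Lemma edotZ l (s : R) x : edot l (s *: x) = s * edot l x.
Proof. by rewrite /edot mulr_sumr; apply: eq_bigr => j _; rewrite mxE mulrCA. Qed.
Lemma edotB l x y : edot l (x - y) = edot l x - edot l y.
Proof. by rewrite edotD -scaleN1r edotZ mulN1r. Qed.
Lemma edot_e2 l : edot l l = e2 l.
Proof. by apply: eq_bigr => j _; rewrite expr2. Qed.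
Lemma e2D x y : e2 (x + y) = e2 x + 2 * edot x y + e2 y.
Proof.
by rewrite /e2 /edot mulr_sumr -!big_split /=; apply: eq_bigr => j _; rewrite mxE; ring.
Qed.
Lemma e2Z (s : R) x : e2 (s *: x) = s ^+ 2 * e2 x.
Proof. by rewrite /e2 mulr_sumr; apply: eq_bigr => j _; rewrite mxE exprMn. Qed.
Lemma e2_gt0 l : (0 < e2 l) = (l != 0).
Proof.
have -> : e2 l = N2 (rv l).
  by rewrite N2E reV_rv imV_rv {3}/e2 big1 ?addr0 // => j _; rewrite mxE expr0n.
by rewrite N2_gt0 rv_eq0.
Qed.

Lemma contR_sum (T : topologicalType) (I : Type) (s : seq I) (f : I -> T -> R) (t : T) :
  (forall i, {for t, continuous (f i)}) -> {for t, continuous (fun q : T => \sum_(i <- s) f i q)}.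
Proof.
move=> cf; elim: s => [|i s IH].
  have -> : (fun q : T => \sum_(i <- [::]) f i q) = (fun=> 0 : R) by apply/funext => q; rewrite big_nil.
  exact: contR_cst.
have -> : (fun q : T => \sum_(i <- i :: s) f i q) = (fun q : T => f i q + \sum_(i <- s) f i q).
  by apply/funext => q; rewrite big_cons.
by apply: contRD; [exact: cf|exact: IH].
Qed.

Lemma edot_cont l x : {for x, continuous (edot l)}.
Proof. by apply: contR_sum => j; apply: contRM; [exact: contR_cst|exact: ecoord_cont]. Qed.
Lemma e2_cont x : {for x, continuous (@e2 R n)}.
Proof.
have -> : @e2 R n = fun x => \sum_j x 0 j * x 0 j.
  by apply/funext => y; apply: eq_bigr => j _; rewrite expr2.
by apply: contR_sum => j; apply: contRM; exact: ecoord_cont.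
Qed.

(** The vector from the nearest point of A to x separates. *)
Lemma separating_form A x : (1 < n)%N -> compact A -> seg_convex A -> ~ A x ->
  exists2 l, l != 0 & forall c, A c -> edot l c < edot l x.
Proof.
move=> n1 cA sA nAx; have [ne|ne] := pselect (A !=set0); last first.
  have [j0 _] := two_indices n1; exists (delta_mx 0 j0); last by move=> c Ac; exfalso; apply: ne; exists c.
  by apply/eqP => /rowP/(_ j0)/eqP; rewrite !mxE !eqxx oner_eq0.
have cf : forall c, {for c, continuous (fun c => - e2 (x - c))}.
  move=> c; apply: contRN.
  have c1 : {for c, continuous (fun c : E => x - c)}.
    apply: cont_real_row => j; have -> : (fun c : E => (x - c) 0 j) = fun c => x 0 j + - c 0 j.
      by apply/funext => q; rewrite !mxE.
    by apply: contRD; [exact: contR_cst|apply: contRN; exact: ecoord_cont].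
  exact: (continuous_comp c1 (@e2_cont _)).
have [c0 Ac0 cmax] := max_on ne cA cf.
have l0 : x - c0 != 0 by rewrite subr_eq0; apply: contra_notN nAx => /eqP ->.
exists (x - c0) => // c Ac.
have key : edot (x - c0) (c - c0) <= 0.
  rewrite leNgt; apply/negP => h.
  have e0 : 0 <= e2 (c - c0) := e2_ge0 _.
  have e1 : 0 < e2 (c - c0) + 1 by rewrite ltr_wpDl.
  pose s := Num.min 1 (edot (x - c0) (c - c0) / (e2 (c - c0) + 1)).
  have s0 : 0 < s by rewrite lt_min ltr01 divr_gt0.
  have s1 : s <= 1 by rewrite ge_min lexx.
  have sl : s * (e2 (c - c0) + 1) <= edot (x - c0) (c - c0) by rewrite -ler_pdivlMr // ge_min lexx orbT.
  have := cmax _ (sA _ _ s Ac0 Ac (ltW s0) s1); rewrite lerN2.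
  have -> : x - (c0 + s *: (c - c0)) = (x - c0) + (- s) *: (c - c0).
    by rewrite opprD addrA scaleNr.
  rewrite (e2D (x - c0) (- s *: (c - c0))) edotZ e2Z sqrrN => h2.
  have h3 : s * (s * (e2 (c - c0) + 1)) <= s * edot (x - c0) (c - c0) by rewrite ler_wpM2l // ltW.
  have h4 : 0 < s * edot (x - c0) (c - c0) by rewrite mulr_gt0.
  have h5 : 0 < s * s by rewrite mulr_gt0.
  move: h2 h3 h4 h5; rewrite expr2 !mulrDr !mulr1 !mulNr !mulrA.
  move: (edot _ _) (e2 (x - c0)) (e2 _) (s) => a1 a2 a3 u; clear; move=> h1 h2 h3 h4.
  have : u * u * a3 + 2 * (- (u * a1)) < 0 by lra.
  by move: h1; lra.
have : 0 < e2 (x - c0) by rewrite e2_gt0.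
by move: key; rewrite edotB -edot_e2 edotB; lra.
Qed.

(** The gradient at p of a defining function supports the convex set X; strictness holds
    because X is open. *)
Lemma boundary_normal X p : open X -> C2_boundary X -> seg_convex X -> boundary X p ->
  exists l, forall c, X c -> edot l c < edot l p.
Proof.
move=> oX C2 sX bp; have [r rp] := C2 p bp; have [r0 rneg] := boundary_value oX rp bp.
have [[C1 _] [j0 j0n] _] := rp; pose l : E := \row_j partial j r p.
have l0 : l != 0 by apply: contra_neq j0n => /rowP/(_ j0); rewrite !mxE.
have lra_rnorm v : sgrad r p v = edot l v.
  by apply: eq_bigr => j _; rewrite mxE mulrC.
have weak c : closure X c -> edot l (c - p) <= 0.
  move=> cc; rewrite leNgt; apply/negP => h.
  have /derive_eps H := C1_derive (c - p) C1; rewrite lra_rnorm in H.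
  have h2 : 0 < edot l (c - p) / 2 by rewrite divr_gt0.
  have [d d0 {}H] := H _ h2.
  have cl : {for 0, continuous (fun t : R => p + t *: (c - p))}.
    apply: cont_real_row => j; have -> : (fun t : R => (p + t *: (c - p)) 0 j) = fun t : R => p 0 j + t * (c - p) 0 j.
      by apply/funext => s; rewrite !mxE.
    by apply: contRD; [exact: contR_cst|apply: contRM; [exact: cvg_id|exact: contR_cst]].
  have := cl _; rewrite scale0r addr0 => /(_ _ rneg)/nbhs_normP[d1 d10 H1].
  pose t := Num.min 1 (Num.min d d1) / 2.
  have m0 : 0 < Num.min 1 (Num.min d d1) by rewrite !lt_min ltr01 d0.
  have t0 : 0 < t by rewrite divr_gt0.
  have tm : t < Num.min 1 (Num.min d d1) by rewrite ltr_pdivrMr // ltr_pMr // ltr1n.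
  move: tm; rewrite !lt_min => /and3P[t1 td td1].
  have := H t; rewrite gtr0_norm // => /(_ td); rewrite add0r scale0r addr0 r0 subr0 ler_norml => /andP[h3 _].
  have h4 : r (p + t *: (c - p)) <= 0.
    apply: H1; first by rewrite /= sub0r normrN gtr0_norm.
    apply: (closure_seg_convex sX) => //; [by case: bp|exact: ltW|exact: ltW].
  have := mulr_gt0 h t0; move: h3 h4; rewrite mulrAC; move: (edot _ _ * t) (r _) => u w; clear; lra.
exists l => c Xc; have [d d0 Hd] : exists2 d : R, 0 < d & forall y, (forall j, `|y 0 j - c 0 j| < d) -> X y.
  by apply/enbhsP; apply: open_nbhs_nbhs; split.
pose K := \sum_j `|l 0 j|; have K0 : 0 <= K by apply: sumr_ge0.
have K1 : 0 < K + 1 by rewrite ltr_wpDl.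
pose s := d / (K + 1); have s0 : 0 < s by rewrite divr_gt0.
have Xs : X (c + s *: l).
  apply: Hd => j; rewrite !mxE addrAC subrr add0r normrM (gtr0_norm s0).
  apply: (@lt_le_trans _ _ (s * (K + 1))); last by rewrite /s divfK // lt0r_neq0.
  rewrite ltr_pM2l //; apply: (@le_lt_trans _ _ K); last by rewrite ltrDl.
  by rewrite /K (bigD1 j) //= !mxE lerDl; exact: sumr_ge0.
have := weak _ (subset_closure Xs); rewrite edotB edotD edotZ edot_e2.
have : 0 < s * e2 l by rewrite mulr_gt0 // e2_gt0.
move: (edot _ _) (edot _ _) (s * _) => u w k; clear; lra.
Qed.

(** The nearest point gives no direction at a point of the boundary, where the normal is
    used instead. *)
Lemma supporting_form X x : (1 < n)%N -> open X -> C2_boundary X -> seg_convex X -> compact (closure X) -> ~ X x ->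
  exists l, forall c, X c -> edot l c < edot l x.
Proof.
move=> n1 oX C2 sX cX nX; have [cx|cx] := pselect (closure X x).
  by apply: boundary_normal => //; split => //; move=> /interior_subset.
have [l _ H] := separating_form n1 cX (closure_seg_convex sX) cx.
by exists l => c Xc; apply: H; exact: subset_closure.
Qed.

End Convexity.

Ltac gen_Re := repeat (match goal with |- context [@complex.Re ?R ?x] => let a :=
  fresh in generalize (@complex.Re R x); intro a end).

(** * Real slices *)

Section Slices.
Variables (R : realType) (n : nat).
Notation C := (Cx R).
Notation rc x := (real_complex R x : Cx R).
Notation V := 'rV[C]_n.
Notation E := 'rV[R]_n.
Implicit Types (x y e l c : E) (z w v u : V) (X : set E) (g h : V -> C).

Lemma dir_derive (f : E -> R) x (v : E) (l : R) :
  (forall e : R, 0 < e -> exists2 d : R, 0 < d & forall t : R, `|t| < d ->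
     `|f (x + t *: v) - f x - l * t| <= e * `|t|) -> is_derive x v f l.
Proof.
move=> H; have h : is_derive (0 : R) 1 (fun t : R => f (x + t *: v)) l.
  by apply: is_derive_eps => e /H[d d0 Hd]; exists d => // t td; rewrite add0r scale0r addr0; exact: Hd.
have E : (fun t : R => t^-1 *: (((fun s : R => f (x + s *: v)) \o shift 0) (t *: 1) - f (x + 0 *: v)))
  = (fun t => t^-1 *: ((f \o shift x) (t *: v) - f x)).
  apply/funext => s; congr (_ *: (f _ - f _)); last by rewrite scale0r addr0.
  by rewrite /= [s%:A]mulr1 addr0 addrC.
by have [h1 h2] := h; split; [rewrite /derivable -E|rewrite /derive -E].
Qed.

Lemma cvec_ray x y e (t : R) : cvec (x + t *: e) y = cvec x y + rc t *: rv e.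
Proof.
apply/rowP => j; rewrite !mxE; apply: cplx_eq; rewrite ?CReD ?CImD /=; by ring.
Qed.

Lemma rv_delta j : rv (delta_mx 0 j : E) = delta_mx 0 j :> V.
Proof. by apply/rowP => k; rewrite !mxE eqxx /=; case: (k == j). Qed.

Lemma Re_partial h x y (c : R) j : hol setT h ->
  is_derive x (delta_mx 0 j : E) (fun x => complex.Re (h (cvec x y)) + c) (complex.Re (pd h j (cvec x y))).
Proof.
move=> hh; apply: dir_derive => e e0.
set N := rnorm (delta_mx 0 j : V); have N0 : 0 <= N := rnorm_ge0 _.
have N1 : 0 < N + 1 by rewrite ltr_wpDl.
have e1 : 0 < e / (N + 1) by rewrite divr_gt0.
have [d d0 H] := differential_estimate (hh (cvec x y) I) e1.
exists (d / (N + 1)); first by rewrite divr_gt0.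
move=> t; rewrite ltr_pdivlMr // => td; rewrite cvec_ray rv_delta.
have nt : rnorm (rc t *: (delta_mx 0 j : V)) = `|t| * N by rewrite rnormZ rnorm_rc.
have tN : `|t| * N <= `|t| * (N + 1) by rewrite ler_wpM2l // lerDl.
have := H (rc t *: delta_mx 0 j); rewrite nt => /(_ (le_lt_trans tN td)).
rewrite linearZ /= -/(pd h j (cvec x y)) => h1.
have h2 := Re_le (h (cvec x y + rc t *: delta_mx 0 j) - h (cvec x y) - rc t * pd h j (cvec x y)).
have -> : complex.Re (h (cvec x y + rc t *: delta_mx 0 j)) + c - (complex.Re (h (cvec x y)) + c) -
  complex.Re (pd h j (cvec x y)) * t = complex.Re (h (cvec x y + rc t *: delta_mx 0 j) - h (cvec x y) - rc t
    * pd h j (cvec x y)).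
  by rewrite !CReD !CReN ReMrc; ring.
apply: le_trans h2 _; apply: le_trans h1 _.
have -> : e / (N + 1) * (`|t| * N) = e / (N + 1) * N * `|t| by ring.
apply: ler_wpM2r => //; rewrite mulrAC ler_pdivrMr // ler_wpM2l ?(ltW e0) // lerDl //.
Qed.

(** In the real directions the derivatives of Re g are the real parts of the complex
    derivatives of g. *)
Lemma posdef_hess g (G : E -> R) y (c : R) x e : hol setT g ->
  (forall x, G x = complex.Re (g (cvec x y)) + c) -> posdef (hessian G x) -> e != 0 ->
  0 < complex.Re (Bq (hess g (cvec x y)) (rv e) (rv e)).
Proof.
move=> hg GE pH /pH.
have p1 k : partial k G = fun x => complex.Re (pd g k (cvec x y)) + 0.
  have -> : G = fun x => complex.Re (g (cvec x y)) + c by apply/funext.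
  by apply/funext => x'; rewrite addr0 /partial; have [_ ->] := Re_partial x' y c k hg.
have p2 j k : hessian G x j k = complex.Re (hess g (cvec x y) k j).
  rewrite !mxE p1 /partial.
  by have [_ ->] := Re_partial x y 0 j (pd_hol k openT hg).
congr (_ < _); rewrite mxE /Bq Re_sum; apply: eq_bigr => k _.
rewrite [(_ *m _) _ _]mxE [_^T _ _]mxE mulr_suml Re_sum; apply: eq_bigr => j _.
have rvj i : rv e 0 i = rc (e 0 i) by rewrite mxE.
by rewrite p2 !rvj -[rc _ * rc _ * _]mulrA !ReMrc; ring.
Qed.

Lemma reV_ray z (t : R) e : reV (z + rc t *: rv e) = reV z + t *: e.
Proof. by apply/rowP => j; rewrite !mxE CReD CReM /= mul0r subr0. Qed.
Lemma imV_ray z (t : R) e : imV (z + rc t *: rv e) = imV z.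
Proof. by apply/rowP => j; rewrite !mxE CImD CImM /= mulr0 mul0r !addr0. Qed.

Definition realpos (r2 : R) g := forall z, e2 (imV z) < r2 -> forall e, e != 0 ->
  0 < complex.Re (Bq (hess g z) (rv e) (rv e)).

(** The second derivative of Re g along e is positive at z, so that the values at z + t e
    and z - t e add up to more than twice the value at z. *)
Lemma no_interior_max (r2 : R) g z e : hol setT g -> realpos r2 g -> e2 (imV z) < r2 -> e != 0 ->
  (exists2 d : R, 0 < d & forall t : R, `|t| < d -> complex.Re (g (z + rc t *: rv e)) <= complex.Re (g z)) -> False.
Proof.
move=> hg hp zr e0 [d d0 Hd]; have [r r0 [K K0 HK]] := quad_taylor openT hg (I : setT z).
have c0 := hp z zr e e0; set c := complex.Re _ in c0.
pose N := rnorm (rv e); have N0 : 0 < N by rewrite rnorm_gt0 rv_eq0.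
have KN : 0 < 4 * (K * N ^+ 3) by rewrite !mulr_gt0 // exprn_gt0.
pose t := Num.min (d / 2) (Num.min (r / N) (c / (4 * (K * N ^+ 3)))).
have t0 : 0 < t by rewrite !lt_min !divr_gt0.
have td : t < d.
  apply: (@le_lt_trans _ _ (d / 2)); first by rewrite ge_min lexx.
  by rewrite ltr_pdivrMr // ltr_pMr // ltr1n.
have tr : t * N <= r by rewrite -ler_pdivlMr // !ge_min lexx orbT.
have tc : t * (4 * (K * N ^+ 3)) <= c by rewrite -ler_pdivlMr // !ge_min lexx !orbT.
clearbody t.
pose L := complex.Re (dotC (grad g z) (rv e)).
have est s : `|s| = t -> complex.Re (g z) + s * L + t ^+ 2 * c / 2 - K * N ^+ 3 * t ^+ 3 <=
  complex.Re (g (z + rc s *: rv e)).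
  move=> st; have ns : rnorm (rc s *: rv e) = t * N by rewrite rnormZ rnorm_rc st.
  have := HK (rc s *: rv e); rewrite ns => /(_ tr) h1.
  have := Re_ge (g (z + rc s *: rv e) - g z - dotC (grad g z) (rc s *: rv e) - 2^-1 * Bq (hess g z) (rc s
    *: rv e) (rc s *: rv e)).
  have s2 : s ^+ 2 = t ^+ 2 by rewrite -st real_normK // num_real.
  have -> : complex.Re (g (z + rc s *: rv e) - g z - dotC (grad g z) (rc s *: rv e) - 2^-1
    * Bq (hess g z) (rc s *: rv e) (rc s *: rv e))
   = complex.Re (g (z + rc s *: rv e)) - complex.Re (g z) - s * L - t ^+ 2 * c / 2.
    rewrite !CReD !CReN dotCZ ReMrc BqZl BqZr (_ : (2^-1 : C) = rc 2^-1); last by rewrite fmorphV rmorph_nat.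
    by rewrite !ReMrc -/c -/L -s2; field.
  move: h1; rewrite exprMn; move: (rnorm _) (complex.Re _) (complex.Re _) (s * L) (t ^+ 2 * c / 2) => a1 a2 a3 a4 a5.
  by rewrite mulrA mulrAC; move: (K * _ * _) => a6; clear; lra.
have tt : `|t| = t by rewrite gtr0_norm.
have tn : `|- t| = t by rewrite normrN.
have := est _ tt; have := est _ tn; have := Hd t; have := Hd (- t).
rewrite tt tn => /(_ td) h1 /(_ td) h2.
have h3 : K * N ^+ 3 * t ^+ 3 = t ^+ 2 * (t * (K * N ^+ 3)) by ring.
have h4 : t ^+ 2 * (t * (4 * (K * N ^+ 3))) <= t ^+ 2 * c by rewrite ler_wpM2l ?sqr_ge0.
have h5 : 0 < t ^+ 2 * c by rewrite mulr_gt0 // exprn_gt0.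
have h6 : t ^+ 2 * (t * (4 * (K * N ^+ 3))) = 4 * (t ^+ 2 * (t * (K * N ^+ 3))) by ring.
rewrite h6 in h4; rewrite h3 mulNr; move: h1 h2 h4 h5.
move: (t ^+ 2 * (t * _)) (t ^+ 2 * c) (t * L) => a4 a5 a6; gen_Re; clear; lra.
Qed.

(** A maximum on the segment cannot be at an interior point, by no_interior_max. *)
Lemma quasi_convex (r2 : R) g z e (s1 s2 m : R) : hol setT g -> realpos r2 g -> e2 (imV z) < r2 ->
  0 <= s1 -> 0 <= s2 ->
  complex.Re (g (z + rc s1 *: rv e)) <= m -> complex.Re (g (z + rc s2 *: rv (- e))) <= m -> complex.Re (g z) <= m.
Proof.
move=> hg hp zr s10 s20 h1 h2; have [e0|e0] := eqVneq e 0.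
  by move: h1; rewrite e0 (_ : rv (0 : E) = 0); [rewrite scaler0 addr0|apply/eqP; rewrite rv_eq0].
rewrite leNgt; apply/negP => hm.
pose psi (t : R) := complex.Re (g (z + rc t *: rv e)).
have cl t : {for t, continuous (fun t : R => z + rc t *: rv e)}.
  apply: contVD; first exact: contV_cst.
  apply: (@contVZ _ _ _ (fun t : R => rc t)).
  by apply: cont_Complex; [exact: cvg_id|exact: cst_continuous].
have cp t : {for t, continuous psi}.
  by apply: Re_comp_cont; apply: (continuous_comp (cl t)); apply: differentiable_continuous; exact: hg.
rewrite rvN ray_opp in h2.
have ne : `[- s2, s1] !=set0 by exists 0; rewrite /= in_itv /= oppr_le0 s20.
have [c] := max_on ne (@segment_compact R (- s2) s1) cp; rewrite /= in_itv /= => /andP[c1 c2] cm.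
have p0 : m < psi c.
  apply: lt_le_trans hm _; have := cm 0; rewrite /psi scale0r addr0; apply.
  by rewrite /= in_itv /= oppr_le0 s20.
have cs1 : c < s1.
  by rewrite lt_neqAle c2 andbT; apply/eqP => ce; move: p0; rewrite /psi ce ltNge h1.
have cs2 : - s2 < c.
  by rewrite lt_neqAle c1 andbT; apply/eqP => ce; move: p0; rewrite /psi -ce ltNge h2.
apply: (@no_interior_max r2 g (z + rc c *: rv e) e hg hp) => //; first by rewrite imV_ray.
exists (Num.min (c + s2) (s1 - c)); first by rewrite lt_min -ltrBlDr sub0r cs2 subr_gt0.
move=> t; rewrite lt_min !ltr_norml => /andP[/andP[t1 t2] /andP[t3 t4]].
rewrite -addrA -scalerDl -rcD; apply: cm; rewrite /= in_itv /=.
by apply/andP; split; [move: t1; clear|move: t4; clear]; lra.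
Qed.

(** Outside the core, y being fixed, Re g is bounded by a constant, so the slice is a
    sublevel set of a quasi-convex function on X. *)
Lemma tube_slice X (r2 : R) g : seg_convex X -> hol setT g -> realpos r2 g ->
  slice_convex (open_tube X r2 `\` core_domain X r2 g).
Proof.
move=> sX hg hp z e s1 s2 s10 s20 [D1 C1] [D2 C2].
have yz : e2 (imV z) < r2 by case: D1; rewrite imV_ray.
have Dz : open_tube X r2 z.
  split => //; apply: (seg_convex_rays sX s10 s20 (e := e)); first by case: D1; rewrite reV_ray.
  by case: D2; rewrite reV_ray.
split => // -[_]; apply/negP; rewrite -leNgt; apply: (quasi_convex (e := e) hg hp yz s10 s20).
  by rewrite leNgt; apply/negP => h; apply: C1; split => //; rewrite imV_ray.
by rewrite leNgt; apply/negP => h; apply: C2; split => //; rewrite imV_ray.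
Qed.

(** A point of the closure of X with largest j-th coordinate is on the boundary. There
    b_edge applies with y = 0, and the strict inequality extends to points of X nearby. *)
Lemma core_domain_nonempty X (r2 : R) g : (1 < n)%N -> barrier X r2 g -> X !=set0 -> compact (closure X) -> 0 < r2 ->
  core_domain X r2 g !=set0.
Proof.
move=> n1 [oX _ hg _ he _] [x0 Xx0] cX r20; have [j _] := two_indices n1.
have ne : closure X !=set0 by exists x0; exact: subset_closure.
have [c cc cm] := max_on ne cX (@ecoord_cont R n j).
have nXc : ~ X c.
  move=> Xc; have /enbhsP[d d0 Hd] : nbhs c X by apply: open_nbhs_nbhs; split.
  have : X (c + (d / 2) *: delta_mx 0 j).
    apply: Hd => k; rewrite !mxE addrAC subrr add0r eqxx /=.
    have d2 : 0 < d / 2 by rewrite divr_gt0.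
    case: eqP => _; rewrite ?mulr1 ?mulr0 ?normr0 // gtr0_norm //.
    by rewrite ltr_pdivrMr // ltr_pMr // ltr1n.
  move=> /subset_closure/cm; rewrite !mxE !eqxx mulr1 gerDl leNgt divr_gt0 //.
have z0 : e2 (imV (cvec c 0)) = 0.
  by rewrite imV_cvec /e2 big1 // => k _; rewrite mxE expr0n.
have := he (cvec c 0); rewrite z0 subr0 reV_cvec => /(_ cc nXc (ltW r20)) hc.
have cf : {for c, continuous (fun x : E => complex.Re (g (cvec x 0)))}.
  apply: Re_comp_cont.
  have c1 : {for c, continuous (fun x : E => cvec x 0)}.
    apply/continuous_rnormP => e e0; apply/enbhsP; exists e => // y hy.
    have [->|v0] := eqVneq (cvec y 0 - cvec c 0) 0; first by rewrite rnorm0.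
    have [k ->] := rnorm_entry v0; have := hy k.
    rewrite !mxE -(rnorm_rc (y 0 k - c 0 k)); apply: le_lt_trans.
    by rewrite !rnormE /= subrr.
  by apply: (continuous_comp c1); apply: differentiable_continuous; exact: hg.
have [x [Xx hx]] := cc _ (rgt_near cf hc).
have zx : e2 (imV (cvec x 0)) = 0.
  by rewrite imV_cvec /e2 big1 // => k _; rewrite mxE expr0n.
by exists (cvec x 0); split; [split; rewrite ?reV_cvec ?zx|rewrite zx subr0].
Qed.

End Slices.

(** * Connectedness of the hull domain *)

Section Connected.
Variables (R : realType) (n : nat).
Notation C := (Cx R).
Notation rc x := (real_complex R x : Cx R).
Notation V := 'rV[C]_n.
Notation E := 'rV[R]_n.
Implicit Types (x y e l c : E) (z w v u : V) (X : set E) (g h : V -> C).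

Lemma connected_pairs (T : topologicalType) (A : set T) :
  (forall a b, A a -> A b -> exists B : set T, [/\ connected B, B `<=` A, B a & B b]) -> connected A.
Proof.
move=> H; have [[a Aa]|nA] := pselect (A !=set0); last first.
  have -> : A = set0 by apply/seteqP; split => // x Ax; exfalso; apply: nA; exists x.
  exact: connected0.
pose I := {b : T | A b}.
pose F (i : I) := sval (cid (H a (sval i) Aa (svalP i))).
have FP i : [/\ connected (F i), F i `<=` A, F i a & F i (sval i)] := svalP (cid (H a (sval i) Aa (svalP i))).
have -> : A = \bigcup_(i in [set: I]) F i.
  apply/seteqP; split => [b Ab|b [i _]]; first by exists (exist _ b Ab) => //; have [] := FP (exist _ b Ab).
  by have [_ h _ _] := FP i; exact: h.
apply: bigcup_connected; first by exists a => i _; have [] := FP i.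
by move=> i _; have [] := FP i.
Qed.

Lemma cont_pair (T U W : topologicalType) (f : T -> U) (h : T -> W) (t : T) : {for t, continuous f} ->
  {for t, continuous h} -> {for t, continuous (fun t => (f t, h t))}.
Proof. by move=> cf ch; exact: (cvg_pair cf ch). Qed.

Lemma cont_complex_row (T : topologicalType) (f : T -> V) t : (forall j, {for t, continuous (fun t => f t 0 j)}) ->
  {for t, continuous f}.
Proof.
move=> cf; apply/continuous_rnormP => e e0.
have c1 j : \forall s \near t, rnorm (f s 0 j - f t 0 j) < e by have /continuous_rnormP := cf j; apply.
have {}c1 : \forall s \near t, forall j, rnorm (f s 0 j - f t 0 j) < e by exact: filter_forall c1.
apply: filterS c1 => s hs.
have [->|v0] := eqVneq (f s - f t) 0; first by rewrite rnorm0.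
by have [k ->] := rnorm_entry v0; have := hs k; rewrite !mxE.
Qed.

Lemma cvec_cont (p : E * E) : {for p, continuous (fun p : E * E => cvec p.1 p.2)}.
Proof.
apply: cont_complex_row => j.
have -> : (fun p : E * E => cvec p.1 p.2 0 j) = (fun p => Complex (p.1 0 j) (p.2 0 j) : C).
  by apply/funext => q; rewrite mxE.
apply: cont_Complex.
  exact: (@continuous_comp _ _ _ (fun q : E * E => q.1) (fun x : E => x 0 j) p cvg_fst (@ecoord_cont _ _ j _)).
exact: (@continuous_comp _ _ _ (fun q : E * E => q.2) (fun x : E => x 0 j) p cvg_snd (@ecoord_cont _ _ j _)).
Qed.

Lemma edot_cont2 (p : E * E) : {for p, continuous (fun p : E * E => edot p.1 p.2)}.
Proof.
apply: contR_sum => j; apply: contRM.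
  exact: (@continuous_comp _ _ _ (fun q : E * E => q.1) (fun x : E => x 0 j) p cvg_fst (@ecoord_cont _ _ j _)).
exact: (@continuous_comp _ _ _ (fun q : E * E => q.2) (fun x : E => x 0 j) p cvg_snd (@ecoord_cont _ _ j _)).
Qed.

(** Over a fixed y the hull domain is the complement in X of this compact convex set. Each
    of its points is separated from it by a linear form l, and for fixed l the points
    separated by l form a convex set. *)
Definition badslice X g y : set E := [set c | closure X c /\ complex.Re (g (cvec c y)) <= 0].
Definition halfpiece X g y l : set E :=
  [set x | X x /\ forall c, badslice X g y c -> edot l c < edot l x].
Definition fiber X g y l : set V := [set z | imV z = y /\ halfpiece X g y l (reV z)].

Lemma lin_cont (T : topologicalType) (f : T -> E) (h : V -> C) (t : T) (y : E) :
  {for t, continuous f} -> hol setT h -> {for t, continuous (fun t => complex.Re (h (cvec (f t) y)))}.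
Proof.
move=> cf hh; apply: Re_comp_cont.
have c1 : {for t, continuous (fun t => (f t, y))} by apply: cont_pair; [exact: cf|exact: cst_continuous].
have c2 := continuous_comp c1 (@cvec_cont _).
by apply: (continuous_comp c2); apply: differentiable_continuous; exact: hh.
Qed.

Lemma line_cont x e (t : R) : {for t, continuous (fun t : R => x + t *: e)}.
Proof.
apply: cont_real_row => j; have -> : (fun t : R => (x + t *: e) 0 j) = fun t : R => x 0 j + t * e 0 j.
  by apply/funext => s; rewrite !mxE.
by apply: contRD; [exact: contR_cst|apply: contRM; [exact: cvg_id|exact: contR_cst]].
Qed.

Lemma badslice_in X (r2 : R) g y c : barrier X r2 g -> e2 y < r2 -> badslice X g y c -> X c.
Proof.
move=> [_ _ _ _ he _] yr [cc gc]; apply: contrapT => nX.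
have := he (cvec c y); rewrite reV_cvec imV_cvec => /(_ cc nX (ltW yr)).
move: gc yr; gen_Re; move: (e2 y) => a; clear; lra.
Qed.

Lemma badslice_compact X (r2 : R) g y : barrier X r2 g -> compact (closure X) -> compact (badslice X g y).
Proof.
move=> [_ _ hg _ _ _] cX; apply: compact_closedI => //.
have c1 : forall c : E, {for c, continuous (fun c : E => complex.Re (g (cvec c y)))}.
  by move=> c; apply: (@lin_cont _ (fun c => c)) => //; exact: cvg_id.
exact: closed_sublevel c1.
Qed.

Lemma badslice_seg_convex X (r2 : R) g y : barrier X r2 g -> seg_convex X -> e2 y < r2 -> seg_convex (badslice X g y).
Proof.
move=> [_ _ hg hp _ _] sX yr a b t [ca ga] [cb gb] t0 t1; split; first exact: closure_seg_convex.
apply: (quasi_convex (e := b - a) (s1 := 1 - t) (s2 := t) hg hp) => //.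
- by rewrite imV_cvec.
- by rewrite subr_ge0.
- by rewrite -cvec_ray -addrA -scalerDl [t + _]addrC subrK scale1r [a + _]addrC subrK.
- by rewrite -cvec_ray scalerN addrK.
Qed.

Lemma halfpiece_seg_convex X g y l : seg_convex X -> seg_convex (halfpiece X g y l).
Proof.
move=> sX a b t [Xa ha] [Xb hb] t0 t1; split; first exact: sX.
move=> c bc; have := ha c bc; have := hb c bc; rewrite edotD edotZ edotB.
move: (edot l a) (edot l b) (edot l c) => u w s h1 h2.
have := ltr_pM2l; have h3 : 0 <= t * (w - s) by rewrite mulr_ge0 // subr_ge0 ltW.
have h4 : 0 <= (1 - t) * (u - s) by rewrite mulr_ge0 // subr_ge0 // ltW.
have [te|te] := eqVneq t 0; first by rewrite te mul0r addr0.
have h5 : 0 < t * (w - s) by rewrite mulr_gt0 ?subr_gt0 // lt_def te.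
move=> _; move: h4 h5; rewrite !mulrBr mulrBl mul1r mulrBl mul1r; move: (t * u) (t * w) (t * s) => p1 p2 p3;
  clear; lra.
Qed.

Lemma fiber_hull X (r2 : R) g y l : barrier X r2 g -> e2 y < r2 -> fiber X g y l `<=` hull_domain X r2 g.
Proof.
move=> bg yr z [zy [Xz hz]]; split; first by split => //; rewrite zy.
rewrite ltNge; apply/negP => gz; have : badslice X g y (reV z).
  by split; [exact: subset_closure|rewrite -zy cvecK].
by move=> /hz; rewrite ltxx.
Qed.

Lemma fiber_connected X g y l : seg_convex X -> connected (fiber X g y l).
Proof.
move=> sX; apply: connected_pairs => a b [ay ha] [by_ hb].
exists [set u | exists2 t : R, 0 <= t <= 1 & u = a + rc t *: (b - a)]; split.
- exact: segment_connected_complex.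
- move=> _ [t /andP[t0 t1] ->].
  have ab : b - a = rv (reV b - reV a).
    apply/rowP => j; rewrite !mxE; apply: cplx_eq; rewrite ?CReD ?CImD ?CReN ?CImN /=.
      by [].
    have := congr1 (fun y : E => y 0 j) (etrans by_ (esym ay)); rewrite !mxE => ->; exact: subrr.
  split; first by rewrite ab imV_ray.
  by rewrite ab reV_ray; apply: halfpiece_seg_convex.
- by exists 0; rewrite ?lexx ?ler01 // scale0r addr0.
- by exists 1; rewrite ?lexx ?ler01 // scale1r addrC subrK.
Qed.

Lemma fiber_cover X (r2 : R) g z : (1 < n)%N -> barrier X r2 g -> seg_convex X -> compact (closure X) ->
  hull_domain X r2 g z ->
  exists2 l, l != 0 & fiber X g (imV z) l z.
Proof.
move=> n1 bg sX cX [[Xz yz] gz].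
have nb : ~ badslice X g (imV z) (reV z) by move=> [_]; rewrite cvecK leNgt gz.
have [l l0 H] := separating_form n1 (@badslice_compact X r2 g (imV z) bg cX) (badslice_seg_convex bg sX yz) nb.
by exists l.
Qed.

Lemma fiber_nonempty X (r2 : R) g y l : barrier X r2 g -> X !=set0 -> compact (closure X) -> e2 y < r2 -> l != 0 ->
  exists x, halfpiece X g y l x.
Proof.
move=> bg [x0 Xx0] cX yr l0; have [ne|ne] := pselect (badslice X g y !=set0); last first.
  by exists x0; split => // c bc; exfalso; apply: ne; exists c.
have [c bc cm] := max_on ne (@badslice_compact X r2 g y bg cX) (@edot_cont _ _ l).
have Xc := badslice_in bg yr bc; have oX := b_open bg.
have := @line_cont c l 0 X; rewrite scale0r addr0 => /(_ (open_nbhs_nbhs (conj oX Xc)))/nbhs_normP[d d0 Hd].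
have d2 : 0 < d / 2 by rewrite divr_gt0.
exists (c + (d / 2) *: l); split.
  by apply: Hd; rewrite /= sub0r normrN gtr0_norm // ltr_pdivrMr // ltr_pMr // ltr1n.
move=> c' bc'; apply: le_lt_trans (cm _ bc') _.
by rewrite edotD edotZ ltrDl mulr_gt0 // edot_e2 e2_gt0.
Qed.

(** A strict inequality over a compact set persists under small changes of y and l. *)
Lemma halfpiece_lsc X (r2 : R) g y l x : barrier X r2 g -> compact (closure X) -> halfpiece X g y l x ->
  \forall p \near (y, l), halfpiece X g p.1 p.2 x.
Proof.
move=> bg cX [Xx hx]; have hg := b_hol bg.
have := cX; rewrite compact_near_coveringP.
move=> /(_ (E * E)%type (nbhs (y, l)) (fun p c => complex.Re (g (cvec c p.1)) <= 0 -> edot p.2 c < edot p.2 x) _) H.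
have {}H : \forall p \near (y, l), forall c, closure X c -> complex.Re (g (cvec c p.1)) <= 0 ->
  edot p.2 c < edot p.2 x.
  apply: H => c cc.
  pose q0 : E * (E * E) := (c, (y, l)).
  have cf : {for q0, continuous (fun q : E * (E * E) => q.1)} by exact: cvg_fst.
  have cs : {for q0, continuous (fun q : E * (E * E) => q.2)} by exact: cvg_snd.
  have cy : {for q0, continuous (fun q : E * (E * E) => q.2.1)} by apply: (continuous_comp cs); exact: cvg_fst.
  have cl : {for q0, continuous (fun q : E * (E * E) => q.2.2)} by apply: (continuous_comp cs); exact: cvg_snd.
  have [gc|gc] := leP (complex.Re (g (cvec c y))) 0.
    have lt0 : edot l c < edot l x by apply: hx.
    have c1 : {for q0, continuous (fun q : E * (E * E) => edot q.2.2 q.1)}.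
      have c11 : {for q0, continuous (fun q : E * (E * E) => (q.2.2, q.1))} by exact: cont_pair cl cf.
      exact: (continuous_comp c11 (@edot_cont2 _)).
    have c2 : {for q0, continuous (fun q : E * (E * E) => edot q.2.2 x)}.
      have c21 : {for q0, continuous (fun q : E * (E * E) => (q.2.2, x))} by apply: cont_pair;
        [exact: cl|exact: cst_continuous].
      exact: (continuous_comp c21 (@edot_cont2 _)).
    have h0 : 0 < edot q0.2.2 x + - edot q0.2.2 q0.1 by rewrite subr_gt0.
    have := rgt_near (contRD c2 (contRN c1)) h0.
    by apply: filterS => -[c' [y' l']] /=; rewrite subr_gt0.
  have c1 : {for q0, continuous (fun q : E * (E * E) => complex.Re (g (cvec q.1 q.2.1)))}.
    apply: Re_comp_cont; have c11 : {for q0, continuous (fun q : E * (E * E) => (q.1, q.2.1))}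
      by exact: cont_pair cf cy.
    have c12 := continuous_comp c11 (@cvec_cont _).
    by apply: (continuous_comp c12); apply: differentiable_continuous; exact: hg.
  have := rgt_near c1 gc; apply: filterS => -[c' [y' l']] /= h1 h2.
  by move: (lt_le_trans h1 h2); rewrite ltxx.
by apply: filterS H => p hp; split => // c [cc gc]; exact: hp.
Qed.

Lemma connected_in_clopen (T : topologicalType) (F W B C D : set T) : connected F -> F `<=` W -> open C -> closed D ->
  B = W `&` C -> B = W `&` D -> (exists2 z, F z & B z) -> F `<=` B.
Proof.
move=> cF FW oC cD BC BD [z Fz Bz].
have E : F `&` B = F.
  apply: cF; first by exists z.
  - exists C => //; rewrite BC setIA; congr (_ `&` _); exact/setIidPl.
  - exists D => //; rewrite BD setIA; congr (_ `&` _); exact/setIidPl.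
by rewrite -E => x [].
Qed.

(** The fibers are connected and nonempty, and each contains a point whose real part is also
    that of a point of each fiber nearby. So a part of the union that is relatively open and
    closed is the union of the fibers over a set of parameters with the same property. *)
Lemma sweep_connected X (r2 : R) g y0 y1 l0 l1 : barrier X r2 g -> X !=set0 -> compact (closure X) -> seg_convex X ->
  (forall s : R, s \in `[0, 1]%R -> e2 (y0 + s *: (y1 - y0)) < r2) ->
  (forall s : R, s \in `[0, 1]%R -> l0 + s *: (l1 - l0) != 0) ->
  connected [set z | exists2 s : R, s \in `[0, 1]%R & fiber X g (y0 + s *: (y1 - y0)) (l0 + s *: (l1 - l0)) z].
Proof.
move=> bg ne cX sX Hy Hl; set W := [set z | _].
pose ys (s : R) := y0 + s *: (y1 - y0); pose ls (s : R) := l0 + s *: (l1 - l0).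
move=> B [zB Bz] [Cc oC BC] [Dc cD BD].
pose I := [set s : R | s \in `[0, 1]%R /\ exists2 z, fiber X g (ys s) (ls s) z & B z].
have FW s : s \in `[0, 1]%R -> fiber X g (ys s) (ls s) `<=` W by move=> hs z hz; exists s.
have allF s : s \in `[0, 1]%R -> (exists2 z, fiber X g (ys s) (ls s) z & B z) -> fiber X g (ys s) (ls s) `<=` B.
  by move=> hs; apply: connected_in_clopen oC cD BC BD; [exact: fiber_connected|exact: FW].
have loc s : s \in `[0, 1]%R -> exists x, [/\ fiber X g (ys s) (ls s) (cvec x (ys s)),
    {for s, continuous (fun s => cvec x (ys s))} &
    \forall s' \near s, fiber X g (ys s') (ls s') (cvec x (ys s'))].
  move=> hs; have [x hx] := fiber_nonempty bg ne cX (Hy s hs) (Hl s hs).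
  have c1 : {for s, continuous (fun s => (ys s, ls s))} by apply: cont_pair; exact: line_cont.
  exists x; split; first by split; rewrite ?imV_cvec ?reV_cvec.
    have c2 : {for s, continuous (fun s => (x, ys s))} by apply: cont_pair; [exact: cst_continuous|exact: line_cont].
    exact: (continuous_comp c2 (@cvec_cont _)).
  have n1 : \forall s' \near s, halfpiece X g (ys s') (ls s') x := c1 _ (halfpiece_lsc bg cX hx).
  apply: filterS n1 => s' hs'.
  by split; rewrite ?imV_cvec ?reV_cvec.
have locB s : I s -> \forall s' \near s, s' \in `[0, 1]%R -> I s'.
  move=> [hs hB]; have [x [f0 cx nf]] := loc s hs.
  have : Cc (cvec x (ys s)) by have := allF s hs hB _ f0; rewrite BC => -[].
  move=> Cz; have := cx _ (open_nbhs_nbhs (conj oC Cz)).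
  apply: filterS2 nf => s' h1 h2 hs'; split => //; exists (cvec x (ys s')) => //.
  by rewrite BC; split => //; exact: (FW s' hs').
have locN s : s \in `[0, 1]%R -> ~ I s -> \forall s' \near s, ~ I s'.
  move=> hs nI; have [x [f0 cx nf]] := loc s hs.
  have nD : (~` Dc) (cvec x (ys s)).
    move=> Dz; apply: nI; split => //; exists (cvec x (ys s)) => //.
    by rewrite BD; split => //; exact: (FW s hs).
  have := cx _ (open_nbhs_nbhs (conj (closed_openC cD) nD)).
  apply: filterS2 nf => s' h1 h2 [hs' hB']; apply: h2.
  by have := allF s' hs' hB' _ h1; rewrite BD => -[].
have IE : I = `[0, 1]%classic.
  apply: (@segment_connected R 0 1).
  - have : W zB by move: Bz; rewrite BC => -[].
    by move=> [s hs fz]; exists s; split => //; exists zB.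
  - exists (interior [set s : R | s \in `[0, 1]%R -> I s]); first exact: open_interior.
    apply/seteqP; split => s; first by move=> Is; split; [case: Is|exact: locB].
    by move=> [hs /nbhs_singleton]; apply.
  - exists (~` interior [set s : R | ~ I s]); first by apply: open_closedC; exact: open_interior.
    apply/seteqP; split => s.
      by move=> Is; split; [case: Is|move=> /nbhs_singleton].
    by move=> [hs hn]; apply: contrapT => nI; apply: hn; exact: locN.
apply/seteqP; split => z; first by rewrite BC => -[].
move=> [s hs fz]; have : I s by rewrite IE.
by move=> [_ hB]; exact: (allF s hs hB).
Qed.

Lemma non_multiple l : (1 < n)%N -> l != 0 -> exists l' : E, forall a : R, l' != a *: l.
Proof.
move=> n1 l0; have [j lj] : exists j, l 0 j != 0.
  apply: contrapT => H; move/eqP: l0; apply; apply/rowP => j; rewrite mxE.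
  by apply/eqP; apply: contrapT => /negP h; apply: H; exists j.
have [k kj] : exists k : 'I_n, k != j.
  have [j0 [j1 j01]] := two_indices n1.
  by have [e|e] := eqVneq j j0; [exists j1; rewrite e|exists j0; rewrite eq_sym].
exists (delta_mx 0 k) => a; apply/eqP => /rowP h.
have := h j; rewrite !mxE eqxx /= eq_sym (negbTE kj) => /esym/eqP.
rewrite mulf_eq0 (negbTE lj) orbF => /eqP a0.
by have := h k; rewrite !mxE !eqxx a0 mul0r => /eqP; rewrite oner_eq0.
Qed.

Lemma ball_seg (r2 : R) y0 y1 (s : R) : e2 y0 < r2 -> e2 y1 < r2 -> s \in `[0, 1]%R -> e2 (y0 + s *: (y1 - y0)) < r2.
Proof.
move=> h0 h1; rewrite in_itv /= => /andP[s0 s1].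
have -> : e2 (y0 + s *: (y1 - y0)) = (1 - s) * e2 y0 + s * e2 y1 - s * (1 - s) * e2 (y1 - y0).
  rewrite /e2 !mulr_sumr -big_split -sumrB /=; apply: eq_bigr => j _; rewrite !mxE; ring.
have h2 : 0 <= s * (1 - s) * e2 (y1 - y0) by rewrite !mulr_ge0 ?subr_ge0 // e2_ge0.
pose m := Num.max (e2 y0) (e2 y1); have mr : m < r2 by rewrite gt_max h0.
have h3 : (1 - s) * e2 y0 <= (1 - s) * m by rewrite ler_wpM2l ?subr_ge0 // le_max lexx.
have h4 : s * e2 y1 <= s * m by rewrite ler_wpM2l // le_max lexx orbT.
apply: le_lt_trans mr; have -> : m = (1 - s) * m + s * m by rewrite -mulrDl subrK mul1r.
by rewrite lerBlDr; apply: le_trans (lerD h3 h4) _; rewrite lerDl.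
Qed.

(** Two points are joined by moving the imaginary part and the normal of the half-space
    along segments. If the segment of normals passes through 0, it is replaced by two
    segments through a normal that is no multiple of l0; it exists since n > 1. *)
Theorem hull_domain_connected X (r2 : R) g : (1 < n)%N -> barrier X r2 g -> X !=set0 ->
  compact (closure X) -> seg_convex X ->
  connected (hull_domain X r2 g).
Proof.
move=> n1 bg ne cX sX; apply: connected_pairs => a b Ha Hb.
have [l0 l00 fa] := fiber_cover n1 bg sX cX Ha; have [l1 l10 fb] := fiber_cover n1 bg sX cX Hb.
have ya : e2 (imV a) < r2 by case: Ha => -[].
have yb : e2 (imV b) < r2 by case: Hb => -[].
pose W (y0 y1 : E) l0 l1 := [set z | exists2 s : R, s \in `[0, 1]%R &
  fiber X g (y0 + s *: (y1 - y0)) (l0 + s *: (l1 - l0)) z].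
have WH y0 y1 l l' : e2 y0 < r2 -> e2 y1 < r2 -> W y0 y1 l l' `<=` hull_domain X r2 g.
  by move=> h0 h1 z [s hs]; apply: (fiber_hull bg); exact: ball_seg.
have z01 : (0 : R) \in `[0, 1]%R by rewrite in_itv /= lexx ler01.
have o01 : (1 : R) \in `[0, 1]%R by rewrite in_itv /= lexx ler01.
have W0 y0 y1 l l' z : fiber X g y0 l z -> W y0 y1 l l' z.
  by move=> h; exists 0 => //; rewrite !scale0r !addr0.
have W1 y0 y1 l l' z : fiber X g y1 l' z -> W y0 y1 l l' z.
  by move=> h; exists 1 => //; rewrite !scale1r !(addrC y0) !(addrC l) !subrK.
have Wc y0 y1 l l' : e2 y0 < r2 -> e2 y1 < r2 -> (forall s : R, s \in `[0, 1]%R -> l + s *: (l' - l) != 0) ->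
    connected (W y0 y1 l l').
  by move=> h0 h1 hl; apply: (sweep_connected bg ne cX sX) => // s hs; exact: ball_seg.
have [hl|hl] := pselect (forall s : R, s \in `[0, 1]%R -> l0 + s *: (l1 - l0) != 0).
  exists (W (imV a) (imV b) l0 l1); split; [exact: Wc|exact: WH|exact: W0|exact: W1].
have [s [s0 s1 sl]] : exists s : R, [/\ 0 <= s, s <= 1 & l0 + s *: (l1 - l0) = 0].
  apply: contrapT => H; apply: hl => s; rewrite in_itv /= => /andP[s0 s1].
  by apply/eqP => h; apply: H; exists s.
have s00 : s != 0 by apply: contra_neq l00 => se; move: sl; rewrite se scale0r addr0.
have l1E : l1 = (- (1 - s) / s) *: l0.
  have h : s *: l1 = - (1 - s) *: l0.
    apply/eqP; rewrite -subr_eq0 -sl -[X in X - _]addr0 -[X in _ == X]addr0; apply/eqP.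
    by apply/rowP => j; rewrite !mxE; ring.
  by apply: (scalerI s00); rewrite h scalerA; congr (_ *: _); field.
have [l2 H2] := non_multiple n1 l00.
have p1 (u : R) : u \in `[0, 1]%R -> l0 + u *: (l2 - l0) != 0.
  move=> _; apply/eqP => h; have [u0|u0] := eqVneq u 0.
    by move: h; rewrite u0 scale0r addr0; apply/eqP.
  have : l2 = ((u - 1) / u) *: l0.
    have h3 : u *: l2 = (u - 1) *: l0.
      by apply/rowP => j; move/rowP/(_ j): h; rewrite !mxE => h; apply/eqP; rewrite -subr_eq0 -h; apply/eqP; ring.
    by apply: (scalerI u0); rewrite h3 scalerA; congr (_ *: _); field.
  exact/eqP/H2.
have p2 (u : R) : u \in `[0, 1]%R -> l2 + u *: (l1 - l2) != 0.
  move=> _; apply/eqP => h; have [u1|u1] := eqVneq (1 - u) 0.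
    have ue : u = 1 by apply/eqP; rewrite -subr_eq0 -oppr_eq0 opprB u1.
    by move: h; rewrite ue scale1r addrC subrK; apply/eqP.
  have : l2 = (- u / (1 - u) * (- (1 - s) / s)) *: l0.
    rewrite -scalerA -l1E.
    have h3 : (1 - u) *: l2 = - u *: l1.
      by apply/rowP => j; move/rowP/(_ j): h; rewrite !mxE => h; apply/eqP; rewrite -subr_eq0 -h; apply/eqP; ring.
    by apply: (scalerI u1); rewrite h3 scalerA; congr (_ *: _); field.
  exact/eqP/H2.
have l20 : l2 != 0 by have := H2 0; rewrite scale0r.
have [x hx] := fiber_nonempty bg ne cX yb l20.
have fx : fiber X g (imV b) l2 (cvec x (imV b)) by split; rewrite ?imV_cvec ?reV_cvec.
exists (W (imV a) (imV b) l0 l2 `|` W (imV b) (imV b) l2 l1); split.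
- apply: connectedU; [|exact: Wc|exact: Wc].
  by exists (cvec x (imV b)); split; [exact: W1|exact: W0].
- by move=> z [|]; apply: WH.
- by left; exact: W0.
- by right; exact: W1.
Qed.

End Connected.

(** * The entire function of a special barrier *)

Section Bridge.
Variables (R : realType) (n : nat).
Notation C := (Cx R).
Notation rc x := (real_complex R x : Cx R).
Notation V := 'rV[C]_n.
Notation E := 'rV[R]_n.
Implicit Types (x y e : E) (z w : V) (X : set E) (rho : R).

Lemma ball_e2 rho y : 0 < rho -> eball 0 rho y <-> e2 y < rho ^+ 2.
Proof.
move=> r0; rewrite /eball /= subr0 -enorm2.
by rewrite ltr_pXn2r // nnegrE; [exact: sqrtr_ge0|exact: ltW].
Qed.

(** A point y of the sphere is the limit of the points (1 - s) y. *)
Lemma closed_ball_e2 rho y : 0 < rho -> closure (eball 0 rho) y <-> e2 y <= rho ^+ 2.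
Proof.
move=> r0; split=> [cy|hy].
  have cl : closed [set y : E | e2 y <= rho ^+ 2] by apply: closed_sublevel => v; exact: e2_cont.
  have sub : eball 0 rho `<=` [set y : E | e2 y <= rho ^+ 2] by move=> v /(ball_e2 v r0) /ltW.
  by have := closureS sub cy; rewrite -(proj1 (closure_id _) cl).
move=> P /enbhsP[d d0 HP]; have N0 : 0 <= `|y| by [].
have D0 : 0 < d + `|y| by rewrite ltr_wpDr.
pose s := d / (d + `|y|); have s0 : 0 < s by rewrite divr_gt0.
have s1 : s <= 1 by rewrite ler_pdivrMr // mul1r lerDl.
exists ((1 - s) *: y); split.
  apply/ball_e2 => //; rewrite e2Z; have r2 : 0 < rho ^+ 2 by rewrite exprn_gt0.
  apply: (@le_lt_trans _ _ ((1 - s) ^+ 2 * rho ^+ 2)); first by rewrite ler_wpM2l // sqr_ge0.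
  rewrite -[ltRHS]mul1r ltr_pM2r //; move: s0 s1; clear; move: s => s; nra.
apply: HP => j; rewrite !mxE.
have -> : (1 - s) * y 0 j - y 0 j = - (s * y 0 j) by ring.
rewrite normrN normrM gtr0_norm //; apply: (@le_lt_trans _ _ (s * `|y|)).
  by rewrite ler_wpM2l ?entry_le // ltW.
rewrite /s mulrAC ltr_pdivrMr // ltr_pM2l //; move: d0 N0; clear; move: `|y| => a; lra.
Qed.

Lemma boundary_open X x : open X -> boundary X x <-> closure X x /\ ~ X x.
Proof.
move=> oX; split=> -[cx nx]; split => // h; apply: nx; last exact: interior_subset h.
by apply: open_nbhs_nbhs; split.
Qed.

Lemma ball_open rho : 0 < rho -> open (eball (0 : E) rho).
Proof.
move=> r0; rewrite openE => y /(ball_e2 y r0) h.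
have := rlt_near (@e2_cont _ _ y) h; apply: filterS => v; by move/(ball_e2 v r0).
Qed.

Lemma sphere_e2 rho y : 0 < rho -> boundary (eball 0 rho) y <-> e2 y = rho ^+ 2.
Proof.
move=> r0; split=> [/(boundary_open y (ball_open r0))[]|h].
  move/(closed_ball_e2 y r0) => h1 h2; apply/eqP; rewrite eq_le h1 /= leNgt; apply/negP => h.
  by apply: h2; apply/ball_e2.
apply/(boundary_open y (ball_open r0)); split; first by apply/closed_ball_e2 => //; rewrite h.
by move/(ball_e2 y r0); rewrite h ltxx.
Qed.

Lemma compact_closure X : bounded_set X -> compact (closure X).
Proof.
move=> bX; apply: bounded_closed_compact; last exact: closed_closure.
have [M [_ HM]] := bX; exists M; split=> [|M' hM x cx]; first exact: num_real.
have cl : closed [set x : E | `|x| <= M'] by apply: closed_sublevel => v; exact: norm_continuous.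
have sub : X `<=` [set x : E | `|x| <= M'] by move=> v Xv; exact: HM.
by have := closureS sub cx; rewrite -(proj1 (closure_id _) cl).
Qed.

Lemma Re_dotC_self x y : complex.Re (dotC (cvec x y) (cvec x y)) = e2 x - e2 y.
Proof.
rewrite /dotC /e2 Re_sum -sumrB; apply: eq_bigr => j _.
by rewrite CReM !mxE /= !expr2.
Qed.

Lemma hol_sq : hol setT (fun z : V => dotC z z).
Proof. by apply: hol_sum => j; apply: hol_mul; exact: hol_coord. Qed.

Definition fence_eq rho (alpha : E -> R) (f : E -> E -> R) (g : V -> C) := forall x y,
  enorm x ^+ 2 - (alpha x + f x y) = complex.Re (g (cvec x y)) + (e2 y - rho ^+ 2).

(** Since Re z.z = |x|^2 - |y|^2, the function g z = z.z - F z + rho^2 has the required real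
    part. *)
Lemma fence_function rho alpha f X : (1 < n)%N -> 0 < rho -> special_barrier (eball 0 rho) alpha f ->
  convex_initial_domain (eball 0 rho) alpha f X ->
  exists g : V -> C, barrier X (rho ^+ 2) g /\ fence_eq rho alpha f g.
Proof.
move=> n1 r0 [_ [F [hF _ HF]] pd] [[oX cX neX] bX C2 sc he].
pose g z : C := dotC z z + (- F z + rc (rho ^+ 2)); exists g.
have hg : hol setT g.
  apply: hol_add; first exact: hol_sq.
  by apply: hol_add; [move=> z _; apply: differentiableN; exact: hF|exact: hol_cst].
have gE : fence_eq rho alpha f g.
  by move=> x y; rewrite /g !CReD CReN Re_dotC_self HF enorm2 /=; ring.
have rp : realpos (rho ^+ 2) g.
  move=> z hz e e0; rewrite -(cvecK z).
  apply: (posdef_hess (c := e2 (imV z) - rho ^+ 2) hg _ _ e0).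
    by move=> x; exact: (gE x (imV z)).
  by apply: pd; apply/ball_e2.
split=> //; split => //.
- have cc := compact_closure bX; have ne : closure X !=set0.
    by have [x Xx] := neX; exists x; exact: subset_closure.
  have [c _ Hc] := max_on ne cc (@e2_cont R n); by exists (e2 c).
- move=> z cz nXz hz; rewrite ltNge; apply/negP => h.
  have : (fence (eball 0 rho) alpha f `&` tube (boundary X) (closure (eball 0 rho))) z.
    have hy : closure (eball 0 rho) (imV z) by apply/closed_ball_e2.
    split; split => //; last by apply/boundary_open.
    rewrite -subr_le0 gE cvecK; move: h; clear; gen_Re; lra.
  by rewrite he.
- by apply: tube_slice => //; exact: tietze.
Qed.

Lemma tube_ball rho X : 0 < rho -> tube X (eball 0 rho) = open_tube X (rho ^+ 2).
Proof. by move=> r0; apply/seteqP; split => z [h /(ball_e2 _ r0) h2]; split. Qed.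

Section Sets.
Variables (rho : R) (alpha : E -> R) (f : E -> E -> R) (X : set E) (g : V -> C).
Local Notation gspec := (fence_eq rho alpha f g).

Lemma fence_g z : gspec -> 0 < rho -> fence (eball 0 rho) alpha f z <->
  e2 (imV z) <= rho ^+ 2 /\ complex.Re (g z) <= rho ^+ 2 - e2 (imV z).
Proof.
move=> gE r0; have H (a b c : R) : (a + (b - c) <= 0) = (a <= c - b).
  by rewrite -[RHS]subr_le0 opprB addrA addrAC.
rewrite /fence /= -subr_le0 gE cvecK H; split => -[h1 h2]; split => //; exact/(closed_ball_e2 _ r0).
Qed.

Lemma special_domain_core : gspec -> 0 < rho ->
  tube X (eball 0 rho) `\` fence (eball 0 rho) alpha f = core_domain X (rho ^+ 2) g.
Proof.
move=> gE r0; rewrite tube_ball //; apply/seteqP; split => z [Dz h]; split => //.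
  rewrite ltNge; apply/negP => hz; apply: h; apply/fence_g => //; split => //; by case: Dz => _ /ltW.
by move/(fence_g z gE r0) => [_]; rewrite leNgt h.
Qed.

Lemma fence_edge : gspec -> 0 < rho ->
  fence (eball 0 rho) alpha f `&` tube X (boundary (eball 0 rho)) = edge X (rho ^+ 2) g.
Proof.
move=> gE r0; apply/seteqP; split => z.
  by move=> [/(fence_g z gE r0)[_ h] [Xz /(sphere_e2 _ r0) e]]; split => //; split => //; move: h; rewrite e subrr.
move=> [Xz [e h]]; split; first by apply/fence_g => //; rewrite e subrr.
by split => //; apply/sphere_e2.
Qed.

Lemma hull_complement : (1 < n)%N -> barrier X (rho ^+ 2) g ->
  open_tube X (rho ^+ 2) `\` poly_hull (edge X (rho ^+ 2) g) = hull_domain X (rho ^+ 2) g.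
Proof.
move=> n1 bg; apply/seteqP; split => z [Dz h]; split => //.
  rewrite ltNge; apply/negP => hz; apply: h => p.
  have [w Kw hw] := hull_contains_fence n1 bg (@hol_peval R n setT p) Dz hz; exists w => //.
  by rewrite !normE lecR.
move=> hz; have [p hp] := hull_avoids bg Dz h; have [w Kw] := hz p.
by rewrite !normE lecR leNgt => /negP; apply; exact: hp.
Qed.
End Sets.
End Bridge.

(** * Riemann domains and schlicht envelopes *)

Section RiemannDomain.
Variables (R : realType) (n : nat).
Notation C := (Cx R).
Notation rc x := (real_complex R x : Cx R).
Notation V := 'rV[C]_n.
Notation E := 'rV[R]_n.
Implicit Types (z w : V) (S W : set V) (M N : riemann_domain R n).

Lemma rd_holomorphic_mulB M (h : M -> C) (u : V -> C) (c : C) : rd_holomorphic h -> hol setT u ->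
  rd_holomorphic (fun q => h q * u (rd_proj q) + c).
Proof.
move=> hh hu p; have [k dk Hk] := hh p; exists (fun z => k z * u z + c).
  apply: filterS dk => z dz; apply: differentiableD; last exact: differentiable_cst.
  by apply: differentiableM => //; exact: hu.
by apply: filterS Hk => q ->.
Qed.

(** The set where k vanishes locally is open; it is closed because the identity principle
    identity_closure applies to the local representation of k in a chart, that is, on an
    open set where the projection is injective. *)
Lemma rd_identity M (k : M -> C) (p0 : M) : rd_holomorphic k -> (\forall q \near p0, k q = 0) ->
  forall q, k q = 0.
Proof.
move=> hk k0; pose A := [set p : M | \forall q \near p, k q = 0].
have oA : open A by rewrite openE => p Ap; exact: (nbhs_interior Ap).
suff AT : A = setT by move=> q; have : A q by [rewrite AT]; exact: nbhs_singleton.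
have cA : closed A.
  move=> p cp; have [g dg kg] := hk p; have [pc lh] := rd_local_homeo M.
  have [U [oU Up injU openU]] := lh p.
  have /(@near_rnormP _ V)[s s0 Hs] := dg.
  pose B (e : R) := [set w : V | rnorm (w - rd_proj p) < e].
  have nB (e : R) : 0 < e -> nbhs (rd_proj p) (B e).
    by move=> e0; apply/(@near_rnormP _ V); exists e => // w.
  have nW (e : R) : 0 < e -> nbhs p (U `&` [set q | k q = g (rd_proj q)] `&` (@rd_proj R n M) @^-1` B e).
    move=> e0; apply: filterI; last exact: (pc p _ (nB _ e0)).
    by apply: filterI => //; apply: open_nbhs_nbhs; split.
  have holB : hol (B s) g by move=> w; exact: Hs.
  have oB : open (B s) by exact: open_ball0.
  have Bp : B s (rd_proj p) by rewrite /B /= subrr rnorm0.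
  have H : forall e : R, 0 < e -> exists2 u, rnorm (u - rd_proj p) < e & \forall w \near u, g w = 0.
    move=> e e0; pose T := U `&` [set q | k q = g (rd_proj q)] `&` (@rd_proj R n M) @^-1` B e.
    have [q [Aq Tq]] := cp _ (nbhs_interior (nW _ e0)); have [_ Bq] := interior_subset Tq.
    exists (rd_proj q) => //; pose W' := A `&` interior T.
    have oW' : open W' by apply: openI => //; exact: open_interior.
    have W'U : W' `<=` U by move=> t [_ /interior_subset[[]]].
    have := openU _ oW' W'U; rewrite openE => /(_ (rd_proj q)).
    have hq : (@rd_proj R n M @` W') (rd_proj q) by exists q.
    move=> /(_ hq); apply: filterS => w [t [At /interior_subset[[_ kt] _]] <-].
    by rewrite -kt; exact: nbhs_singleton At.
  have g0 := identity_closure oB holB Bp H.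
  have nk := pc p _ g0; rewrite /A /=; apply: filterS2 kg nk => q -> ; exact.
apply: (@rd_connected R n M A); first by exists p0.
- by exists A; rewrite ?setTI.
- by exists A; rewrite ?setTI.
Qed.

(** The points q and kappa (rd_proj q) have the same projection and, by continuity of kappa,
    lie in one set on which the projection is injective. *)
Lemma embedding_onto S M (kappa : V -> M) z0 : open S -> S z0 -> holomorphic_extension S kappa ->
  \forall q \near kappa z0, S (rd_proj q) /\ kappa (rd_proj q) = q.
Proof.
move=> oS Sz0 [pk ck _]; have [pc lh] := rd_local_homeo M.
have [U [oU Uk injU _]] := lh (kappa z0).
have nU : nbhs (kappa z0) U by apply: open_nbhs_nbhs; split.
have nO : nbhs (rd_proj (kappa z0)) (S `&` kappa @^-1` U).
  rewrite pk //; apply: filterI; first by apply: open_nbhs_nbhs; split.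
  exact: ck.
have nk := pc (kappa z0) _ nO; apply: filterS2 nU nk => q Uq [Sq Ukq]; split => //.
apply: injU; rewrite ?inE //; exact: pk.
Qed.

(** The extension of 1 / u times u is 1 on the image of S, hence everywhere. *)
Lemma extension_nonvanishing S M (kappa : V -> M) (u : V -> C) : open S -> S !=set0 ->
  holomorphic_extension S kappa -> hol setT u -> (forall z, S z -> u z != 0) ->
  forall q : M, u (rd_proj q) != 0.
Proof.
move=> oS [z0 Sz0] hx hu u0 q; have nk := embedding_onto oS Sz0 hx; have [pk ck ext] := hx.
have hi : holomorphic_on S (fun z => (u z)^-1) by move=> z Sz; apply: differentiableV; [exact: hu|exact: u0].
have [h hh hE] := ext _ hi.
have := rd_identity (p0 := kappa z0) (rd_holomorphic_mulB (-1) hh hu).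
have near0 : \forall q \near kappa z0, h q * u (rd_proj q) + -1 = 0.
  apply: filterS nk => p [Sp kp]; rewrite -{1}kp hE // mulVf ?u0 //; exact: subrr.
move=> /(_ near0 q) e; apply/eqP => uq; move/eqP: e; rewrite uq mulr0 add0r oppr_eq0.
by rewrite oner_eq0.
Qed.

(** The set of agreement is closed because N is Hausdorff, and open because the projection
    of N is locally injective. *)
Lemma lift_unique M N (f1 f2 : M -> N) p0 : continuous f1 -> continuous f2 ->
  (forall p, rd_proj (f1 p) = rd_proj p) -> (forall p, rd_proj (f2 p) = rd_proj p) -> f1 p0 = f2 p0 ->
  forall p, f1 p = f2 p.
Proof.
move=> c1 c2 e1 e2 e0; pose A := [set p : M | f1 p = f2 p].
suff AT : A = setT by move=> p; have : A p by rewrite AT.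
have oA : open A.
  rewrite openE => p Ap; have [_ lh] := rd_local_homeo N.
  have [U [oU Up injU _]] := lh (f1 p).
  have n1 : nbhs p (f1 @^-1` U) by apply: c1; apply: open_nbhs_nbhs; split.
  have n2 : nbhs p (f2 @^-1` U).
    by apply: c2; apply: open_nbhs_nbhs; split => //; have -> : f2 p = f1 p by [].
  rewrite /interior; apply: filterS2 n1 n2 => q U1 U2.
  by apply: injU; rewrite ?inE // e1 e2.
have cA : closed A.
  move=> p cp; apply: (rd_hausdorff (r := N)) => P Q nP nQ.
  have n12 : nbhs p (f1 @^-1` P `&` f2 @^-1` Q) by apply: filterI; [exact: c1|exact: c2].
  by have [q [Aq [Pq Qq]]] := cp _ n12; exists (f1 q); split => //; rewrite Aq.
apply: (@rd_connected R n M A); first by exists p0.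
- by exists A; rewrite ?setTI.
- by exists A; rewrite ?setTI.
Qed.

Section Domain.
Variable W : set V.

Lemma sub_val_cont : continuous (set_val : set_type W -> V).
Proof. exact: initial_continuous. Qed.

Lemma sub_openP (O : set (set_type W)) : open O -> exists2 Q : set V, open Q & set_val @^-1` Q = O.
Proof. by move=> [Q oQ QO]; exists Q. Qed.

Lemma sub_hausdorff : hausdorff_space (set_type W).
Proof.
move=> p q cl; apply: val_inj; apply: (@norm_hausdorff C V) => A B nA nB.
have [t [At Bt]] := cl _ _ (sub_val_cont nA) (sub_val_cont nB).
by exists (set_val t).
Qed.

Lemma sub_connected : connected W -> connected [set: set_type W].
Proof.
move=> cW B [b Bb] [Q1 oO BO] [F cF BF].
have [Q oQ QO] := sub_openP oO; have [Q' oQ' QO'] := sub_openP (closed_openC cF).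
have H : W `&` Q = W.
  apply: cW.
  - exists (set_val b); split; first exact: set_valP.
    by move: Bb; rewrite BO => -[_]; rewrite -QO.
  - by exists Q.
  - exists (~` Q'); first exact: open_closedC.
    apply/seteqP; split => z [Wz h]; split => //.
      move=> Q'z; have : (~` F) (exist _ z (mem_set Wz) : set_type W) by rewrite -QO'.
      apply; have : B (exist _ z (mem_set Wz) : set_type W) by rewrite BO; split => //; rewrite -QO.
      by rewrite BF => -[].
    have : F (exist _ z (mem_set Wz) : set_type W).
      apply: contrapT => nF; apply: h; have : (~` F) (exist _ z (mem_set Wz) : set_type W) by [].
      by rewrite -QO'.
    move=> Fz; have : B (exist _ z (mem_set Wz) : set_type W) by rewrite BF.
    by rewrite BO => -[_]; rewrite -QO.
rewrite BO setTI -QO; apply/seteqP; split => // t _ /=.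
have : W (set_val t) by exact: set_valP.
by rewrite -{1}H => -[].
Qed.

Lemma sub_local_homeo : open W -> local_homeo (set_val : set_type W -> V).
Proof.
move=> oW; split; first exact: sub_val_cont.
move=> p; exists setT; split; [exact: openT|by []|by move=> a b _ _ /val_inj|].
move=> O oO _; have [Q oQ <-] := sub_openP oO.
have -> : set_val @` (set_val @^-1` Q : set (set_type W)) = W `&` Q.
  apply/seteqP; split => [z [t Qt <-]|z [Wz Qz]]; first by split => //; exact: set_valP.
  by exists (exist _ z (mem_set Wz) : set_type W).
exact: openI.
Qed.

Definition sub_domain (oW : open W) (cW : connected W) : riemann_domain R n :=
  @RiemannDomain R n (set_type W) set_val sub_hausdorff (sub_connected cW) (sub_local_homeo oW).

Definition sub_embed (t0 : set_type W) (z : V) : set_type W :=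
  if pselect (W z) is left Wz then exist _ z (mem_set Wz) else t0.

Lemma sub_embedK t0 z : W z -> set_val (sub_embed t0 z) = z.
Proof. by rewrite /sub_embed; case: pselect. Qed.

Lemma sub_embed_cont t0 z : open W -> W z -> {for z, continuous (sub_embed t0)}.
Proof.
move=> oW Wz P nP.
have [Q1 [/sub_openP[Q oQ <-] /=]] : exists2 B, open_nbhs (sub_embed t0 z) B & B `<=` P.
  by have := nP; rewrite nbhsE.
rewrite sub_embedK // => Qz OP.
have nWQ : nbhs (z : V) (W `&` Q) by apply: open_nbhs_nbhs; split => //; exact: openI.
suff : nbhs (z : V) (sub_embed t0 @^-1` P) by [].
by apply: filterS nWQ => w [Ww Qw]; apply: OP; rewrite /= sub_embedK.
Qed.
End Domain.

(** W with its inclusion is an extension by hypothesis. Any other extension projects into W,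
    as an entire function without zeros on S has no zeros on the extension; so the
    projection is the map into W. If D is another envelope, the maps between D and W are
    inverse to each other by uniqueness of lifts. *)
Theorem schlicht_envelope S W : open S -> S !=set0 -> S `<=` W -> open W -> connected W ->
  (forall h, hol S h -> exists2 k, hol W k & forall z, S z -> k z = h z) ->
  (forall z, ~ W z -> exists u, [/\ hol setT u, u z = 0 & forall w, S w -> u w != 0]) ->
  (exists (D : riemann_domain R n) (iota : V -> D), is_envelope S iota) /\
  (forall (D : riemann_domain R n) (iota : V -> D), is_envelope S iota ->
     schlicht D /\ range (@rd_proj R n D) = W).
Proof.
move=> oS neS SW oW cW ext bar; have [z0 Sz0] := neS.
pose D0 := sub_domain oW cW; pose w0 : set_type W := exist _ z0 (mem_set (SW _ Sz0)).
pose io : V -> D0 := sub_embed w0.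
have ex0 : holomorphic_extension S io.
  split.
  - by move=> z Sz; apply: sub_embedK; exact: (SW z Sz).
  - by move=> z Sz; apply: sub_embed_cont => //; exact: (SW z Sz).
  - move=> h hh; have [k hk kE] := ext h hh; exists (fun q : D0 => k (rd_proj q)).
      move=> p; exists k; last by apply: filterE => q.
      have : nbhs (rd_proj p : V) W by apply: open_nbhs_nbhs; split => //; exact: set_valP.
      by apply: filterS => z Wz; exact: hk.
    by move=> z Sz; rewrite [rd_proj _]sub_embedK ?kE //; exact: (SW z Sz).
have univ M (ka : V -> M) : holomorphic_extension S ka -> exists phi : M -> D0,
    [/\ continuous phi, forall q, rd_proj (phi q) = rd_proj q & forall z, S z -> phi (ka z) = io z].
  move=> hx; have inW (q : M) : W (rd_proj q).
    apply: contrapT => nW; have [u [hu uq us]] := bar _ nW.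
    by have := extension_nonvanishing oS neS hx hu us q; rewrite uq eqxx.
  exists (fun q => io (rd_proj q)); split.
  - move=> q; apply: (@continuous_comp _ _ _ (@rd_proj R n M) io q).
      by have [c _] := rd_local_homeo M; exact: c.
    by apply: sub_embed_cont.
  - by move=> q; exact: sub_embedK.
  - by move=> z Sz; have [pk _ _] := hx; rewrite pk.
split; first by exists D0, io; split.
move=> D iota [hx un]; have [psi [cpsi ppsi psiE]] := un D0 io ex0.
have [phi [cphi pphi phiE]] := univ D iota hx.
have cpp : continuous (psi \o phi).
  by move=> q; apply: continuous_comp; [exact: cphi|exact: cpsi].
have K q : psi (phi q) = q.
  apply: (@lift_unique D D (psi \o phi) id (iota z0)) => //.
  - by move=> p t; exact.
  - by move=> p /=; rewrite ppsi.
  - by rewrite /= phiE // psiE.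
split.
  move=> p q pq; rewrite -(K p) -(K q); congr psi; apply: val_inj.
  by have := pphi p; rewrite pq -(pphi q).
apply/seteqP; split => [w [q _ <-]|w Ww].
  by rewrite -(pphi q); exact: set_valP.
by exists (psi (io w)) => //; rewrite ppsi; exact: sub_embedK.
Qed.
End RiemannDomain.

(** * The envelope of the special domain *)

Section Main.
Variables (R : realType) (n : nat).
Notation C := (Cx R).
Notation V := 'rV[C]_n.
Notation E := 'rV[R]_n.
Implicit Types (z w : V) (l x y : E) (X : set E).

Lemma Re_dotC_rv l z : complex.Re (dotC (rv l) z) = edot l (reV z).
Proof.
by rewrite /dotC /edot Re_sum; apply: eq_bigr => j _; rewrite !mxE ReMrc.
Qed.

Lemma Im_dotC_rv l z : complex.Im (dotC (rv l) z) = edot l (imV z).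
Proof.
rewrite /dotC /edot (big_morph (@complex.Im R) (@CImD R) (erefl : complex.Im (0 : C) = 0)).
by apply: eq_bigr => j _; rewrite !mxE CImM /= mul0r addr0.
Qed.

Lemma hol_dotC (b : V) (c : C) : hol setT (fun z => dotC b z + c).
Proof.
apply: hol_add; last exact: hol_cst.
by apply: hol_sum => j; apply: hol_mul; [exact: hol_cst|exact: hol_coord].
Qed.

Lemma edot_le l y : edot l y <= (e2 l + e2 y) / 2.
Proof.
rewrite /edot /e2 -big_split /= mulr_suml; apply: ler_sum => j _.
have := sqr_ge0 (l 0 j - y 0 j); rewrite sqrrB; move: (l 0 j) (y 0 j) => a b; clear; lra.
Qed.

(** Over a point outside X take a supporting linear form, whose real part separates; over
    |y|^2 >= r2 take the linear form with coefficients y, whose imaginary part separates by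
    the Cauchy-Schwarz inequality; otherwise Re g <= 0 at z, while Re g > r2 - |y|^2 > 0 on
    the core, and g minus its value at z will do. *)
Lemma hull_barrier X r2 (g : V -> C) z : (1 < n)%N -> barrier X r2 g -> C2_boundary X -> seg_convex X ->
  compact (closure X) -> ~ hull_domain X r2 g z ->
  exists u, [/\ hol setT u, u z = 0 & forall w, core_domain X r2 g w -> u w != 0].
Proof.
move=> n1 bg C2 sX cX nz; have [oX _ hg _ _ _] := bg.
have Re0 (c : C) : complex.Re c != 0 -> c != 0 by apply: contra => /eqP ->.
have Im0 (c : C) : complex.Im c != 0 -> c != 0 by apply: contra => /eqP ->.
have [Xz|nX] := pselect (X (reV z)); last first.
  have [l Hl] := supporting_form n1 oX C2 sX cX nX.
  exists (fun w => dotC (rv l) w + - dotC (rv l) z); split; [exact: hol_dotC|exact: subrr|].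
  move=> w [[Xw _] _]; apply: Re0; rewrite CReD CReN !Re_dotC_rv subr_eq0.
  by apply/eqP => e; have := Hl _ Xw; rewrite e ltxx.
have [yz|yz] := ltP (e2 (imV z)) r2; last first.
  exists (fun w => dotC (rv (imV z)) w + - dotC (rv (imV z)) z); split; [exact: hol_dotC|exact: subrr|].
  move=> w [[_ yw] _]; apply: Im0; rewrite CImD CImN !Im_dotC_rv subr_eq0 edot_e2.
  apply/eqP => e; have := edot_le (imV z) (imV w); rewrite e.
  by move: yz yw; move: (e2 (imV z)) (e2 (imV w)) => a b; clear; lra.
have gz : complex.Re (g z) <= 0 by rewrite leNgt; apply/negP => h; apply: nz.
exists (fun w => g w + - g z); split; [|exact: subrr|].
  by apply: hol_add => //; exact: hol_cst.
move=> w [[_ yw] gw]; apply: Re0; rewrite CReD CReN subr_eq0; apply/eqP => e.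
by move: gw yw gz; rewrite e; move: (complex.Re (g z)) (e2 _) => a b; clear; lra.
Qed.

End Main.

Theorem theorem5p2 (R : realType) (n : nat) (rho : R)
    (alpha : 'rV[R]_n -> R) (f : 'rV[R]_n -> 'rV[R]_n -> R)
    (X : set 'rV[R]_n) :
  let Y := eball 0 rho in
  let D := tube X Y in
  let K := fence Y alpha f in
  let Kb := K `&` tube X (boundary Y) in
  let S := D `\` K in
  (2 <= n)%N -> 0 < rho ->
  special_barrier Y alpha f ->
  convex_initial_domain Y alpha f X ->
  (exists (E : riemann_domain R n) (iota : 'rV[Cx R]_n -> E),
     is_envelope S iota) /\
  (forall (E : riemann_domain R n) (iota : 'rV[Cx R]_n -> E),
     is_envelope S iota ->
     schlicht E /\ range (@rd_proj R n E) = D `\` poly_hull Kb).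
Proof.
move=> Y D K Kb S n1 r0 sb cid; have [g [bg gE]] := fence_function n1 r0 sb cid.
have [[oX cX neX] bX C2 sc _] := cid; have cc := compact_closure bX.
have sX := tietze oX cX C2 sc; have r2 : 0 < rho ^+ 2 by rewrite exprn_gt0.
rewrite /S /D /K /Kb /Y (special_domain_core X gE r0) (fence_edge X gE r0) tube_ball //.
rewrite (hull_complement n1 bg); apply: schlicht_envelope.
- exact: core_domain_open.
- exact: core_domain_nonempty.
- move=> z [Dz gz]; split => //; apply: le_lt_trans gz; rewrite subr_ge0; by case: Dz => _ /ltW.
- exact: hull_domain_open.
- exact: hull_domain_connected.
- by move=> h hh; exact: extension.
- by move=> z nz; exact: hull_barrier.
Qed.
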